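(* Let $n\ge 1$. For any zigzag set of rectangulations $\mathcal{C}_n\subseteq\mathcal{R}_n$, Algorithm M$^\square$ (with input $\mathcal{C}_n$) visits every rectangulation from $\mathcal{C}_n$ exactly once, in the order $J^\square(\mathcal{C}_n)$ defined by Algorithm J$^\square$.
   Context: **Rectangulations.** A (generic) rectangulation is a partition of an axis-aligned rectangle into finitely many interior-disjoint axis-aligned rectangles such that no four rectangles of the partition have a point in common. Rectangle $r$ is left of $s$ (and $s$ right of $r$) if the right side of $r$ and the left side of $s$ intersect in a line segment (not just a point); $r$ is below $s$ (and $s$ above $r$) if the top side of $r$ and the bottom side of $s$ intersect in a line segment. Rectangulations are considered up to equivalence preserving the left/right and below/above relations. $\mathcal{R}_n$ is the set of rectangulations with $n$ rectangles, and $\square$ is the unique element of $\mathcal{R}_1$. A vertex is a corner of a rectangle of the partition, an edge is a minimal line segment between two vertices, a wall is a maximal line segment between two vertices that are not corners of the rectangulation. Every vertex that is not a corner of the rectangulation is a T-joint of type $\vdash$ (stem to the right), $\dashv$ (stem to the left), $\top$ (stem down) or $\bot$ (stem up). **Deletion.** For $R\in\mathcal{R}_n$, $n\ge2$, let $r$ be its bottom-right rectangle. If the top-left vertex of $r$ has type $\vdash$, slide the top side of $r$ (a wall) downwards until it merges with the bottom side of $r$; if it has type $\top$, slide the left side of $r$ (a wall) to the right until it merges with the right side of $r$. The result is $p(R)\in\mathcal{R}_{n-1}$. The rectangles of $R$ are named $r_n,r_{n-1},\dots,r_1$ in the order in which repeated deletion removes them, and $R^{[i]}:=p^{n-i}(R)$.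 **Insertion.** For a rectangulation $R$, choose one interior point on every edge forming the left side of a rectangle touching the bottom boundary of $R$ (vertical insertion points), and one interior point on every edge forming the top side of a rectangle touching the right boundary of $R$ (horizontal insertion points). Order the vertical insertion points lexicographically by $(x,y)$-coordinates, followed by the horizontal ones ordered lexicographically by $(y,x)$-coordinates; this gives $I(R)=(q_1,\dots,q_\nu)$ with $\nu=\nu(R)$. For $R\in\mathcal{R}_{n-1}$ define $c_i(R)\in\mathcal{R}_n$ as follows. If $q_i$ is vertical, insert a new rectangle $r_n$ in the bottom-right corner that has above it exactly the rectangles of $R$ that lie to the right of $q_i$ and touch the bottom boundary, and to its left exactly the rectangles of $R$ that touch the vertical segment through $q_i$ (from the left) below $q_i$. If $q_i$ is horizontal, insert $r_n$ in the bottom-right corner such that it has to its left exactly the rectangles of $R$ that lie below $q_i$ and touch the right boundary, and above it exactly the rectangles of $R$ that touch the horizontal segment through $q_i$ (from above) to the right of $q_i$. $R$ is bottom-based if some rectangle has as its bottom side the entire bottom boundary of $R$, and right-based if some rectangle has as its right side the entire right boundary of $R$. **Jumps.** For $R,R'\in\mathcal{R}_n$, $2\le j\le n$, $d>0$, $R'$ differs from $R$ by a right jump of rectangle $r_j$ by $d$ steps if either (1) $j=n$, $p(R)=p(R')=:P$, and $R=c_k(P)$, $R'=c_{k+d}(P)$ for some $k>0$; or (2) $j<n$, $R$ and $R'$ are both bottom-based or both right-based, and $p(R')$ differs from $p(R)$ by a right jump of $r_j$ by $d$ steps. A left jump is defined analogously with $c_{k-d}$ in place of $c_{k+d}$. For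 $\mathcal{C}_n\subseteq\mathcal{R}_n$ put $\mathcal{C}_j:=\{p^{n-j}(R)\mid R\in\mathcal{C}_n\}$. A right jump of $r_j$ is minimal w.r.t. $\mathcal{C}_n$ if, when the recursion in (2) reaches condition (1) (for rectangulations with $j$ rectangles), there is no $\ell$ with $k<\ell<k+d$ and $c_\ell(P)\in\mathcal{C}_j$; for left jumps replace $k<\ell<k+d$ by $k-d<\ell<k$. The jumps performed by the algorithms below lead to rectangulations in $\mathcal{C}_n$. **Zigzag sets.** $\mathcal{C}_n\subseteq\mathcal{R}_n$ is zigzag if either $n=1$ and $\mathcal{C}_1=\{\square\}$, or $n\ge2$, $\mathcal{C}_{n-1}:=\{p(R)\mid R\in\mathcal{C}_n\}$ is zigzag, and for every $R\in\mathcal{C}_{n-1}$ we have $c_1(R)\in\mathcal{C}_n$ and $c_{\nu(R)}(R)\in\mathcal{C}_n$. $\mathrm{id}_n^\square$ denotes the rectangulation consisting of $n$ rectangles placed side by side (all walls vertical). **Algorithm J$^\square$.** (J1) Visit the initial rectangulation $R_0$. (J2) Generate an unvisited rectangulation from $\mathcal{C}_n$ by performing a minimal jump (w.r.t. $\mathcal{C}_n$) of the rectangle with largest possible index in the most recently visited rectangulation. If no such jump exists, or the jump direction is ambiguous (both a left and a right minimal jump of that rectangle lead to an unvisited element of $\mathcal{C}_n$), terminate. Otherwise visit this rectangulation and repeat J2. $J^\square(\mathcal{C}_n)$ denotes the sequence of rectangulations visited when $R_0=\mathrm{id}_n^\square$. **Algorithm M$^\square$.** Maintains the current rectangulation $R$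 and arrays $o=(o_1,\dots,o_n)$, $s=(s_1,\dots,s_n)$. (M1) Set $R\gets \mathrm{id}_n^\square$, and $o_j\gets$ left, $s_j\gets j$ for $j=1,\dots,n$. (M2) Visit the current rectangulation $R$. (M3) Set $j\gets s_n$, and terminate if $j=1$. (M4) In the current rectangulation $R$, perform a jump of rectangle $r_j$ that is minimal w.r.t. $\mathcal{C}_n$, in direction $o_j$. (M5) Set $s_n\gets n$. If $o_j=$ left and $R^{[j]}$ is bottom-based set $o_j\gets$ right, or if $o_j=$ right and $R^{[j]}$ is right-based set $o_j\gets$ left, and in both cases set $s_j\gets s_{j-1}$ and then $s_{j-1}\gets j-1$. Go back to M2. *)

(* Defs.v *)
(* MathComp, with the classical layer of MathComp-Analysis. Rectangulations
   live in the plane over an arbitrary ordered field F, e.g. the reals. *)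
From HB Require Import structures.
From mathcomp Require Import all_boot all_order all_algebra.
From mathcomp Require Import boolp classical_sets.

Set Implicit Arguments.
Unset Strict Implicit.
Unset Printing Implicit Defensive.

Import Order.TTheory GRing.Theory Num.Theory.
Local Open Scope ring_scope.
Local Open Scope quotient_scope.
Local Open Scope classical_set_scope.

Record rect (F : realFieldType) := Rect { x1 : F; y1 : F; x2 : F; y2 : F }.

Definition rect_code (F : realFieldType) (a : rect F) : F * F * F * F :=
  (x1 a, y1 a, x2 a, y2 a).
Definition rect_decode (F : realFieldType) (t : F * F * F * F) : rect F :=
  let: (a, b, c, d) := t in Rect a b c d.
Lemma rect_codeK (F : realFieldType) : cancel (@rect_code F) (@rect_decode F).
Proof. by case. Qed.
HB.instance Definition _ (F : realFieldType) :=
  Choice.copy (rect F) (can_type (@rect_codeK F)).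

Definition nondegenerate (F : realFieldType) (a : rect F) : bool :=
  (x1 a < x2 a) && (y1 a < y2 a).
Definition inside (F : realFieldType) (v : F * F) (a : rect F) : bool :=
  (x1 a <= v.1 <= x2 a) && (y1 a <= v.2 <= y2 a).
Definition interior (F : realFieldType) (v : F * F) (a : rect F) : bool :=
  (x1 a < v.1 < x2 a) && (y1 a < v.2 < y2 a).

Definition left_of (F : realFieldType) (a b : rect F) : bool :=
  (x2 a == x1 b) && (Num.max (y1 a) (y1 b) < Num.min (y2 a) (y2 b)).
Definition below (F : realFieldType) (a b : rect F) : bool :=
  (y2 a == y1 b) && (Num.max (x1 a) (x1 b) < Num.min (x2 a) (x2 b)).

(* A layout is a bounding rectangle and a list of tiles; it is a rectangulation
   if the tiles cover exactly the box, no two of them have a common interior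
   point, and no four of them have a common point. *)
Definition layout (F : realFieldType) : Type := (rect F * seq (rect F))%type.
Definition box (F : realFieldType) (L : layout F) : rect F := L.1.
Definition tiles (F : realFieldType) (L : layout F) : seq (rect F) := L.2.

Definition is_rectangulation (F : realFieldType) (L : layout F) : Prop :=
  [/\ nondegenerate (box L) && all (@nondegenerate F) (tiles L),
      forall v, inside v (box L) = has (inside v) (tiles L),
      forall v, (count (interior v) (tiles L) <= 1)%N &
      forall v, (count (inside v) (tiles L) <= 3)%N].

Record rectangulation (F : realFieldType) := Rectangulation {
  lay :> layout F;
  _ : `[< is_rectangulation lay >] }.
HB.instance Definition _ (F : realFieldType) := [isSub for @lay F].
HB.instance Definition _ (F : realFieldType) :=
  [Choice of rectangulation F by <:].

Definition equivalent (F : realFieldType) (R S : rectangulation F) : Prop :=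
  exists f g : rect F -> rect F,
    [/\ {in tiles R, forall a, f a \in tiles S /\ g (f a) = a},
        {in tiles S, forall b, g b \in tiles R /\ f (g b) = b} &
        {in tiles R &, forall a b,
           left_of a b = left_of (f a) (f b) /\ below a b = below (f a) (f b)}].

Definition equivb (F : realFieldType) : rel (rectangulation F) :=
  fun R S => `[< equivalent R S >].

Lemma equivb_refl (F : realFieldType) : reflexive (@equivb F).
Proof. by move=> R; apply/asboolP; exists id, id; split. Qed.

Lemma equivb_sym (F : realFieldType) : symmetric (@equivb F).
Proof.
suff H (R S : rectangulation F) : equivb R S -> equivb S R.
  by move=> R S; apply/idP/idP; apply: H.
move=> /asboolP[f [g [fK gK fg]]]; apply/asboolP; exists g, f; split => //.
move=> a b aS bS; have [gaR fga] := gK _ aS; have [gbR fgb] := gK _ bS.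
by have [-> ->] := fg _ _ gaR gbR; rewrite fga fgb.
Qed.

Lemma equivb_trans (F : realFieldType) : transitive (@equivb F).
Proof.
move=> S R T /asboolP[f [g [fK gK fg]]] /asboolP[f' [g' [fK' gK' fg']]].
apply/asboolP; exists (f' \o f), (g \o g'); split => [a aR|b bT|a b aR bR] /=.
- have [faS gfa] := fK _ aR; have [? ->] := fK' _ faS; by split.
- have [gbS fgb] := gK' _ bT; have [? ->] := gK _ gbS; by split.
- have [-> ->] := fg _ _ aR bR.
  exact: fg' (proj1 (fK _ aR)) (proj1 (fK _ bR)).
Qed.

Canonical equiv_equiv (F : realFieldType) : equiv_rel (rectangulation F) :=
  EquivRel (@equivb F) (@equivb_refl F) (@equivb_sym F) (@equivb_trans F).

Definition rclass (F : realFieldType) : Type := {eq_quot (@equiv_equiv F)}.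

Definition side_layout (F : realFieldType) (n : nat) : layout F :=
  (Rect 0 0 n%:R 1, [seq Rect i%:R 0 i.+1%:R 1 | i <- iota 0 n]).

Lemma side_rectangulation (F : realFieldType) (n : nat) :
  is_rectangulation (side_layout F n.+1).
Proof.
have tilesS m : tiles (side_layout F m.+1) =
    rcons (tiles (side_layout F m)) (Rect m%:R 0 m.+1%:R 1).
  by rewrite /side_layout /tiles -[in iota 0 _]addn1 iotaD map_cat cats1.
split.
- apply/andP; split; first by rewrite /nondegenerate /= ltr0Sn ltr01.
  apply/allP => a /mapP[i _ ->].
  by rewrite /nondegenerate /= ltr_nat ltnSn ltr01.
- move=> v; elim: n => [|n IHn]; first by rewrite /= orbF.
  rewrite tilesS has_rcons -{}IHn /inside /=.
  case: (0 <= v.2 <= 1); rewrite ?andbF ?orbF // !andbT.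
  have n0 : (0 : F) <= n.+1%:R by rewrite ler0n.
  have nn : (n.+1%:R : F) <= n.+2%:R by rewrite ler_nat.
  case: (leP v.1 n.+1%:R) => [h|h]; last first.
    by rewrite (ltW h) (le_trans n0 (ltW h)) /= orbF.
  rewrite (le_trans h nn) !andbT; case: (leP 0 v.1) => h0; rewrite ?orbT ?orbF //.
  by rewrite /= leNgt (lt_le_trans h0 n0).
- move=> v; apply: (@leq_trans (v.1 < n.+1%:R)%R); last by case: (_ < _).
  elim: n.+1 => [|m IHm]; first by [].
  rewrite tilesS -cats1 count_cat /= addn0 {2}/interior /=.
  have mm : (m%:R : F) <= m.+1%:R by rewrite ler_nat.
  case: (ltP v.1 m%:R) IHm => [h|h]; last rewrite leqn0 => /eqP->.
    by rewrite (lt_le_trans h mm) [m%:R < _]ltNge (ltW h) /= addn0.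
  by rewrite add0n; case: (v.1 < m.+1%:R); rewrite ?andbF // leq_b1.
- move=> v; apply: (@leq_trans ((v.1 < n.+1%:R)%R + (v.1 <= n.+1%:R)%R)); last first.
    by case: (_ < _); case: (_ <= _).
  elim: n.+1 => [|m IHm]; first by [].
  rewrite tilesS -cats1 count_cat /= addn0 {2}/inside /=.
  have mm : (m%:R : F) < m.+1%:R by rewrite ltr_nat.
  case: (ltgtP v.1 m%:R) IHm => [h|h|->] IHm.
  + have h' := lt_trans h mm.
    by rewrite h' (ltW h') /= addn0.
  + move: IHm; rewrite leqn0 => /eqP->.
    by rewrite add0n; case: (v.1 <= m.+1%:R); rewrite //= (leq_trans (leq_b1 _)) // leq_addl.
  + rewrite mm (ltW mm) /=; apply: (@leq_trans (1 + 1)%N) => //.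
    by apply: leq_add => //; exact: leq_b1.
Qed.

Definition id_rect (F : realFieldType) (n : nat) : rclass F :=
  \pi_(rclass F)
    (Rectangulation (asboolT (side_rectangulation F n.-1))).

Definition nrects (F : realFieldType) (x : rclass F) : nat :=
  size (tiles (repr x)).

Definition rects (F : realFieldType) (n : nat) : set (rclass F) :=
  [set x | nrects x = n].

Definition bottom_based (F : realFieldType) (x : rclass F) : bool :=
  let b := box (repr x) in
  has (fun a => [&& y1 a == y1 b, x1 a == x1 b & x2 a == x2 b])
      (tiles (repr x)).
Definition right_based (F : realFieldType) (x : rclass F) : bool :=
  let b := box (repr x) in
  has (fun a => [&& x2 a == x2 b, y1 a == y1 b & y2 a == y2 b])
      (tiles (repr x)).

(* Whether some side of a tile leaves the point v in the given direction. *)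
Definition arm_up (F : realFieldType) (L : layout F) (v : F * F) : bool :=
  has (fun a => ((x1 a == v.1) || (x2 a == v.1)) && (y1 a <= v.2 < y2 a))
      (tiles L).
Definition arm_down (F : realFieldType) (L : layout F) (v : F * F) : bool :=
  has (fun a => ((x1 a == v.1) || (x2 a == v.1)) && (y1 a < v.2 <= y2 a))
      (tiles L).
Definition arm_right (F : realFieldType) (L : layout F) (v : F * F) : bool :=
  has (fun a => ((y1 a == v.2) || (y2 a == v.2)) && (x1 a <= v.1 < x2 a))
      (tiles L).
Definition arm_left (F : realFieldType) (L : layout F) (v : F * F) : bool :=
  has (fun a => ((y1 a == v.2) || (y2 a == v.2)) && (x1 a < v.1 <= x2 a))
      (tiles L).

Definition stem_right (F : realFieldType) (L : layout F) (v : F * F) : bool :=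
  [&& arm_up L v, arm_down L v, arm_right L v & ~~ arm_left L v].
Definition stem_down (F : realFieldType) (L : layout F) (v : F * F) : bool :=
  [&& arm_left L v, arm_right L v, arm_down L v & ~~ arm_up L v].

Definition bottom_right (F : realFieldType) (L : layout F) : rect F :=
  head (box L)
    [seq a <- tiles L | (x2 a == x2 (box L)) && (y1 a == y1 (box L))].

Definition delete (F : realFieldType) (L : layout F) : layout F :=
  let r := bottom_right L in
  let v := (x1 r, y2 r) in
  let rest := [seq a <- tiles L | a != r] in
  if stem_right L v then
    (box L, [seq if below r a then Rect (x1 a) (y1 r) (x2 a) (y2 a) else a
            | a <- rest])
  else if stem_down L v then
    (box L, [seq if left_of a r then Rect (x1 a) (y1 a) (x2 r) (y2 a) else a
            | a <- rest])
  else L.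

(* The default value of insubd is never used on rectangulations with at least
   two rectangles, as [delete] maps these to rectangulations. *)
Definition parent (F : realFieldType) (x : rclass F) : rclass F :=
  \pi_(rclass F) (insubd (repr x) (delete (repr x))).

Definition vertices (F : realFieldType) (L : layout F) : seq (F * F) :=
  flatten [seq [:: (x1 a, y1 a); (x1 a, y2 a); (x2 a, y1 a); (x2 a, y2 a)]
          | a <- tiles L].

(* The midpoints of the gaps between the distinct values in s. *)
Definition midpoints (F : realFieldType) (s : seq F) : seq F :=
  let t := sort <=%R (undup s) in [seq (e.1 + e.2) / 2 | e <- zip t (behead t)].

Definition left_side_points (F : realFieldType) (L : layout F) (b : rect F) :
    seq (F * F) :=
  [seq (x1 b, y) | y <- midpoints
    [seq v.2 | v <- vertices L & (v.1 == x1 b) && (y1 b <= v.2 <= y2 b)]].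
Definition top_side_points (F : realFieldType) (L : layout F) (b : rect F) :
    seq (F * F) :=
  [seq (x, y2 b) | x <- midpoints
    [seq v.1 | v <- vertices L & (v.2 == y2 b) && (x1 b <= v.1 <= x2 b)]].

Definition lexi_xy (F : realFieldType) : rel (F * F) :=
  fun u v => (u.1 < v.1) || (u.1 == v.1) && (u.2 <= v.2).
Definition lexi_yx (F : realFieldType) : rel (F * F) :=
  fun u v => (u.2 < v.2) || (u.2 == v.2) && (u.1 <= v.1).

(* Each insertion point comes with a flag that is true iff it is vertical. *)
Definition insertion_points (F : realFieldType) (L : layout F) :
    seq (bool * (F * F)) :=
  [seq (true, v) | v <- sort (@lexi_xy F) (flatten
     [seq left_side_points L b | b <- tiles L & y1 b == y1 (box L)])] ++
  [seq (false, v) | v <- sort (@lexi_yx F) (flatten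
     [seq top_side_points L b | b <- tiles L & x2 b == x2 (box L)])].

Definition nu (F : realFieldType) (x : rclass F) : nat :=
  size (insertion_points (repr x)).

(* The tiles that end up above, respectively to the left of, a rectangle
   inserted at the insertion point q. *)
Definition becomes_above (F : realFieldType) (L : layout F)
    (q : bool * (F * F)) (a : rect F) : bool :=
  if q.1 then (y1 a == y1 (box L)) && (q.2.1 <= x1 a)
  else (y1 a == q.2.2) && (q.2.1 < x2 a).
Definition becomes_left (F : realFieldType) (L : layout F)
    (q : bool * (F * F)) (a : rect F) : bool :=
  if q.1 then (x2 a == q.2.1) && (y1 a < q.2.2)
  else (x2 a == x2 (box L)) && (y2 a <= q.2.2).

Definition contained (F : realFieldType) (a b : rect F) : bool :=
  [&& x1 b <= x1 a, y1 b <= y1 a, x2 a <= x2 b & y2 a <= y2 b].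

(* S arises from R by putting a rectangle r into the bottom-right corner, each
   tile a of R being cut down to its part g a outside of r. *)
Definition inserted (F : realFieldType) (i : nat) (R S : rectangulation F) :
    Prop :=
  (0 < i <= size (insertion_points R))%N /\
  let q := nth (true, (0, 0)) (insertion_points R) i.-1 in
  exists (r : rect F) (g : rect F -> rect F),
    [/\ box S = box R,
        perm_eq (tiles S) (r :: [seq g a | a <- tiles R]),
        x2 r = x2 (box R) /\ y1 r = y1 (box R),
        {in tiles R, forall a, contained (g a) a} &
        {in tiles R, forall a, below r (g a) = becomes_above R q a /\
                               left_of (g a) r = becomes_left R q a}].

(* Not every representative R of x has room for an insertion without moving
   some of its walls first, hence the choice of R. For 1 <= i <= nu x there is
   exactly one class y as below. *)
Definition child (F : realFieldType) (i : nat) (x : rclass F) : rclass F :=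
  xget x [set y | exists R S : rectangulation F,
    [/\ \pi_(rclass F) R = x, \pi_(rclass F) S = y & inserted i R S]].

Inductive direction := Left | Right.

Definition opposite (o : direction) : direction :=
  if o is Left then Right else Left.

(* [jump o j d P k n R R'] : for R, R' with n rectangles, R' differs from R by
   a jump of r_j by d steps in direction o, and the recursion ends with the
   rectangulations child k P and child (k + d) P, resp. child (k - d) P. *)
Inductive jump (F : realFieldType) (o : direction) (j d : nat) (P : rclass F)
    (k : nat) : nat -> rclass F -> rclass F -> Prop :=
| jump_last (k' : nat) (R R' : rclass F) of
    parent R = P & parent R' = P &
    (0 < k <= nu P)%N & (0 < k' <= nu P)%N &
    (if o is Right then k' = k + d else k = k' + d)%N &
    R = child k P & R' = child k' P :
    jump o j d P k j R R'
| jump_below (n : nat) (R R' : rclass F) of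
    (j <= n)%N &
    (bottom_based R /\ bottom_based R') \/ (right_based R /\ right_based R') &
    jump o j d P k n (parent R) (parent R') :
    jump o j d P k n.+1 R R'.

Definition level (F : realFieldType) (n : nat) (C : set (rclass F)) (j : nat) :
    set (rclass F) :=
  iter (n - j) (@parent F) @` C.

Definition strictly_between (o : direction) (k d l : nat) : bool :=
  if o is Right then (k < l < k + d)%N else (k - d < l < k)%N.

Definition minimal_jump (F : realFieldType) (n : nat) (C : set (rclass F))
    (o : direction) (j : nat) (R R' : rclass F) : Prop :=
  exists (d : nat) (P : rclass F) (k : nat),
    [/\ (2 <= j <= n)%N, (0 < d)%N, rects n R /\ rects n R',
        jump o j d P k n R R' &
        forall l, strictly_between o k d l -> ~ level n C j (child l P)].

Fixpoint zigzag (F : realFieldType) (n : nat) (C : set (rclass F)) : Prop :=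
  match n with
  | 0 => False
  | 1 => C = [set id_rect F 1]
  | m.+1 => let C' := @parent F @` C in
    zigzag m C' /\ forall R, C' R -> C (child 1 R) /\ C (child (nu R) R)
  end.

(* [outputs step final visited s L] : from state s, every execution of the
   possibly nondeterministic algorithm terminates in a final state, and the
   sequence of rectangulations visited along it is L. *)
Inductive outputs (State V : Type) (step : State -> State -> Prop)
    (final : State -> Prop) (visited : State -> V) : State -> seq V -> Prop :=
| outputs_final (s : State) of final s :
    outputs step final visited s [:: visited s]
| outputs_step (s : State) (L : seq V) of
    ~ final s & (exists t, step s t) &
    (forall t, step s t -> outputs step final visited t L) :
    outputs step final visited s (visited s :: L).

(* A state of Algorithm J: the most recently visited rectangulation, and the
   ones visited before it. *)
Definition J_state (F : realFieldType) : Type := (rclass F * seq (rclass F))%type.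

Definition J_candidate (F : realFieldType) (n : nat) (C : set (rclass F))
    (s : J_state F) (o : direction) (j : nat) (R : rclass F) : Prop :=
  [/\ minimal_jump n C o j s.1 R, C R & R \notin s.1 :: s.2].

Definition J_step (F : realFieldType) (n : nat) (C : set (rclass F))
    (s t : J_state F) : Prop :=
  t.2 = s.1 :: s.2 /\
  exists (o : direction) (j : nat),
    [/\ J_candidate n C s o j t.1,
        forall o' j' R, J_candidate n C s o' j' R -> (j' <= j)%N &
        forall R, ~ J_candidate n C s (opposite o) j R].

Definition J_output (F : realFieldType) (n : nat) (C : set (rclass F)) :
    seq (rclass F) -> Prop :=
  outputs (@J_step F n C) (fun s => ~ exists t, J_step n C s t) fst
    (id_rect F n, [::]).

Record M_state (F : realFieldType) := MState {
  M_rect : rclass F;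
  M_o : nat -> direction;
  M_s : nat -> nat }.

Definition M_turns (F : realFieldType) (o : direction) (x : rclass F) : bool :=
  if o is Left then bottom_based x else right_based x.

(* Steps M4 and M5, the arrays being indexed from 1. *)
Definition M_update (F : realFieldType) (n : nat) (S : M_state F)
    (R : rclass F) : M_state F :=
  let j := M_s S n in
  let o := M_o S in
  let s := [eta M_s S with n |-> n] in
  if M_turns (o j) (iter (n - j) (@parent F) R) then
    let s' := [eta s with j |-> s j.-1] in
    MState R [eta o with j |-> opposite (o j)] [eta s' with j.-1 |-> j.-1]
  else MState R o s.

Definition M_step (F : realFieldType) (n : nat) (C : set (rclass F))
    (S T : M_state F) : Prop :=
  exists R, [/\ minimal_jump n C (M_o S (M_s S n)) (M_s S n) (M_rect S) R,
                C R & T = M_update n S R].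

Definition M_output (F : realFieldType) (n : nat) (C : set (rclass F)) :
    seq (rclass F) -> Prop :=
  outputs (@M_step F n C) (fun S => M_s S n = 1%N) (@M_rect F)
    (MState (id_rect F n) (fun _ => Left) id).

(* Main.v *)
(* Tiles are handled as half-open rectangles, which partition the half-open box
   exactly; this reduces the geometry to linear arithmetic, and the reflection in
   an antidiagonal reduces horizontal insertions to vertical ones. A vertical
   insertion cuts the tiles above the new corner tile, and deletion undoes this.
   For every insertion point of a layout an equivalent layout has room for the
   new tile: move everything to the left of and below the point down. All
   left/below relations after an insertion are determined by those before it and
   by the sets of tiles above and to the left of the new tile. Along the list of
   insertion points a number computed from the sizes of these two sets increases
   strictly, so corresponding insertion points of equivalent layouts have the same
   index. Hence the classes with n+1 rectangles are the nodes of a tree: those with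
   a given parent P are the child i P for 1 <= i <= nu P, all distinct, with nu P
   at least 2, and they are bottom-based iff i = 1 and right-based iff i = nu P.

   On this tree both algorithms visit the following list: replace each entry P of
   the list for the parents by its children in the zigzag set, in decreasing and
   increasing order alternately. Within a block r_n jumps. Between two blocks r_n
   is at an end, i.e. both rectangulations are bottom-based or both right-based,
   and the jump is that of the parents; so a run of Algorithm M on the parents
   lifts to one on the zigzag set, and for Algorithm J any candidate jump of a
   rectangle below n is a candidate for the parents as well. *)
From mathcomp Require Import all_boot all_order all_algebra.
From mathcomp Require Import boolp classical_sets.
From mathcomp Require Import lra zify.
Require Import Defs.

Set Implicit Arguments.
Unset Strict Implicit.
Unset Printing Implicit Defensive.

Import Order.TTheory GRing.Theory Num.Theory.
Local Open Scope ring_scope.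
Local Open Scope quotient_scope.

(** * Half-open tiles *)

Section Geometry.

Variable F : realFieldType.
Implicit Types (L : layout F) (a b c d r : rect F) (x y m h : F).

(** Equivalence forgets all coordinates, whereas the corner tile, the type of its top-left vertex,
    the insertion points and their order are all read off from coordinates. Each of these notions
    has to be recovered from the relations left-of and below before it can be used on classes. A
    second obstacle is that [inserted] prescribes only the neighbours of the new tile; its position
    and the shapes of the other tiles have to be derived from that. The condition on four tiles
    serves to exclude borderline cases: where a new height would coincide with a vertex on the other
    side of the same wall, four tiles would meet. Finally, [outputs] speaks of all executions, so
    both algorithms have to be shown to have no choice. For Algorithm M this is the fact that a
    minimal jump of a given tile in a given direction has at most one target in the set, which
    relies on the two ends of a block of children being distinct. *)

Lemma gap_above (s : seq F) x hi : x < hi ->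
  exists2 x', x < x' < hi & {in s, forall z, x < z -> x' < z}.
Proof.
elim: s hi => [|z s IHs] hi lt_x_hi; first by exists ((x + hi) / 2) => //; lra.
have [x' x'P x's] := IHs _ lt_x_hi.
have [lt_xz|le_zx] := ltP x z; last first.
  by exists x' => // w /[!inE] /orP[/eqP->|/x's //]; lra.
have [x'z|zx'] := ltP x' z.
  by exists x' => // w /[!inE] /orP[/eqP->|/x's //].
exists ((x + z) / 2); first lra.
by move=> w /[!inE] /orP[/eqP->|/x's ws] ?; [lra | have := ws _; lra].
Qed.

Lemma gap_below (s : seq F) x lo : lo < x ->
  exists2 x', lo < x' < x & {in s, forall z, z < x -> z < x'}.
Proof.
move=> lt_lo_x; have [|x' x'P x's] := @gap_above (map -%R s) (- x) (- lo).
  by rewrite ltrN2.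
exists (- x'); first lra.
by move=> z zs zx; have := x's (- z) (map_f _ zs); lra.
Qed.

Lemma common_point l u l' u' : l < u -> l' < u' -> l < u' -> l' < u ->
  exists x, [&& l < x, x < u, l' < x & x < u'].
Proof.
move=> *; case: (leP l l') => ?; case: (leP u u') => ?.
- by exists ((l' + u) / 2); lra.
- by exists ((l' + u') / 2); lra.
- by exists ((l + u) / 2); lra.
- by exists ((l + u') / 2); lra.
Qed.

(* Half-open intervals, closed below if [s] holds and above otherwise: each of
   the four resulting kinds of half-open rectangles is partitioned exactly. *)
Definition half_open (s : bool) lo hi x : bool :=
  if s then lo <= x < hi else lo < x <= hi.
Arguments half_open s lo hi x /.

Definition quad (s t : bool) x y a : bool :=
  half_open s (x1 a) (x2 a) x && half_open t (y1 a) (y2 a) y.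

(** For nondegenerate tiles this says that the interiors meet. *)
Definition overlap a b : bool :=
  [&& x1 a < x2 b, x1 b < x2 a, y1 a < y2 b & y1 b < y2 a].

(** Four tiles with a common corner [(x, y)]: [a] lower left, [b] lower right, [c] upper left, [d]
    upper right. *)
Definition cross x y a b c d : bool :=
  [&& x2 a == x, y2 a == y, x1 b == x, y2 b == y,
      x2 c == x, y1 c == y, x1 d == x & y1 d == y].

Definition coords L : seq F :=
  flatten [seq [:: x1 a; x2 a; y1 a; y2 a] | a <- box L :: tiles L].

Lemma mem_coords L a : a \in box L :: tiles L ->
  [/\ x1 a \in coords L, x2 a \in coords L, y1 a \in coords L
    & y2 a \in coords L].
Proof.
move=> aL; split; apply/flatten_mapP; exists a => //; rewrite !inE eqxx ?orbT //.
Qed.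

Lemma rect_eq a b :
  x1 a = x1 b -> y1 a = y1 b -> x2 a = x2 b -> y2 a = y2 b -> a = b.
Proof. by case: a b => ? ? ? ? [? ? ? ?] /= -> -> -> ->. Qed.

Lemma left_ofE a b : nondegenerate a -> nondegenerate b ->
  left_of a b = [&& x2 a == x1 b, y1 a < y2 b & y1 b < y2 a].
Proof.
move=> /andP[_ ha] /andP[_ hb].
by rewrite /left_of gt_max !lt_min ha hb /= andbT.
Qed.

Lemma belowE a b : nondegenerate a -> nondegenerate b ->
  below a b = [&& y2 a == y1 b, x1 a < x2 b & x1 b < x2 a].
Proof.
move=> /andP[ha _] /andP[hb _].
by rewrite /below gt_max !lt_min ha hb /= andbT.
Qed.

Section Rectangulation.

Variable L : layout F.
Hypothesis HL : is_rectangulation L.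

Lemma box_nd : nondegenerate (box L).
Proof. by case: HL => /andP[]. Qed.

Lemma tile_nd a : a \in tiles L -> nondegenerate a.
Proof. by case: HL => /andP[_ /allP h] _ _ _; exact: h. Qed.

Lemma overlap_eq a b :
  a \in tiles L -> b \in tiles L -> overlap a b -> a = b.
Proof.
move=> aL bL ab; apply/eqP; case: HL => _ _ cnt _.
have /andP[xa ya] := tile_nd aL; have /andP[xb yb] := tile_nd bL.
have /and4P[h1 h2 h3 h4] := ab.
have [x xP] := common_point xa xb h1 h2; have [y yP] := common_point ya yb h3 h4.
case: eqP => // /eqP neq_ab; have := cnt (x, y).
rewrite -size_filter leqNgt => /negP[].
apply: (@uniq_leq_size _ [:: a; b]); first by rewrite /= inE neq_ab.
by move=> z /[!inE] /orP[] /eqP->; rewrite mem_filter ?aL ?bL andbT /interior /=; lra.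
Qed.

Lemma tiles_uniq : uniq (tiles L).
Proof.
apply: count_mem_uniq => a; apply/eqP; rewrite eqn_leq; apply/andP; split; last first.
  by case: (boolP (a \in tiles L)) => // aL; rewrite -has_count has_pred1.
case: (boolP (a \in tiles L)) => aL; last by rewrite leqNgt -leqNgt (count_memPn aL).
have /andP[xa ya] := tile_nd aL; case: HL => _ _ cnt _.
apply: leq_trans (cnt ((x1 a + x2 a) / 2, (y1 a + y2 a) / 2)).
by apply: sub_count => z /eqP->; rewrite /interior /=; lra.
Qed.

Lemma tile_in_box a : a \in tiles L -> contained a (box L).
Proof.
move=> aL; have /andP[xa ya] := tile_nd aL; case: HL => _ cov _ _.
have : inside (x1 a, y1 a) (box L).
  by rewrite cov; apply/hasP; exists a => //; rewrite /inside /=; lra.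
have : inside (x2 a, y2 a) (box L).
  by rewrite cov; apply/hasP; exists a => //; rewrite /inside /=; lra.
by rewrite /inside /contained /=; lra.
Qed.

(** The point is moved away from the closed end by so little that no coordinate of the layout is
    passed. A closed interval between coordinates that contains the new point then contains the old
    one in the half-open sense, which turns the closed cover by tiles into a half-open one. *)
Lemma half_open_gap (s : bool) lo hi x : half_open s lo hi x ->
  exists2 x', lo < x' < hi & forall l u,
    l \in coords L -> u \in coords L -> l <= x' <= u -> half_open s l u x.
Proof.
rewrite /half_open; case: s => hx.
  have [|x' ? x's] := @gap_above (coords L) x hi; first lra.
  exists x'; first lra; move=> l u lL uL; have := x's _ lL.
  by case: (ltP x l) => [? /(_ isT)|? _]; lra.
have [|x' ? x's] := @gap_below (coords L) x lo; first lra.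
exists x'; first lra; move=> l u lL uL; have := x's _ uL.
by case: (ltP u x) => [? /(_ isT)|? _]; lra.
Qed.

Lemma quad_cover s t x y : quad s t x y (box L) ->
  exists2 a, a \in tiles L & quad s t x y a.
Proof.
move=> /andP[/half_open_gap[x' x'P gapx] /half_open_gap[y' y'P gapy]].
case: HL => _ cov _ _.
have : inside (x', y') (box L) by rewrite /inside /=; lra.
rewrite cov => /hasP[a aL /andP[ax ay]]; exists a => //.
have [] := @mem_coords L a; first by rewrite inE aL orbT.
by move=> *; apply/andP; split; [apply: gapx | apply: gapy].
Qed.

Lemma no_cross x y a b c d : a \in tiles L -> b \in tiles L ->
  c \in tiles L -> d \in tiles L -> ~~ cross x y a b c d.
Proof.
move=> aL bL cL dL; apply/negP; rewrite /cross => H; case: HL => _ _ _ cnt.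
have /andP[xa ya] := tile_nd aL; have /andP[xb yb] := tile_nd bL.
have /andP[xc yc] := tile_nd cL; have /andP[xd yd] := tile_nd dL.
have := cnt (x, y); rewrite -size_filter leqNgt => /negP[].
have D u v : (x1 u < x1 v) || (y1 u < y1 v) || (x1 v < x1 u) || (y1 v < y1 u) -> u != v.
  by move=> uv; apply: contraTneq uv => ->; rewrite !ltxx.
apply: (@uniq_leq_size _ [:: a; b; c; d]).
  by rewrite /= !inE !negb_or !D //; lra.
move=> z /[!inE] /or4P[] /eqP->; rewrite mem_filter ?aL ?bL ?cL ?dL andbT /inside /=; lra.
Qed.

(** Touching the bottom becomes a property of the relation [below] alone, hence invariant under
    isomorphisms: a tile higher up has a neighbour under its bottom-left corner. *)
Lemma tile_at_bottom a : a \in tiles L ->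
  (y1 a == y1 (box L)) = ~~ has (fun c => below c a) (tiles L).
Proof.
move=> aL; have /andP[xa ya] := tile_nd aL; have := tile_in_box aL.
rewrite /contained => Ba; apply/idP/hasPn => [/eqP ab c cL|H].
  have := tile_in_box cL; have := tile_nd cL; rewrite /contained => ndc Bc.
  rewrite belowE //; last exact: tile_nd.
  by move: ndc; rewrite /nondegenerate; lra.
apply/negPn/negP => ab.
have [|c cL] := @quad_cover true false (x1 a) (y1 a).
  by rewrite /quad /=; lra.
rewrite /quad /= => Q; have /negP[] := H _ cL; rewrite belowE ?tile_nd //.
have /andP[xc yc] := tile_nd cL.
have [|] := boolP (overlap a c); last by rewrite /overlap; lra.
by move=> /overlap_eq e; have ac := e aL cL; rewrite -ac in Q; lra.
Qed.

Lemma tile_at_left a : a \in tiles L ->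
  (x1 a == x1 (box L)) = ~~ has (fun c => left_of c a) (tiles L).
Proof.
move=> aL; have /andP[xa ya] := tile_nd aL; have := tile_in_box aL.
rewrite /contained => Ba; apply/idP/hasPn => [/eqP ab c cL|H].
  have := tile_in_box cL; have := tile_nd cL; rewrite /contained => ndc Bc.
  rewrite left_ofE ?tile_nd //.
  by move: ndc; rewrite /nondegenerate; lra.
apply/negPn/negP => ab.
have [|c cL] := @quad_cover false true (x1 a) (y1 a).
  by rewrite /quad /=; lra.
rewrite /quad /= => Q; have /negP[] := H _ cL; rewrite left_ofE ?tile_nd //.
have /andP[xc yc] := tile_nd cL.
have [|] := boolP (overlap a c); last by rewrite /overlap; lra.
by move=> /overlap_eq e; have ac := e aL cL; rewrite -ac in Q; lra.
Qed.

Lemma bottom_right_in : [/\ bottom_right L \in tiles L,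
  x2 (bottom_right L) = x2 (box L) & y1 (bottom_right L) = y1 (box L)].
Proof.
have /andP[xB yB] := box_nd.
have [|c cL] := @quad_cover false true (x2 (box L)) (y1 (box L)).
  by rewrite /quad /=; lra.
rewrite /quad /= => Q; have := tile_in_box cL; rewrite /contained => Bc.
have : bottom_right L \in [seq a <- tiles L | (x2 a == x2 (box L)) && (y1 a == y1 (box L))].
  have : c \in [seq a <- tiles L | (x2 a == x2 (box L)) && (y1 a == y1 (box L))].
    by rewrite mem_filter cL; lra.
  by rewrite /bottom_right; case: filter => //= u s _; exact: mem_head.
by rewrite mem_filter => /andP[/andP[/eqP-> /eqP->] ->].
Qed.

Lemma bottom_rightE r : r \in tiles L -> x2 r = x2 (box L) ->
  y1 r = y1 (box L) -> bottom_right L = r.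
Proof.
move=> rL xr yr; have [brL xbr ybr] := bottom_right_in.
apply: overlap_eq => //; have := tile_nd rL; have := tile_nd brL.
by rewrite /nondegenerate /overlap; lra.
Qed.

End Rectangulation.
End Geometry.

(** * Reflection in an antidiagonal *)

Section Construction.

Variable F : realFieldType.
Implicit Types (L : layout F) (a b c d r : rect F) (x y m h : F).

Lemma count_le1 (T : eqType) (P : pred T) (s : seq T) : uniq s ->
  {in s &, forall u v, P u -> P v -> u = v} -> (count P s <= 1)%N.
Proof.
move=> us inj; rewrite -size_filter; have uf := filter_uniq P us.
have : {in filter P s &, forall u v, u = v}.
  by move=> u v; rewrite !mem_filter => /andP[Pu ui] /andP[Pv vi]; exact: inj.
case: (filter P s) uf => [|u [|v t]] //= /andP[+ _] H.
by rewrite (H u v) ?inE ?eqxx ?orbT.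
Qed.

Lemma straddle x l u l' u' : l < u -> l' < u' -> l <= x <= u -> l' <= x <= u' ->
  (x < u) = (x < u') -> (l < u') && (l' < u).
Proof. by case: (ltP x u); case: (ltP x u') => // *; lra. Qed.

Lemma is_rectangulation_intro L :
  nondegenerate (box L) ->
  {in tiles L, forall a, nondegenerate a /\ contained a (box L)} ->
  uniq (tiles L) ->
  {in tiles L &, forall a b, overlap a b -> a = b} ->
  (forall x y, quad true true x y (box L) ->
     exists2 a, a \in tiles L & quad true true x y a) ->
  (forall x y a b c d, a \in tiles L -> b \in tiles L -> c \in tiles L ->
     d \in tiles L -> ~~ cross x y a b c d) ->
  is_rectangulation L.
Proof.
move=> ndB tP uniqL ov cov ncr.
have nd a : a \in tiles L -> nondegenerate a by move=> /tP[].
have /andP[xB yB] := ndB; split.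
- by rewrite ndB; apply/allP => a /nd.
- move=> [x y]; apply/idP/hasP => [|[a aL]]; last first.
    have [_] := tP _ aL; rewrite /contained /inside /=; lra.
  move=> vB.
  (* On the top and right sides, which the half-open box omits, the point is first moved inwards
     without passing a coordinate. *)
  have gap (z lo hi : F) : lo < hi -> lo <= z <= hi -> exists2 z', lo <= z' < hi &
      forall l u, u \in coords L -> l <= z' < u -> l <= z <= u.
    move=> lohi zP; have [zhi|zhi] := ltP z hi.
      by exists z; [lra | move=> l u _; lra].
    have [z' z'P z's] := @gap_below _ (coords L) z lo ltac:(lra).
    exists z'; first lra.
    move=> l u uc; have := z's _ uc; case: (ltP u z) => [? /(_ isT)|? _]; lra.
  move: vB; rewrite /inside /= => vB.
  have [|x' x'B gx] := gap x (x1 (box L)) (x2 (box L)) xB; first lra.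
  have [|y' y'B gy] := gap y (y1 (box L)) (y2 (box L)) yB; first lra.
  have [|a aL] := cov x' y'; first by rewrite /quad /=; lra.
  rewrite /quad /= => Q; exists a => //.
  have [_ x2a _ y2a] := @mem_coords _ L a ltac:(by rewrite inE aL orbT).
  by apply/andP; split; [apply: gx | apply: gy] => //; lra.
- move=> v; apply: count_le1 => // a b aL bL av bv; apply: ov => //.
  by move: av bv; rewrite /interior /overlap; lra.
- move=> [x y]; rewrite leqNgt; apply/negP => big.
  pose s := [seq a <- tiles L | inside (x, y) a].
  have us : uniq s by rewrite filter_uniq.
  have sP a : a \in s -> [/\ a \in tiles L, nondegenerate a & inside (x, y) a].
    by rewrite mem_filter => /andP[? ?]; split => //; exact: nd.
  (* Among the tiles containing [(x, y)], one is determined by the quadrant into which it extends,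
     recorded by the two tests: tiles with equal tests overlap. *)
  have inj : {in s &, injective (fun a => (x < x2 a, y < y2 a))}.
    move=> a b /sP[aL /andP[? ?] /andP[? ?]] /sP[bL /andP[? ?] /andP[? ?]] [e1 e2].
    apply: ov => //; apply/and4P.
    have /andP[-> ->] : (x1 a < x2 b) && (x1 b < x2 a) by apply: (@straddle x).
    by have /andP[] : (y1 a < y2 b) && (y1 b < y2 a) by apply: (@straddle y).
  (* More than three tiles at one point therefore occupy all four quadrants, and form a [cross]. *)
  have full : [seq (x < x2 a, y < y2 a) | a <- s] =i predT.
    apply/subset_cardP; last exact/subset_predT.
    apply/eqP; rewrite eqn_leq max_card /=.
    have /card_uniqP -> : uniq [seq (x < x2 a, y < y2 a) | a <- s].
      by rewrite map_inj_in_uniq.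
    by rewrite size_map size_filter card_prod card_bool.
  have get p : exists a, [/\ a \in tiles L, nondegenerate a, inside (x, y) a,
      (x < x2 a) = p.1 & (y < y2 a) = p.2].
    have : p \in predT by [].
    by rewrite -full => /mapP[a /sP[? ? ?] ->]; exists a.
  have [a [aL + + + +]] := get (false, false).
  have [b [bL + + + +]] := get (true, false).
  have [c [cL + + + +]] := get (false, true).
  have [d [dL + + + +]] := get (true, true).
  rewrite /nondegenerate /inside /= => nd_d id d1 d2 nc ic c1 c2 nb ib b1 b2 na ia a1 a2.
  have nov u v : u \in tiles L -> v \in tiles L ->
      ((x < x2 u) != (x < x2 v)) || ((y < y2 u) != (y < y2 v)) -> ~~ overlap u v.
    by move=> uL vL; apply: contraL => /ov ->; rewrite ?eqxx.
  have := nov _ _ aL bL; have := nov _ _ aL cL; have := nov _ _ cL dL.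
  have := nov _ _ bL dL.
  rewrite a1 a2 b1 b2 c1 c2 d1 d2 => /(_ isT) + /(_ isT) + /(_ isT) + /(_ isT).
  rewrite /overlap => h1 h2 h3 h4.
  by have /negP[] := @ncr x y _ _ _ _ aL bL cL dL; rewrite /cross; lra.
Qed.

(* Reflection in an antidiagonal: it fixes the bottom-right corner and swaps
   the two kinds of insertion points. *)
Definition tr a : rect F := Rect (- y2 a) (- x2 a) (- y1 a) (- x1 a).
Definition trL L : layout F := (tr (box L), map tr (tiles L)).

Lemma trK : involutive tr.
Proof. by case=> *; rewrite /tr /= !opprK. Qed.

Lemma trLK : involutive trL.
Proof. by case=> B s; rewrite /trL /box /tiles /= trK (mapK trK). Qed.

Lemma tr_inj : injective tr.
Proof. exact: inv_inj trK. Qed.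

Lemma nondegenerate_tr a : nondegenerate (tr a) = nondegenerate a.
Proof. by rewrite /nondegenerate /= !ltrN2 andbC. Qed.

Lemma left_of_tr a b : left_of (tr a) (tr b) = below b a.
Proof.
rewrite /left_of /below /= eqr_opp eq_sym !gt_max !lt_min !ltrN2.
by case: (_ == _); case: (_ < _); case: (_ < _); case: (_ < _); case: (_ < _).
Qed.

Lemma below_tr a b : below (tr a) (tr b) = left_of b a.
Proof. by rewrite -left_of_tr !trK. Qed.

Lemma contained_tr a b : contained (tr a) (tr b) = contained a b.
Proof. by rewrite /contained /= !lerN2; apply/and4P/and4P => -[]. Qed.

Lemma is_rectangulation_tr L : is_rectangulation L -> is_rectangulation (trL L).
Proof.
have iE v a : inside v (tr a) = inside (- v.2, - v.1) a.
  by apply/idP/idP; rewrite /inside /=; lra.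
have jE v a : interior v (tr a) = interior (- v.2, - v.1) a.
  by apply/idP/idP; rewrite /interior /=; lra.
case=> /andP[ndB ndL] cov cnt3 cnt4; split.
- rewrite nondegenerate_tr ndB all_map; apply: sub_all ndL => a /=.
  by rewrite nondegenerate_tr.
- by move=> v; rewrite iE cov has_map; apply: eq_has => a /=; rewrite iE.
- move=> v; rewrite count_map; apply: leq_trans (cnt3 (- v.2, - v.1)).
  by apply: sub_count => a /=; rewrite jE.
- move=> v; rewrite count_map; apply: leq_trans (cnt4 (- v.2, - v.1)).
  by apply: sub_count => a /=; rewrite iE.
Qed.

Lemma mem_trL L a : (tr a \in tiles (trL L)) = (a \in tiles L).
Proof. exact: mem_map tr_inj _ _. Qed.

Lemma tile_at_right L a : is_rectangulation L -> a \in tiles L ->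
  (x2 a == x2 (box L)) = ~~ has (left_of a) (tiles L).
Proof.
move=> HL aL; have := @tile_at_bottom _ _ (is_rectangulation_tr HL) (tr a).
rewrite mem_trL /= eqr_opp has_map => -> //; congr (~~ _).
by apply: eq_has => c /=; rewrite below_tr.
Qed.

Lemma bottom_right_tr L : bottom_right (trL L) = tr (bottom_right L).
Proof.
rewrite /bottom_right /= filter_map.
set s := filter _ _; set t := filter _ _.
have -> : s = t.
  by apply: eq_filter => a /=; rewrite !eqr_opp andbC.
by case: t.
Qed.

Lemma stem_right_tr L x y :
  stem_right (trL L) (- y, - x) = stem_down L (x, y).
Proof.
rewrite /stem_right /stem_down /arm_up /arm_down /arm_left /arm_right /= !has_map.
rewrite /preim /=; congr [&& _, _, _ & ~~ _]; apply: eq_has => a /=;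
  rewrite !eqr_opp; apply/idP/idP; lra.
Qed.

Lemma stem_down_tr L x y :
  stem_down (trL L) (- y, - x) = stem_right L (x, y).
Proof. by rewrite -{2}(trLK L) -stem_right_tr !opprK. Qed.

Lemma delete_tr L : delete (trL L) = trL (delete L).
Proof.
rewrite /delete bottom_right_tr /= stem_right_tr stem_down_tr.
set r := bottom_right L.
have E : [seq a <- [seq tr i | i <- tiles L] | a != tr r] =
    [seq tr a | a <- [seq a <- tiles L | a != r]].
  by rewrite filter_map; congr map; apply: eq_filter => a; rewrite /= (inj_eq tr_inj).
(* [delete] tests [stem_right] first and the reflection exchanges the two tests, so they must
   exclude each other. *)
have D : stem_right L (x1 r, y2 r) -> stem_down L (x1 r, y2 r) = false.
  by rewrite /stem_right /stem_down => /and4P[-> _ _ _] /=; rewrite !andbF.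
case: ifP => [dn|_].
  have -> : stem_right L (x1 r, y2 r) = false by apply: contraTF dn => /D ->.
  rewrite /trL /box /tiles /=; congr pair; rewrite E -!map_comp.
  by apply: eq_map => a /=; rewrite below_tr; case: ifP.
case: ifP => // _.
rewrite /trL /box /tiles /=; congr pair; rewrite E -!map_comp.
by apply: eq_map => a /=; rewrite left_of_tr; case: ifP.
Qed.

End Construction.

(** * Isomorphisms of layouts *)

Section Isomorphisms.

Variable F : realFieldType.
Implicit Types (L M : layout F) (a b c d r : rect F) (x y m h : F).

(** Bijectivity is stated as a permutation of lists, so that no inverse function has to be carried
    along. *)
Definition iso (f : rect F -> rect F) L M : Prop :=
  perm_eq (tiles M) (map f (tiles L)) /\
  {in tiles L &, forall a b,
     left_of a b = left_of (f a) (f b) /\ below a b = below (f a) (f b)}.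

Lemma iso_id L M : perm_eq (tiles M) (tiles L) -> iso id L M.
Proof. by move=> p; rewrite /iso map_id. Qed.

Lemma iso_mem f L M a : iso f L M -> a \in tiles L -> f a \in tiles M.
Proof. by move=> [p _] aL; rewrite (perm_mem p) map_f. Qed.

Lemma layP (R : rectangulation F) : is_rectangulation R.
Proof. exact/asboolP/(valP R). Qed.

Lemma equivalentP (R S : rectangulation F) :
  equivalent R S <-> exists f, iso f R S.
Proof.
split=> [[f [g [fK gK fg]]]|[f [p rf]]].
  exists f; split=> //; apply: uniq_perm; first exact: tiles_uniq (layP S).
    rewrite map_inj_in_uniq ?(tiles_uniq (layP R)) // => a b aR bR e.
    have [_ ga] := fK _ aR; have [_ gb] := fK _ bR.
    by rewrite -ga e gb.
  move=> b; apply/idP/mapP => [bS|[a aR ->]]; last by have [] := fK _ aR.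
  by have [? fgb] := gK _ bS; exists (g b).
have uf : uniq (map f (tiles R)) by rewrite -(perm_uniq p) (tiles_uniq (layP S)).
have Kf a : a \in tiles R -> nth (box R) (tiles R) (index (f a) (map f (tiles R))) = a.
  move=> aR; have ia : (index a (tiles R) < size (tiles R))%N by rewrite index_mem.
  rewrite -{1}(nth_index (box R) aR) -(nth_map _ (f (box R))) //.
  by rewrite index_uniq ?size_map // nth_index.
exists f, (fun b => nth (box R) (tiles R) (index b (map f (tiles R)))); split=> //.
  by move=> a aR; rewrite (perm_mem p) map_f ?Kf.
by move=> b; rewrite (perm_mem p) => /mapP[a aR ->]; rewrite Kf.
Qed.

(** With both layouts listed over a common index type, an isomorphism need only be described on
    indices; the map on rectangles looks up the position in the list. *)
Lemma iso_param (I : eqType) (s : seq I) (u v : I -> rect F) L M :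
  uniq (tiles L) -> perm_eq (tiles L) (map u s) -> perm_eq (tiles M) (map v s) ->
  {in s &, forall i j, left_of (u i) (u j) = left_of (v i) (v j) /\
                       below (u i) (u j) = below (v i) (v j)} ->
  exists2 f, iso f L M & {in s, forall i, f (u i) = v i}.
Proof.
case: s => [|i0 t].
  move=> _ pL pM _; exists id => //; apply: iso_id.
  by apply: perm_trans pM _; rewrite perm_sym.
move: (i0 :: t) => s uL pL pM rel.
have us : uniq (map u s) by rewrite -(perm_uniq pL).
have fE i : i \in s -> nth i0 s (index (u i) (map u s)) = i.
  move=> iS; have ii : (index i s < size s)%N by rewrite index_mem.
  rewrite -{1}(nth_index i0 iS) -(nth_map _ (u i0)) //.
  by rewrite index_uniq ?size_map // nth_index.
exists (fun a => v (nth i0 s (index a (map u s)))); last by move=> i /fE->.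
split.
  rewrite (perm_trans pM) // perm_sym (perm_trans (perm_map _ pL)) //.
  rewrite -map_comp; suff /eq_in_map -> :
    {in s, (fun a => v (nth i0 s (index a (map u s)))) \o u =1 v} by [].
  by move=> i /fE /= ->.
move=> a b; rewrite !(perm_mem pL) => /mapP[i iS ->] /mapP[j jS ->].
by rewrite !fE //; exact: rel.
Qed.

Lemma iso_sym f L M : uniq (tiles M) -> iso f L M ->
  exists2 g, iso g M L & {in tiles L, cancel f g}.
Proof.
move=> uM [p rf]; have [|a b aL bL|g Ig gE] := @iso_param _ (tiles L) f id M L uM p.
- by rewrite map_id.
- by have [-> ->] := rf _ _ aL bL.
by exists g.
Qed.

Lemma iso_tr f L M : iso f L M -> iso (fun a => tr (f (tr a))) (trL L) (trL M).
Proof.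
move=> [p rf]; split.
  have E : (fun a => tr (f (tr a))) \o @tr F =1 @tr F \o f by move=> a /=; rewrite trK.
  by rewrite /= -map_comp (eq_map E) map_comp perm_map.
move=> _ _ /mapP[a aL ->] /mapP[b bL ->]; rewrite !trK !left_of_tr !below_tr.
by have [] := rf _ _ bL aL.
Qed.

Section Touch.

Variables (f : rect F -> rect F) (L M : layout F).
Hypotheses (HL : is_rectangulation L) (HM : is_rectangulation M) (If : iso f L M).

Lemma iso_has (P Q : pred (rect F)) :
  {in tiles L, forall a, P a = Q (f a)} -> has P (tiles L) = has Q (tiles M).
Proof. by case: If => p _ PQ; rewrite (perm_has _ p) has_map; apply: eq_in_has. Qed.

Lemma iso_count (P Q : pred (rect F)) :
  {in tiles L, forall a, P a = Q (f a)} -> count P (tiles L) = count Q (tiles M).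
Proof. by case: If => p _ PQ; rewrite (permP p) count_map; apply: eq_in_count. Qed.

Lemma iso_at_bottom a : a \in tiles L ->
  (y1 (f a) == y1 (box M)) = (y1 a == y1 (box L)).
Proof.
move=> aL; rewrite !tile_at_bottom ?(iso_mem If) //; congr (~~ _); apply/esym/iso_has.
by move=> c cL; have [] := If.2 _ _ cL aL.
Qed.

Lemma iso_at_left a : a \in tiles L ->
  (x1 (f a) == x1 (box M)) = (x1 a == x1 (box L)).
Proof.
move=> aL; rewrite !tile_at_left ?(iso_mem If) //; congr (~~ _); apply/esym/iso_has.
by move=> c cL; have [] := If.2 _ _ cL aL.
Qed.

Lemma iso_at_right a : a \in tiles L ->
  (x2 (f a) == x2 (box M)) = (x2 a == x2 (box L)).
Proof.
move=> aL; rewrite !tile_at_right ?(iso_mem If) //; congr (~~ _); apply/esym/iso_has.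
by move=> c cL; have [] := If.2 _ _ aL cL.
Qed.

Lemma iso_bottom_right : f (bottom_right L) = bottom_right M.
Proof.
have [rL xr yr] := bottom_right_in HL.
by apply/esym/bottom_rightE; rewrite ?(iso_mem If) //; apply/eqP;
  rewrite ?iso_at_right ?iso_at_bottom // ?xr ?yr.
Qed.

End Touch.
End Isomorphisms.

(** * Vertical insertion *)

Section VerticalInsertion.

Variable F : realFieldType.
Implicit Types (L M : layout F) (a b c d r : rect F) (x y m h : F).

Lemma tile_belowE L a b : is_rectangulation L -> a \in tiles L ->
  b \in tiles L -> below a b = [&& y2 a == y1 b, x1 a < x2 b & x1 b < x2 a].
Proof. by move=> HL aL bL; rewrite belowE ?(tile_nd HL). Qed.

Lemma tile_left_ofE L a b : is_rectangulation L -> a \in tiles L ->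
  b \in tiles L -> left_of a b = [&& x2 a == x1 b, y1 a < y2 b & y1 b < y2 a].
Proof. by move=> HL aL bL; rewrite left_ofE ?(tile_nd HL). Qed.

Definition over L x0 a : bool := (y1 a == y1 (box L)) && (x0 <= x1 a).

Definition cut L x0 h a : rect F :=
  if over L x0 a then Rect (x1 a) h (x2 a) (y2 a) else a.

Definition corner L x0 h : rect F := Rect x0 (y1 (box L)) (x2 (box L)) h.

(* M arises from L by putting the rectangle [corner L x0 h] below the tiles
   of L that touch the bottom to the right of the vertical line at x0. *)
Definition vins L M x0 h : Prop :=
  [/\ is_rectangulation L, is_rectangulation M, box M = box L,
      perm_eq (tiles M) (corner L x0 h :: map (cut L x0 h) (tiles L)) &
      exists2 b, b \in tiles L & x1 b = x0 /\ y1 b = y1 (box L)].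

Section CutTiles.

Variables (L M : layout F) (x0 h : F).
Hypothesis V : vins L M x0 h.
Local Notation r := (corner L x0 h).
Local Notation g := (cut L x0 h).

Let HL : is_rectangulation L. Proof. by case: V. Qed.
Let HM : is_rectangulation M. Proof. by case: V. Qed.

Lemma vins_corner_in : r \in tiles M.
Proof. by case: V => _ _ _ p _; rewrite (perm_mem p) mem_head. Qed.

Lemma vins_cut_in a : a \in tiles L -> g a \in tiles M.
Proof. by case: V => _ _ _ p _ aL; rewrite (perm_mem p) inE map_f ?orbT. Qed.

Lemma vins_bounds : [/\ y1 (box L) < h, x1 (box L) <= x0 & x0 < x2 (box L)].
Proof.
have := tile_nd HM vins_corner_in; have := tile_in_box HM vins_corner_in.
case: V => _ _ -> _ _; rewrite /contained /nondegenerate /= => ? ?.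
by split; lra.
Qed.

Lemma over_high a : a \in tiles L -> over L x0 a -> h < y2 a.
Proof.
move=> aL A; have := tile_nd HM (vins_cut_in aL).
by rewrite /cut A /nondegenerate /=; lra.
Qed.

(** The bottom tile under [a] to the right of [x0] cannot start before [x0], since a tile with left
    side at [x0] stands on the bottom. So it is cut and reaches above [h]; then [a] overlaps it, and
    hence equals it. *)
Lemma over_low a : a \in tiles L -> x0 < x2 a -> y1 a <= h -> over L x0 a.
Proof.
move=> aL xa ya; case: (V) => _ _ _ _ [b bL [xb yb]].
have [hB xB1 xB2] := vins_bounds.
have := tile_nd HL aL; have := tile_in_box HL aL.
rewrite /nondegenerate /contained => Ba na.
have := tile_nd HL bL; rewrite /nondegenerate => nb.
have [x xP] : exists x, [&& x1 a <= x, x0 <= x & x < x2 a].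
  by case: (leP x0 (x1 a)) => ?; [exists (x1 a) | exists x0]; lra.
have [|c cL] := @quad_cover _ _ HL true true x (y1 (box L)).
  by rewrite /quad /=; lra.
rewrite /quad /= => Q; have := tile_in_box HL cL; rewrite /contained => Bc.
have xc : x0 <= x1 c.
  rewrite leNgt; apply/negP => lt; have e : b = c.
    by apply: (overlap_eq HL) => //; rewrite /overlap; lra.
  by rewrite -e in lt; lra.
have Ac : over L x0 c by rewrite /over; lra.
have hc := over_high cL Ac.
suff -> : a = c by [].
by apply: (overlap_eq HL) => //; rewrite /overlap; lra.
Qed.

Lemma below_corner_cut a : a \in tiles L -> below r (g a) = over L x0 a.
Proof.
move=> aL; rewrite (tile_belowE HM) ?vins_corner_in ?vins_cut_in //.
have := tile_nd HL aL; have := tile_in_box HL aL.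
have [hB xB1 xB2] := vins_bounds.
rewrite /nondegenerate /contained => Ba na.
rewrite /cut; case: ifP => [|A] /=; first by rewrite /over; lra.
apply: contraFF A => ?; apply: over_low => //; lra.
Qed.

Lemma left_of_cut_corner a : a \in tiles L ->
  left_of (g a) r = (x2 a == x0) && (y1 a < h).
Proof.
move=> aL; rewrite (tile_left_ofE HM) ?vins_corner_in ?vins_cut_in //.
have := tile_nd HL aL; have := tile_in_box HL aL.
have [hB xB1 xB2] := vins_bounds.
rewrite /nondegenerate /contained => Ba na.
rewrite /cut; case: ifP => [|A] /=; first by rewrite /over; lra.
by apply/idP/idP; lra.
Qed.

Lemma vins_trichotomy a : a \in tiles L ->
  [|| over L x0 a && (h < y2 a), (x2 a <= x0) && ~~ over L x0 a
    | (h < y1 a) && ~~ over L x0 a].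
Proof.
move=> aL; case A: (over L x0 a) => /=; first by rewrite (over_high aL).
rewrite !andbT; case: (leP (x2 a) x0) => //= xa; rewrite ltNge; apply/negP => ya.
by rewrite over_low in A.
Qed.

Lemma below_cut a b : a \in tiles L -> b \in tiles L ->
  below (g a) (g b) = below a b.
Proof.
move=> aL bL; rewrite (tile_belowE HL aL bL) (tile_belowE HM) ?vins_cut_in //.
have := vins_trichotomy aL; have := vins_trichotomy bL.
have := tile_nd HL aL; have := tile_in_box HL aL.
have := tile_nd HL bL; have := tile_in_box HL bL.
have [hB xB1 xB2] := vins_bounds.
rewrite /nondegenerate /contained /cut => Bb nb Ba na.
case: ifP => [|] Aa /=; case: ifP => [|] Ab //=; move: Aa Ab;
  rewrite /over; lra.
Qed.

Lemma left_of_cut_above a b : a \in tiles L -> b \in tiles L ->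
  ~~ (over L x0 b && left_of (g a) r) -> left_of (g a) (g b) = left_of a b.
Proof.
move=> aL bL; rewrite left_of_cut_corner //.
rewrite (tile_left_ofE HL aL bL) (tile_left_ofE HM) ?vins_cut_in //.
have := vins_trichotomy aL; have := vins_trichotomy bL.
have := tile_nd HL aL; have := tile_in_box HL aL.
have := tile_nd HL bL; have := tile_in_box HL bL.
have [hB xB1 xB2] := vins_bounds.
rewrite /nondegenerate /contained /cut => Bb nb Ba na.
case: ifP => [|] Ab /=; case: ifP => [|] Aa //=; move: Aa Ab;
  rewrite /over; lra.
Qed.

End CutTiles.
End VerticalInsertion.

(** * The relation left-of before and after a vertical insertion *)

Section CutNeighbours.

Variable F : realFieldType.
Implicit Types (L M : layout F) (a b c d r : rect F) (x y m h : F).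

(* A tile on the left loses contact with the tile b above the corner unless it
   is the topmost of the left neighbours of the corner. *)
Lemma left_of_cut L M x0 h a b : vins L M x0 h ->
  a \in tiles L -> b \in tiles L ->
  let r := corner L x0 h in let g := cut L x0 h in
  left_of (g a) (g b) = left_of a b && ~~ [&& over L x0 b, left_of (g a) r &
     has (fun c => left_of (g c) r && below a c) (tiles L)].
Proof.
move=> V aL bL r g; rewrite andbA.
have [Hab|] := boolP (over L x0 b && left_of (g a) r); last first.
  by move=> Hab; rewrite andbT (left_of_cut_above V).
case/andP: Hab => Ob; rewrite (left_of_cut_corner V aL) => /andP[/eqP xa ya] /=.
have [HL HM Bx _ _] := V; have [hB xB1 xB2] := vins_bounds V.
have hb := over_high V bL Ob.
have := tile_nd HL aL; have := tile_in_box HL aL.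
have := tile_nd HL bL; have := tile_in_box HL bL.
rewrite /nondegenerate /contained => Bb nb Ba na.
have Oa : over L x0 a = false by rewrite /over; lra.
have := Ob; rewrite /over => Ob'.
have gaM := vins_cut_in V aL; have gbM := vins_cut_in V bL.
rewrite (tile_left_ofE HM) // (tile_left_ofE HL) //.
move: (gaM) (gbM); rewrite /g /cut Oa Ob /= => {}gaM {}gbM.
have [x1b|x1b] := eqVneq (x1 b) x0; last by apply/idP/idP; lra.
transitivity (h < y2 a); first by apply/idP/idP; lra.
have -> : [&& x2 a == x1 b, y1 a < y2 b & y1 b < y2 a] by lra.
apply/idP/hasPn => /= [ha c cL|H].
  rewrite (left_of_cut_corner V) // (tile_belowE HL) //; lra.
rewrite ltNge; apply/negP => yah.
have [|c cL] := @quad_cover _ _ HL false true x0 (y2 a).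
  by rewrite /quad /=; lra.
rewrite /quad /= => Q; have := tile_nd HL cL; rewrite /nondegenerate => nc.
have yc : y1 c = y2 a.
  apply/eqP; rewrite eq_le; apply/andP; split; first lra.
  rewrite leNgt; apply/negP => lt; have e : c = a.
    by apply: (overlap_eq HL) => //; rewrite /overlap; lra.
  by rewrite e in Q; lra.
have xc : x2 c = x0.
  apply/eqP; rewrite eq_le; apply/andP; split; last lra.
  rewrite leNgt; apply/negP => lt; have e : c = b.
    by apply: (overlap_eq HL) => //; rewrite /overlap; lra.
  by rewrite e in Q; lra.
have := H _ cL; rewrite (left_of_cut_corner V) // (tile_belowE HL) // => Hc.
(* The tile [c] rests on [a], so by [H] it is not left of the corner. This leaves only [y2 a = h],
   where four tiles would meet at the top-left vertex of the corner. *)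
have yah' : y2 a = h by lra.
have Oc : over L x0 c = false by rewrite /over; lra.
have := vins_cut_in V cL; rewrite /cut Oc => cM.
have /negP[] := @no_cross _ _ HM x0 h _ _ _ _ gaM (vins_corner_in V) cM gbM.
by rewrite /cross /=; lra.
Qed.

(** When the cut tiles reach down again, a left neighbour of the corner regains contact exactly with
    the leftmost tile above the corner. As [over L x0 b] amounts to [below r (g b)], the old
    relation is expressed through the new ones. *)
Lemma left_of_uncut L M x0 h a b : vins L M x0 h ->
  a \in tiles L -> b \in tiles L ->
  let r := corner L x0 h in let g := cut L x0 h in
  left_of a b = left_of (g a) (g b) || [&& over L x0 b, left_of (g a) r &
     ~~ has (fun c => below r c && left_of c (g b)) (tiles M)].
Proof.
move=> V aL bL r g; rewrite andbA.
have [Hab|] := boolP (over L x0 b && left_of (g a) r); last first.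
  by move=> Hab; rewrite orbF (left_of_cut_above V).
case/andP: Hab => Ob; rewrite (left_of_cut_corner V aL) => /andP[/eqP xa ya] /=.
have [HL HM Bx _ _] := V; have [hB xB1 xB2] := vins_bounds V.
have hb := over_high V bL Ob.
have := tile_nd HL aL; have := tile_in_box HL aL.
have := tile_nd HL bL; have := tile_in_box HL bL.
rewrite /nondegenerate /contained => Bb nb Ba na.
have Oa : over L x0 a = false by rewrite /over; lra.
have := Ob; rewrite /over => Ob'.
have gaM := vins_cut_in V aL; have gbM := vins_cut_in V bL.
rewrite (tile_left_ofE HL) // (tile_left_ofE HM) //.
rewrite {1 2 3}/g /cut Oa Ob /=.
have [x1b|x1b] := eqVneq (x1 b) x0.
  rewrite (_ : ~~ _) ?orbT; last first.
    apply/hasPn => c cM; rewrite (tile_belowE HM) ?(vins_corner_in V) //.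
    by rewrite (tile_left_ofE HM) // /g /cut Ob /=; lra.
  lra.
rewrite (_ : has _ _); first by apply/idP/idP; lra.
have [|c cL] := @quad_cover _ _ HL false true (x1 b) (y1 (box L)).
  by rewrite /quad /=; lra.
rewrite /quad /= => Q; have := tile_nd HL cL; rewrite /nondegenerate => nc.
have := tile_in_box HL cL; rewrite /contained => Bc.
have xc : x2 c = x1 b.
  apply/eqP; rewrite eq_le; apply/andP; split; last lra.
  rewrite leNgt; apply/negP => lt; have e : c = b.
    by apply: (overlap_eq HL) => //; rewrite /overlap; lra.
  by rewrite e in Q; lra.
have Oc : over L x0 c by apply: (over_low V) => //; lra.
apply/hasP; exists (g c); first exact: vins_cut_in.
rewrite (below_corner_cut V) // Oc /= (tile_left_ofE HM) ?(vins_cut_in V) //.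
have := over_high V cL Oc.
by rewrite /g /cut Oc Ob /=; lra.
Qed.

End CutNeighbours.

(** * Vertical insertion and its inverse under isomorphisms *)

Section InsertionInvariance.

Variable F : realFieldType.
Implicit Types (L M : layout F) (a b c d r : rect F) (x y m h : F).

Lemma left_of_corner L M x0 h c : vins L M x0 h -> c \in tiles M ->
  left_of (corner L x0 h) c = false.
Proof.
move=> V cM; have [_ HM Bx _ _] := V.
rewrite (tile_left_ofE HM) ?(vins_corner_in V) //=.
have := tile_nd HM cM; have := tile_in_box HM cM.
by rewrite /contained /nondegenerate Bx; lra.
Qed.

Lemma below_corner L M x0 h c : vins L M x0 h -> c \in tiles M ->
  below c (corner L x0 h) = false.
Proof.
move=> V cM; have [_ HM Bx _ _] := V.
rewrite (tile_belowE HM) ?(vins_corner_in V) //=.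
have := tile_nd HM cM; have := tile_in_box HM cM.
by rewrite /contained /nondegenerate Bx; lra.
Qed.

Lemma vins_bottom_right L M x0 h : vins L M x0 h ->
  bottom_right M = corner L x0 h.
Proof.
move=> V; have [_ HM Bx _ _] := V.
by apply: (bottom_rightE HM); rewrite ?(vins_corner_in V) // Bx.
Qed.

(** The relations in [M] are functions of those in [L] and of the two neighbour sets of the corner,
    which the last two hypotheses match. The tiles of [M] are indexed by [option], with [None] for
    the corner. *)
Lemma vins_iso f L M L' M' x0 h x0' h' :
  vins L M x0 h -> vins L' M' x0' h' -> iso f L L' ->
  {in tiles L, forall a, over L' x0' (f a) = over L x0 a} ->
  {in tiles L, forall a, left_of (cut L' x0' h' (f a)) (corner L' x0' h') =
                         left_of (cut L x0 h a) (corner L x0 h)} ->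
  exists k, iso k M M'.
Proof.
move=> V V' If fo fl; have [HL HM _ pM _] := V; have [HL' HM' _ pM' _] := V'.
pose u (i : option (rect F)) :=
  if i is Some a then cut L x0 h a else corner L x0 h.
pose v (i : option (rect F)) :=
  if i is Some a then cut L' x0' h' (f a) else corner L' x0' h'.
have [||||k Ik _] := @iso_param _ _ (None :: map Some (tiles L)) u v M M'.
- exact: tiles_uniq.
- by rewrite /= -map_comp.
- apply: perm_trans pM' _; rewrite /= perm_cons -map_comp.
  have [pf _] := If; apply: perm_trans (perm_map _ pf) _.
  by rewrite -map_comp; exact: perm_refl.
- have fL a : a \in tiles L -> f a \in tiles L' by exact: iso_mem.
  have gM a : a \in tiles L -> cut L x0 h a \in tiles M by exact: vins_cut_in.
  have gM' a : a \in tiles L -> cut L' x0' h' (f a) \in tiles M'.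
    by move=> /fL; exact: vins_cut_in.
  have rM := vins_corner_in V; have rM' := vins_corner_in V'.
  move=> [a|] [b|] /=; rewrite !inE /= ?mem_map; try by move=> ? ? [].
  + move=> aL bL; rewrite !(below_cut V) ?(below_cut V') ?fL //.
    have [lo be] := If.2 _ _ aL bL; split; last by [].
    rewrite (left_of_cut V) // (left_of_cut V') ?fL //= -lo fo // fl //.
    congr (_ && ~~ [&& _, _ & _]); apply: (iso_has If) => c cL.
    by rewrite fl //; have [_ ->] := If.2 _ _ aL cL.
  + move=> aL _; rewrite fl //; split=> //.
    by rewrite (below_corner V) ?gM // (below_corner V') ?gM'.
  + move=> _ bL; rewrite (left_of_corner V) ?gM // (left_of_corner V') ?gM' //.
    by rewrite (below_corner_cut V) // (below_corner_cut V') ?fL // fo.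
  + rewrite (left_of_corner V) // (left_of_corner V') //.
    by rewrite (below_corner V) // (below_corner V').
by exists k.
Qed.

Lemma vins_iso_inv k L M L' M' x0 h x0' h' :
  vins L M x0 h -> vins L' M' x0' h' -> iso k M M' -> exists f, iso f L L'.
Proof.
move=> V V' Ik; have [HL HM _ pM _] := V; have [HL' HM' _ pM' _] := V'.
have kr : k (corner L x0 h) = corner L' x0' h'.
  by rewrite -(vins_bottom_right V) (iso_bottom_right HM HM' Ik) (vins_bottom_right V').
have rM := vins_corner_in V; have rM' := vins_corner_in V'.
have gM a : a \in tiles L -> cut L x0 h a \in tiles M by exact: vins_cut_in.
have gM' a : a \in tiles L' -> cut L' x0' h' a \in tiles M' by exact: vins_cut_in.
have pk : perm_eq (map (cut L' x0' h') (tiles L')) (map k (map (cut L x0 h) (tiles L))).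
  rewrite -(perm_cons (corner L' x0' h')) -{2}kr -map_cons.
  apply: perm_trans (perm_map k pM); apply: perm_trans Ik.1.
  by rewrite perm_sym.
(* [w] undoes the cut; it recognises the tiles to be extended by their contact with the corner,
   which the isomorphism preserves. *)
pose w c := if below (corner L' x0' h') c
  then Rect (x1 c) (y1 (box L')) (x2 c) (y2 c) else c.
have wK a : a \in tiles L' -> w (cut L' x0' h' a) = a.
  move=> aL; rewrite /w (below_corner_cut V') // /cut.
  case O: (over L' x0' a) => //=.
  by move: O; rewrite /over => /andP[/eqP <- _]; case: (a).
have vP a : a \in tiles L -> w (k (cut L x0 h a)) \in tiles L' /\
    cut L' x0' h' (w (k (cut L x0 h a))) = k (cut L x0 h a).
  move=> aL; have : k (cut L x0 h a) \in map (cut L' x0' h') (tiles L').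
    by rewrite (perm_mem pk) !map_f.
  by case/mapP => a' a'L ->; rewrite wK.
have [||||f If _] := @iso_param _ _ (tiles L) id (fun a => w (k (cut L x0 h a))) L L'.
- exact: tiles_uniq.
- by rewrite map_id.
- have <- : map w (map (cut L' x0' h') (tiles L')) = tiles L'.
    by rewrite -map_comp -[RHS]map_id; apply/eq_in_map => a /wK.
  by rewrite map_comp (map_comp k) perm_map.
- move=> a b aL bL; have [aL' ea] := vP _ aL; have [bL' eb] := vP _ bL.
  have [lo be] := Ik.2 _ _ (gM _ aL) (gM _ bL).
  rewrite /= -(below_cut V' aL' bL') ea eb -be -(below_cut V) //; split=> //.
  rewrite (left_of_uncut V aL bL) (left_of_uncut V' aL' bL') /= ea eb lo.
  have [lr _] := Ik.2 _ _ (gM _ aL) rM; have [_ br] := Ik.2 _ _ rM (gM _ bL).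
  rewrite -(below_corner_cut V bL) -(below_corner_cut V' bL') eb -kr.
  rewrite -lr -br; congr (_ || [&& _, _ & ~~ _]); apply: (iso_has Ik) => c cM.
  have [-> _] := Ik.2 _ _ cM (gM _ bL).
  by have [_ ->] := Ik.2 _ _ rM cM.
by exists f.
Qed.

(* Expresses through the two relations alone that the top-left vertex of the
   bottom-right tile has its stem to the right, so that this type is invariant
   under isomorphisms. *)
Definition vtype L : bool :=
  let r := bottom_right L in
  has (below r) (tiles L) &&
  ~~ has (fun c => left_of c r && has (fun a => below r a && below c a) (tiles L))
         (tiles L).

Lemma iso_vtype f L M : is_rectangulation L -> is_rectangulation M ->
  iso f L M -> vtype L = vtype M.
Proof.
move=> HL HM If; have [rL _ _] := bottom_right_in HL.
rewrite /vtype -(iso_bottom_right HL HM If); congr (_ && ~~ _).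
  by apply: (iso_has If) => a aL; have [_ ->] := If.2 _ _ rL aL.
apply: (iso_has If) => c cL; have [-> _] := If.2 _ _ cL rL; congr (_ && _).
apply: (iso_has If) => a aL.
by have [_ ->] := If.2 _ _ rL aL; have [_ ->] := If.2 _ _ cL aL.
Qed.

(** Tells the two orientations apart: a layout arising by a vertical insertion is never isomorphic
    to one arising by a horizontal insertion. *)
Lemma vins_vtype L M x0 h : vins L M x0 h -> vtype M && ~~ vtype (trL M).
Proof.
move=> V; have [HL HM Bx pM [b bL [xb yb]]] := V; have [hB xB1 xB2] := vins_bounds V.
have rM := vins_corner_in V; have Ob : over L x0 b by rewrite /over; lra.
have gbM := vins_cut_in V bL; have hb := over_high V bL Ob.
have nb := tile_nd HL bL; have Bb := tile_in_box HL bL; move: nb Bb.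
rewrite /nondegenerate /contained => nb Bb.
have br : below (corner L x0 h) (cut L x0 h b) by rewrite (below_corner_cut V).
rewrite /vtype bottom_right_tr (vins_bottom_right V); apply/andP; split.
  apply/andP; split; first by apply/hasP; exists (cut L x0 h b).
  apply/hasPn => c cM; apply/negP => /andP[cr /hasP[a aM]].
  rewrite !(tile_belowE HM) //= => /andP[h1 h2].
  move: cr; rewrite (tile_left_ofE HM) //= => cr.
  have e : cut L x0 h b = a.
    apply: (overlap_eq HM) => //; have := tile_nd HM aM.
    by rewrite /overlap /cut Ob /nondegenerate /=; lra.
  by move: h2; rewrite -e /cut Ob /= {e}; lra.
rewrite negb_and negbK; have [e|xB3] := eqVneq x0 (x1 (box L)).
  apply/orP; left; rewrite /= has_map; apply/hasPn => c cM /=.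
  rewrite below_tr (tile_left_ofE HM) //=.
  have := tile_in_box HM cM; have := tile_nd HM cM.
  by rewrite /contained /nondegenerate Bx; lra.
apply/orP; right; rewrite /= has_map.
have [|c cM] := @quad_cover _ _ HM false true x0 h.
  by rewrite /quad Bx /=; lra.
rewrite /quad /= => Q; have := tile_nd HM cM; rewrite /nondegenerate => nc.
have [gx1 gy1 gx2 gy2] : [/\ x1 (cut L x0 h b) = x1 b, y1 (cut L x0 h b) = h,
    x2 (cut L x0 h b) = x2 b & y2 (cut L x0 h b) = y2 b] by rewrite /cut Ob.
move: (cut L x0 h b) gbM br gx1 gy1 gx2 gy2 => gb gbM br gx1 gy1 gx2 gy2.
have xc : x2 c = x0.
  apply/eqP; rewrite eq_le; apply/andP; split; last lra.
  rewrite leNgt; apply/negP => lt; have e : c = gb.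
    by apply: (overlap_eq HM) => //; rewrite /overlap /=; lra.
  by move: Q; rewrite e /= {e}; lra.
apply/hasP; exists gb => //.
rewrite /= left_of_tr br has_map; apply/hasP.
(* If [c] runs past the vertex on the left, it has both the corner and [gb] to its right, which
   refutes [vtype] of the reflection. If [c] starts at the vertex, the tile under it completes a
   cross. *)
have [hc|hc] := ltP (y1 c) h.
  exists c => //=; rewrite !below_tr !(tile_left_ofE HM) //=.
  have := tile_in_box HM cM; rewrite /contained Bx.
  by lra.
have [|d dM] := @quad_cover _ _ HM false false x0 h.
  by rewrite /quad Bx /=; lra.
rewrite /quad /= => Qd; have := tile_nd HM dM; rewrite /nondegenerate => nd.
have yd : y2 d = h.
  apply/eqP; rewrite eq_le; apply/andP; split; last lra.
  rewrite leNgt; apply/negP => lt; have e : c = d.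
    by apply: (overlap_eq HM) => //; rewrite /overlap /=; lra.
  by move: Qd; rewrite -e /= {e}; lra.
have xd : x2 d = x0.
  apply/eqP; rewrite eq_le; apply/andP; split; last lra.
  rewrite leNgt; apply/negP => lt; have e : corner L x0 h = d.
    apply: (overlap_eq HM) => //; have := tile_in_box HM dM.
    by rewrite /contained /overlap /= Bx; lra.
  by move: Qd; rewrite -e /= {e}; lra.
have /negP[] := @no_cross _ _ HM x0 h _ _ _ _ dM rM cM gbM.
by rewrite /cross /= {Bx}; lra.
Qed.

End InsertionInvariance.

(** * Deletion *)

Section Deletion.

Variable F : realFieldType.
Implicit Types (L M : layout F) (a b c d r : rect F) (x y m h : F).

Definition extend r a : rect F :=
  if below r a then Rect (x1 a) (y1 r) (x2 a) (y2 a) else a.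

Definition undercut M : layout F :=
  let r := bottom_right M in
  (box M, [seq extend r a | a <- tiles M & a != r]).

Lemma delete_stem_right M : let r := bottom_right M in
  stem_right M (x1 r, y2 r) -> delete M = undercut M.
Proof. by rewrite /= /delete => ->. Qed.

(** The tile [d] standing on the top-left vertex of the corner shows that the left side of the
    corner continues upwards. So the tiles extended downwards fill the place of the corner
    exactly. *)
Lemma vins_undercut M d : is_rectangulation M -> d \in tiles M ->
  x1 d = x1 (bottom_right M) -> y1 d = y2 (bottom_right M) ->
  vins (undercut M) M (x1 (bottom_right M)) (y2 (bottom_right M)).
Proof.
move=> HM dM; rewrite /undercut; have [rM] := bottom_right_in HM.
move: (bottom_right M) rM => r rM xr yr xd yd.
have nr := tile_nd HM rM; have Br := tile_in_box HM rM.
have nd_d := tile_nd HM dM; have Bd := tile_in_box HM dM.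
have /andP[wB hB] := box_nd HM.
move: nr Br nd_d Bd; rewrite /nondegenerate /contained => nr Br nd_d Bd.
have E1 a : [/\ x1 (extend r a) = x1 a, x2 (extend r a) = x2 a & y2 (extend r a) = y2 a].
  by rewrite /extend; case: ifP.
(* A tile above r cannot stick out to the left, because of d. *)
have E2 a : a \in tiles M -> a != r -> [/\ nondegenerate a, contained a (box M) &
    [&& y1 a == y2 r, y1 (extend r a) == y1 r & x1 r <= x1 a] ||
    [&& y1 (extend r a) == y1 a & (x2 a <= x1 r) || (y2 r < y1 a)]].
  move=> aM ar; have na := tile_nd HM aM; have Ba := tile_in_box HM aM.
  split=> //; move: na Ba; rewrite /nondegenerate /contained => na Ba.
  have /negP nov : ~ overlap a r.
    by move=> /(overlap_eq HM aM rM) /eqP; apply/negP.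
  move: nov; rewrite /overlap /extend (tile_belowE HM) //; case: ifP => [be|nbe] nov /=.
    apply/orP; left; apply/and3P; split; rewrite ?eqxx //; first lra.
    rewrite leNgt; apply/negP => lt; have e : a = d.
      by apply: (overlap_eq HM) => //; rewrite /overlap; lra.
    by move: lt; rewrite e {e}; lra.
  by apply/orP; right; rewrite eqxx /=; lra.
have inj : {in [seq a <- tiles M | a != r] &, forall a b,
    overlap (extend r a) (extend r b) -> a = b}.
  move=> a b; rewrite !mem_filter => /andP[ar aM] /andP[br bM] ov.
  apply: (overlap_eq HM) => //; move: ov; rewrite /overlap.
  have [-> -> ->] := E1 a; have [-> -> ->] := E1 b.
  have [na Ba Ea] := E2 _ aM ar; have [nb Bb Eb] := E2 _ bM br.
  move: na Ba nb Bb Ea Eb; rewrite /nondegenerate /contained => na Ba nb Bb.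
  by case/orP => ?; case/orP => ?; lra.
have HL : is_rectangulation (box M, [seq extend r a | a <- tiles M & a != r]).
  apply: is_rectangulation_intro; rewrite /box /tiles /= -/(box M) -/(tiles M).
  - by rewrite /nondegenerate wB hB.
  - move=> _ /mapP[a + ->]; rewrite mem_filter => /andP[ar aM].
    have [na Ba Ea] := E2 _ aM ar; move: na Ba Ea.
    rewrite /nondegenerate /contained; have [-> -> ->] := E1 a.
    by move=> na Ba /orP[] ?; split; lra.
  - rewrite map_inj_in_uniq ?filter_uniq ?(tiles_uniq HM) //.
    move=> a b aM bM e; apply: inj => //.
    move: aM; rewrite mem_filter => /andP[ar aM].
    have [na Ba Ea] := E2 _ aM ar; move: na Ba Ea.
    rewrite -e /overlap /nondegenerate /contained; have [-> -> ->] := E1 a.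
    by move=> {e} na Ba /orP[] ?; lra.
  - by move=> _ _ /mapP[a aM ->] /mapP[b bM ->] /inj ->.
  - move=> x y Q; have [a aM Qa] := quad_cover HM Q.
    have [e|ar] := eqVneq a r; last first.
      exists (extend r a); first by rewrite map_f // mem_filter ar.
      have [na Ba Ea] := E2 _ aM ar; move: Qa na Ba Ea.
      rewrite /quad /= /nondegenerate /contained; have [-> -> ->] := E1 a.
      by move=> Qa na Ba /orP[] ?; lra.
    move: Q Qa; rewrite e /quad /= => {e a aM} Q Qr.
    (* A point of the removed tile is covered by the extension of the tile that rests on it at the
       same abscissa. *)
    have [|a aM] := @quad_cover _ _ HM true true x (y2 r).
      by rewrite /quad /=; lra.
    rewrite /quad /= => Qa.
    have ar : a != r by apply: contraTneq Qa => ->; lra.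
    exists (extend r a); first by rewrite map_f // mem_filter ar.
    have [na Ba Ea] := E2 _ aM ar; move: na Ba Ea.
    rewrite /nondegenerate /contained; have [-> -> ->] := E1 a.
    by move=> na Ba /orP[] ?; lra.
  - move=> x y _ _ _ _ /mapP[a + ->] /mapP[b + ->] /mapP[c + ->] /mapP[e + ->].
    rewrite !mem_filter => /andP[ar aM] /andP[br bM] /andP[cr cM] /andP[er eM].
    (* An extended tile starts at the bottom of the box, where no tile can end. So the upper two
       tiles of a cross are not extended, and the cross was there before. *)
    apply: contra (@no_cross _ _ HM x y _ _ _ _ aM bM cM eM); rewrite /cross.
    have [_ -> ->] := E1 a; have [-> _ ->] := E1 b.
    have [_ -> _] := E1 c; have [-> _ _] := E1 e.
    have [na Ba _] := E2 _ aM ar.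
    have [_ _ Ec] := E2 _ cM cr; have [_ _ Ee] := E2 _ eM er.
    move: na Ba Ec Ee; rewrite /nondegenerate /contained => na Ba.
    by case/orP => ?; case/orP => ?; lra.
split=> //; last first.
  have dr : d != r by apply: contraTneq isT => e; move: yd nr; rewrite e; lra.
  exists (extend r d); first by rewrite map_f // mem_filter dr.
  rewrite /extend (tile_belowE HM) //.
  by have -> /= : [&& y2 r == y1 d, x1 r < x2 d & x1 d < x2 r] by lra.
apply: perm_trans (perm_to_rem rM) _.
have -> : corner (box M, [seq extend r a | a <- tiles M & a != r]) (x1 r) (y2 r) = r.
  by apply: rect_eq.
rewrite perm_cons rem_filter ?(tiles_uniq HM) // /tiles /= -map_comp -/(tiles M).
rewrite (_ : map _ _ = [seq a <- tiles M | a != r]) ?perm_refl //.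
rewrite -[RHS]map_id; apply/eq_in_map => a; rewrite mem_filter => /andP[ar aM].
have [na Ba Ea] := E2 _ aM ar; have [ex1 ex2 ey2] := E1 a.
have nov : ~~ overlap a r.
  by apply: contra ar => /(overlap_eq HM aM rM) /eqP.
move: na Ba nov Ea; rewrite /= /cut /over ex1 ex2 ey2 /nondegenerate /contained /overlap.
rewrite /box /= => na Ba nov Ea; case: ifP => O.
  by apply: rect_eq => //=; lra.
by apply: rect_eq => //; lra.
Qed.

End Deletion.

(** * The two types of the top-left vertex of the corner tile *)

Section StemCases.

Variable F : realFieldType.
Implicit Types (L M : layout F) (a b c d r : rect F) (x y m h : F).

Definition vdeletable M : Prop :=
  let r := bottom_right M in
  stem_right M (x1 r, y2 r) /\
  exists2 d, d \in tiles M & x1 d = x1 r /\ y1 d = y2 r.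

Lemma vdeletableP M : is_rectangulation M -> vdeletable M ->
  exists x h, vins (delete M) M x h.
Proof.
move=> HM [s [d dM [xd yd]]]; rewrite (delete_stem_right s).
by exists (x1 (bottom_right M)), (y2 (bottom_right M)); exact: vins_undercut xd yd.
Qed.

Lemma stem_right_intro M r d : is_rectangulation M -> r \in tiles M ->
  d \in tiles M -> x1 d = x1 r -> y1 d = y2 r ->
  {in tiles M, forall a, x1 a < x1 r <= x2 a -> (y1 a != y2 r) && (y2 a != y2 r)} ->
  stem_right M (x1 r, y2 r).
Proof.
move=> HM rM dM xd yd H; have /andP[? ?] := tile_nd HM rM.
have /andP[? ?] := tile_nd HM dM; apply/and4P; split.
- by apply/hasP; exists d => //=; lra.
- by apply/hasP; exists r => //=; lra.
- by apply/hasP; exists r => //=; lra.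
- apply/hasPn => a aM /=; have := H _ aM; case: (x1 a < x1 r <= x2 a); last by rewrite andbF.
  by move=> /(_ isT); lra.
Qed.

(** Here the top-left vertex of the corner tile lies on the left side of the box, so nothing reaches
    it from the left. *)
Lemma vdeletable_bottom M : is_rectangulation M -> (1 < size (tiles M))%N ->
  x1 (bottom_right M) = x1 (box M) -> vdeletable M.
Proof.
move=> HM sz; have [rM xr yr] := bottom_right_in HM.
rewrite /vdeletable /=; move: (bottom_right M) rM xr yr => r rM xr yr xr1.
have := tile_nd HM rM; have := tile_in_box HM rM.
rewrite /contained /nondegenerate => Br nr.
have yrB : y2 r < y2 (box M).
  rewrite ltNge; apply/negP => le; move: sz; rewrite ltnNge => /negP[].
  apply: (@uniq_leq_size _ (tiles M) [:: r]) => [|a aM]; first exact: tiles_uniq.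
  rewrite inE; apply/eqP/(overlap_eq HM) => //.
  have := tile_nd HM aM; have := tile_in_box HM aM.
  by rewrite /contained /nondegenerate /overlap; lra.
have [|d dM] := @quad_cover _ _ HM true true (x1 r) (y2 r).
  by rewrite /quad /=; lra.
rewrite /quad /= => Qd; have := tile_nd HM dM; have := tile_in_box HM dM.
rewrite /contained /nondegenerate => Bd nd.
have xd : x1 d = x1 r by lra.
have yd : y1 d = y2 r.
  apply/eqP; rewrite eq_le; apply/andP; split; first lra.
  rewrite leNgt; apply/negP => lt; have e : d = r.
    by apply: (overlap_eq HM) => //; rewrite /overlap; lra.
  by move: Qd; rewrite e {e}; lra.
split; last by exists d.
apply: (stem_right_intro HM rM dM xd yd) => a aM ax.
by have := tile_in_box HM aM; rewrite /contained; lra.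
Qed.

(** The tile [c] runs past the vertex on the left, so no horizontal side ends there from that
    direction and the stem points right. *)
Lemma vdeletable_wall M c : is_rectangulation M ->
  let r := bottom_right M in c \in tiles M -> y2 r < y2 (box M) ->
  x1 c < x1 r <= x2 c -> y1 c < y2 r < y2 c -> vdeletable M.
Proof.
move=> HM; have [rM xr yr] := bottom_right_in HM.
rewrite /vdeletable /=; move: (bottom_right M) rM xr yr => r rM xr yr cM yrB xc yc.
have := tile_nd HM rM; have := tile_in_box HM rM.
rewrite /contained /nondegenerate => Br nr.
have cr : ~~ overlap c r.
  by apply/negP => /(overlap_eq HM cM rM) e; move: xc; rewrite e {e}; lra.
move: cr; rewrite /overlap => cr.
have [|d dM] := @quad_cover _ _ HM true true (x1 r) (y2 r).
  by rewrite /quad /=; lra.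
rewrite /quad /= => Qd; have := tile_nd HM dM; rewrite /nondegenerate => nd.
have xd : x1 d = x1 r.
  apply/eqP; rewrite eq_le; apply/andP; split; first lra.
  rewrite leNgt; apply/negP => lt; have e : d = c.
    by apply: (overlap_eq HM) => //; rewrite /overlap; lra.
  by move: Qd; rewrite e {e}; lra.
have yd : y1 d = y2 r.
  apply/eqP; rewrite eq_le; apply/andP; split; first lra.
  rewrite leNgt; apply/negP => lt; have e : d = r.
    by apply: (overlap_eq HM) => //; rewrite /overlap; lra.
  by move: Qd; rewrite e {e}; lra.
split; last by exists d.
apply: (stem_right_intro HM rM dM xd yd) => a aM ax.
have := tile_nd HM aM; rewrite /nondegenerate => na.
have [e|ac] := eqVneq a c; first by rewrite e {e}; lra.
have : ~~ overlap a c by apply: contra ac => /(overlap_eq HM aM cM) ->.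
by rewrite /overlap; lra.
Qed.

Lemma vdeletable_or M : is_rectangulation M -> (1 < size (tiles M))%N ->
  vdeletable M \/ vdeletable (trL M).
Proof.
move=> HM sz; have HM' := is_rectangulation_tr HM.
have [rM xr yr] := bottom_right_in HM.
have := tile_nd HM rM; have := tile_in_box HM rM.
rewrite /contained /nondegenerate => Br nr.
have [e|xr1] := eqVneq (x1 (bottom_right M)) (x1 (box M)).
  by left; apply: vdeletable_bottom.
have [e|yr2] := eqVneq (y2 (bottom_right M)) (y2 (box M)).
  by right; apply: vdeletable_bottom; rewrite ?size_map // bottom_right_tr /= e.
(* The tile in the upper left quadrant at the vertex decides: it runs past the vertex downwards, or
   it runs past it to the right, or it has a corner there and completes a cross. *)
have [|c cM] := @quad_cover _ _ HM false true (x1 (bottom_right M)) (y2 (bottom_right M)).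
  by rewrite /quad /=; lra.
rewrite /quad /= => Qc; have := tile_nd HM cM; rewrite /nondegenerate => nc.
have [yc|yc] := ltP (y1 c) (y2 (bottom_right M)).
  by left; apply: (@vdeletable_wall _ c) => //; lra.
have [xc|xc] := ltP (x1 (bottom_right M)) (x2 c).
  right; apply: (@vdeletable_wall _ (tr c)); rewrite ?mem_trL // bottom_right_tr /=; lra.
move: (bottom_right M) rM xr yr Br nr xr1 yr2 Qc yc xc => r rM xr yr Br nr xr1 yr2 Qc yc xc.
have [|d dM] := @quad_cover _ _ HM true true (x1 r) (y2 r).
  by rewrite /quad /=; lra.
have [|e eM] := @quad_cover _ _ HM false false (x1 r) (y2 r).
  by rewrite /quad /=; lra.
rewrite /quad /= => Qe Qd; have := tile_nd HM dM; have := tile_nd HM eM.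
rewrite /nondegenerate => ne nd.
have ed : ~~ overlap d c.
  by apply/negP => /(overlap_eq HM dM cM) e'; move: Qd; rewrite e' {e'}; lra.
have ed2 : ~~ overlap d r.
  by apply/negP => /(overlap_eq HM dM rM) e'; move: Qd; rewrite e' {e'}; lra.
have ee : ~~ overlap e c.
  by apply/negP => /(overlap_eq HM eM cM) e'; move: Qe; rewrite e' {e'}; lra.
have ee2 : ~~ overlap e r.
  by apply/negP => /(overlap_eq HM eM rM) e'; move: Qe; rewrite e' {e'}; lra.
move: ed ed2 ee ee2; rewrite /overlap => ed ed2 ee ee2.
have /negP[] := @no_cross _ _ HM (x1 r) (y2 r) _ _ _ _ eM rM cM dM.
by rewrite /cross; lra.
Qed.

Lemma delete_vins M : is_rectangulation M -> (1 < size (tiles M))%N ->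
  exists x h, vins (delete M) M x h \/ vins (trL (delete M)) (trL M) x h.
Proof.
move=> HM sz; have [H|H] := vdeletable_or HM sz.
  by have [x [h V]] := vdeletableP HM H; exists x, h; left.
have [x [h V]] := vdeletableP (is_rectangulation_tr HM) H.
by exists x, h; right; rewrite -delete_tr.
Qed.

Lemma delete_rectangulation M : is_rectangulation M -> (1 < size (tiles M))%N ->
  is_rectangulation (delete M).
Proof.
move=> HM sz; have [x [h [[]|[]]]] := delete_vins HM sz => // H _ _ _ _.
by rewrite -(trLK (delete M)); exact: is_rectangulation_tr.
Qed.

End StemCases.

(** * Insertion points *)

Section InsertionPoints.

Variable F : realFieldType.
Implicit Types (L M : layout F) (a b c d r : rect F) (x y m h : F).

Lemma mem_zip_behead (t : seq F) e1 e2 : sorted <%R t ->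
  ((e1, e2) \in zip t (behead t)) =
  [&& e1 \in t, e2 \in t, e1 < e2 & all (fun z => ~~ (e1 < z < e2)) t].
Proof.
elim: t => [|x [|y t] IHt] //= st.
  by rewrite !inE !andbT; case: eqP => // ->; case: eqP => // ->; rewrite ltxx.
have /andP[xy pt] := st; have xt z : z \in y :: t -> y <= z.
  rewrite inE => /predU1P[->//|zt].
  by apply/ltW/(allP (order_path_min lt_trans pt)).
rewrite in_cons IHt // xpair_eqE; apply/orP/idP.
  case=> [/andP[/eqP-> /eqP->]|/and4P[h1 h2 h3 h4]].
    rewrite !inE !eqxx xy /= orbT ltxx /= /=; apply/andP; split; first lra.
    by apply/allP => z zt; have := xt z; rewrite inE zt orbT => /(_ isT); lra.
  rewrite in_cons h1 in_cons h2 h3 !orbT /=; apply/andP; split; last exact: h4.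
  by have := xt _ h1; lra.
case/and4P; rewrite in_cons [e2 \in _]in_cons => h1 h2 h3 /andP[h4 h5].
move: h1 => /predU1P[e|e1t]; [left|right].
  have e2t : e2 \in y :: t by case/predU1P: h2 => // e'; rewrite e e' ltxx in h3.
  have := xt _ e2t; move: h5 => /andP[h5 _]; move: h5.
  by rewrite e eqxx /=; lra.
rewrite e1t h3 /=; apply/andP; split; last exact: h5.
by case/predU1P: h2 => // e'; have := xt _ e1t; lra.
Qed.

Definition consecutive (s : pred F) e1 e2 : Prop :=
  [/\ s e1, s e2, e1 < e2 & forall z, s z -> ~~ (e1 < z < e2)].

Lemma mem_midpoints (s : seq F) m : m \in midpoints s <->
  exists e1 e2, consecutive [in s] e1 e2 /\ m = (e1 + e2) / 2.
Proof.
rewrite /midpoints; set t := sort _ _.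
have st : sorted <%R t by rewrite sort_lt_sorted undup_uniq.
have mt z : (z \in t) = (z \in s) by rewrite mem_sort mem_undup.
split=> [/mapP[[e1 e2]]|[e1 [e2 [[h1 h2 h3 h4] ->]]]].
  rewrite mem_zip_behead // !mt => /and4P[h1 h2 h3 h4] ->.
  exists e1, e2; split=> //; split=> // z /= zs.
  by apply: (allP h4); rewrite mt.
apply/mapP; exists (e1, e2) => //; rewrite mem_zip_behead // !mt.
by rewrite h1 h2 h3; apply/allP => z; rewrite mt => /h4.
Qed.

Lemma seq_max (s : seq F) x : x \in s ->
  exists2 e, e \in s & {in s, forall z, z <= e}.
Proof.
elim: s x => // y [|z s] IHs x _.
  by exists y; rewrite ?mem_head // => w /[!inE] /eqP->.
have [|e es eP] := IHs z; first exact: mem_head.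
have [ye|ye] := leP y e.
  by exists e; [rewrite inE es orbT | move=> w /[!in_cons] /predU1P[->//|/eP]].
exists y; first exact: mem_head.
by move=> w; rewrite in_cons => /predU1P[->//|/eP]; lra.
Qed.

Lemma seq_consecutive (s : seq F) lo hi y : lo \in s -> hi \in s ->
  lo < y < hi -> y \notin s ->
  exists e1 e2, [/\ consecutive [in s] e1 e2, lo <= e1, e1 < y < e2 & e2 <= hi].
Proof.
move=> los his yP ys.
have [|e1] := @seq_max [seq z <- s | z < y] lo; first by rewrite mem_filter los; lra.
rewrite mem_filter => /andP[e1y e1s] e1P.
have [|e2] := @seq_max [seq - z | z <- s & y < z] (- hi).
  by apply: map_f; rewrite mem_filter his; lra.
case/mapP => z; rewrite mem_filter => /andP[yz zs] -> e2P {e2}.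
have lo1 : lo <= e1 by apply: e1P; rewrite mem_filter los; lra.
have hi1 : z <= hi.
  by have := e2P (- hi); rewrite lerN2; apply; rewrite map_f // mem_filter his; lra.
exists e1, z; split=> //; last lra.
split=> //; first lra; move=> w ws; apply/negP => /andP[w1 w2].
have [wy|wy|e] := ltgtP w y; last by rewrite -e ws in ys.
  by have := e1P w; rewrite mem_filter wy ws => /(_ isT); lra.
by have := e2P (- w) (map_f _ _); rewrite mem_filter wy ws => /(_ isT); lra.
Qed.

Definition vertexb L x y : bool :=
  has (fun a => ((x == x1 a) || (x == x2 a)) && ((y == y1 a) || (y == y2 a)))
    (tiles L).

Lemma mem_vertices L x y : ((x, y) \in vertices L) = vertexb L x y.
Proof.
apply/flatten_mapP/hasP => -[a aL H]; exists a => //.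
  by move: H; rewrite !inE !xpair_eqE => /or4P[] /andP[-> ->]; rewrite ?orbT.
by move: H => /andP[/orP[] /eqP-> /orP[] /eqP->]; rewrite !inE eqxx ?orbT.
Qed.

(* [m] is the midpoint of an edge on the left side of b. *)
Definition left_edge L b m : Prop :=
  exists e1 e2, [/\ consecutive (vertexb L (x1 b)) e1 e2, y1 b <= e1,
    e2 <= y2 b & m = (e1 + e2) / 2].

Definition vpoint L x m : Prop :=
  exists b, [/\ b \in tiles L, y1 b = y1 (box L), x1 b = x & left_edge L b m].

Lemma mem_side_vertices L b y :
  (y \in [seq v.2 | v <- vertices L & (v.1 == x1 b) && (y1 b <= v.2 <= y2 b)]) =
  vertexb L (x1 b) y && (y1 b <= y <= y2 b).
Proof.
rewrite -mem_vertices; apply/mapP/andP => [[[x z]]|[h1 h2]].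
  by rewrite mem_filter /= => /andP[/andP[/eqP-> zb] v] ->.
by exists (x1 b, y); rewrite // mem_filter h1 h2 eqxx.
Qed.

Lemma left_edgeP L b m :
  m \in midpoints [seq v.2 | v <- vertices L & (v.1 == x1 b) && (y1 b <= v.2 <= y2 b)]
  <-> left_edge L b m.
Proof.
rewrite mem_midpoints; split=> -[e1 [e2]].
  case=> -[]; rewrite /= !mem_side_vertices => /andP[h1 h1'] /andP[h2 h2'] lt H ->.
  exists e1, e2; split; [split=> // z vz|lra|lra|by []].
  apply/negP => ez; move: (H z).
  rewrite /= mem_side_vertices vz ez (_ : y1 b <= z <= y2 b) => [/(_ isT) //|].
  by lra.
case=> -[h1 h2 lt H] l1 l2 ->; exists e1, e2; split=> //; split=> //=.
- by rewrite mem_side_vertices h1; lra.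
- by rewrite mem_side_vertices h2; lra.
- by move=> z; rewrite /= mem_side_vertices => /andP[/H].
Qed.

Lemma mem_vpoint L x m :
  ((true, (x, m)) \in insertion_points L) <-> vpoint L x m.
Proof.
rewrite /insertion_points mem_cat orbC.
rewrite (_ : _ \in _ = false) /=; last by apply/negbTE/mapP => -[].
rewrite mem_map ?mem_sort; last by move=> u v [].
split=> [/flatten_mapP[b]|[b [bL yb xb /left_edgeP mb]]].
  rewrite mem_filter => /andP[/eqP yb bL] /mapP[y /left_edgeP my [-> ->]].
  by exists b.
apply/flatten_mapP; exists b; first by rewrite mem_filter yb eqxx.
by rewrite -xb; apply: map_f.
Qed.

Lemma vertexb_tr L x y : vertexb (trL L) (- y) (- x) = vertexb L x y.
Proof.
rewrite /vertexb has_map; apply: eq_has => a /=; rewrite !eqr_opp.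
by rewrite andbC orbC [(y == _) || _]orbC.
Qed.

(** Because of this, statements about insertion points need a proof only for vertical ones. *)
Lemma mem_hpoint L x y :
  ((false, (x, y)) \in insertion_points L) <-> vpoint (trL L) (- y) (- x).
Proof.
rewrite /insertion_points mem_cat.
rewrite (_ : _ \in _ = false) /=; last by apply/negbTE/mapP => -[].
rewrite mem_map ?mem_sort; last by move=> u v [].
have P b z : (z \in [seq v.1 | v <- vertices L & (v.2 == y2 b) && (x1 b <= v.1 <= x2 b)]) =
    vertexb L z (y2 b) && (x1 b <= z <= x2 b).
  rewrite -mem_vertices; apply/mapP/andP => [[[u w]]|[h1 h2]].
    by rewrite mem_filter /= => /andP[/andP[/eqP-> ub] v] ->.
  by exists (z, y2 b); rewrite // mem_filter h1 h2 eqxx.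
split=> [/flatten_mapP[b]|[b' [/mapP[b bL ->] /= /eqP yb /eqP xb mb]]].
  rewrite mem_filter => /andP[/eqP yb bL] /mapP[z /mem_midpoints mz [-> ->]].
  exists (tr b); rewrite mem_trL /= yb; split=> //.
  case: mz => e1 [e2 [[]]]; rewrite /= !P => /andP[h1 h1'] /andP[h2 h2'] lt H ->.
  exists (- e2), (- e1); rewrite /= ; split; [|lra|lra|lra].
  split; rewrite ?vertexb_tr //; first lra.
  move=> w; rewrite -[w]opprK vertexb_tr => vw.
  apply/negP => ew; move: (H (- w)).
  rewrite /= P vw (_ : x1 b <= - w <= x2 b) => [/(_ isT) ?|]; lra.
rewrite eqr_opp in yb; rewrite eqr_opp in xb.
apply/flatten_mapP; exists b; first by rewrite mem_filter yb.
rewrite -(eqP xb); apply: map_f; apply/mem_midpoints.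
case: mb => e1 [e2 [[]]]; rewrite /= -[e1]opprK -[e2]opprK !vertexb_tr.
move=> h1 h2 lt H l1 l2 e; exists (- e2), (- e1); split; last lra.
split; rewrite /= ?P ?h1 ?h2 /=; try lra.
by move=> z; rewrite /= P => /andP[vz _]; have := H (- z); rewrite vertexb_tr vz => /(_ isT); lra.
Qed.

Definition trq (q : bool * (F * F)) := (~~ q.1, (- q.2.2, - q.2.1)).

Lemma trqK : involutive trq.
Proof. by case=> [f [x y]]; rewrite /trq /= negbK !opprK. Qed.

(** The reflection reverses the order of the insertion points, so only membership is transferred;
    the order is handled by [key]. *)
Lemma insertion_points_tr L q :
  (trq q \in insertion_points (trL L)) = (q \in insertion_points L).
Proof.
case: q => -[] [x y]; rewrite /trq /=; apply/idP/idP.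
- by move=> /mem_hpoint; rewrite trLK !opprK => /mem_vpoint.
- by move=> /mem_vpoint V; apply/mem_hpoint; rewrite trLK !opprK.
- by move=> /mem_vpoint V; apply/mem_hpoint.
- by move=> /mem_hpoint V; apply/mem_vpoint.
Qed.

Lemma becomes_above_tr L q a :
  becomes_above (trL L) (trq q) (tr a) = becomes_left L q a.
Proof.
case: q => -[] [x y]; rewrite /becomes_above /becomes_left /=.
  by rewrite eqr_opp ltrN2.
by rewrite eqr_opp lerN2.
Qed.

Lemma becomes_left_tr L q a :
  becomes_left (trL L) (trq q) (tr a) = becomes_above L q a.
Proof. by rewrite -becomes_above_tr trqK trLK trK. Qed.

Lemma left_edge_at L b y : is_rectangulation L -> b \in tiles L ->
  y1 b < y < y2 b -> ~~ vertexb L (x1 b) y ->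
  exists e1 e2, [/\ consecutive (vertexb L (x1 b)) e1 e2, y1 b <= e1,
    e1 < y < e2 & e2 <= y2 b].
Proof.
move=> HL bL yb vy; have := tile_nd HL bL; rewrite /nondegenerate => nb.
pose s := [seq v.2 | v <- vertices L & v.1 == x1 b].
have sP z : (z \in s) = vertexb L (x1 b) z.
  rewrite -mem_vertices; apply/mapP/idP => [[[u w]]|h].
    by rewrite mem_filter /= => /andP[/eqP-> h] ->.
  by exists (x1 b, z); rewrite // mem_filter h eqxx.
have [||||e1 [e2 [[h1 h2 lt H] l1 yP l2]]] := @seq_consecutive s (y1 b) (y2 b) y.
- by rewrite sP; apply/hasP; exists b; rewrite ?eqxx.
- by rewrite sP; apply/hasP; exists b; rewrite ?eqxx ?orbT.
- by [].
- by rewrite sP.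
exists e1, e2; split=> //; split=> //; rewrite -?sP //.
by move=> z; rewrite -sP => /H.
Qed.

End InsertionPoints.

(** * Insertion at a vertical point as a cut by a corner tile *)

Section InsertedVins.

Variable F : realFieldType.
Implicit Types (L M : layout F) (a b c d r : rect F) (x y m h : F).

(** The condition in [inserted] with the insertion point in place of its index, and for bare
    layouts, to which the reflection applies directly. *)
Definition inserted_at (q : bool * (F * F)) L M : Prop :=
  exists r (g : rect F -> rect F),
    [/\ box M = box L,
        perm_eq (tiles M) (r :: [seq g a | a <- tiles L]),
        x2 r = x2 (box L) /\ y1 r = y1 (box L),
        {in tiles L, forall a, contained (g a) a} &
        {in tiles L, forall a, below r (g a) = becomes_above L q a /\
                               left_of (g a) r = becomes_left L q a}].

Lemma overE L x m a : becomes_above L (true, (x, m)) a = over L x a.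
Proof. by []. Qed.

Section OutsideCorner.

Variables (g a : rect F) (x0 h : F).
Hypotheses (na : nondegenerate a) (ng : nondegenerate g) (ga : contained g a).
Hypothesis gP : forall x y, x1 a <= x -> x < x2 a -> y1 a <= y -> y < y2 a ->
  (x < x0) || (h <= y) -> [/\ x1 g <= x, x < x2 g, y1 g <= y & y < y2 g].

(** By [gP] the part [g] keeps all points of [a] outside the corner region. Testing this at a few
    points on the sides of the expected rectangle forces [g]. *)
Lemma outside_cut : x0 <= x1 a -> y1 a < h -> y1 g = h ->
  g = Rect (x1 a) h (x2 a) (y2 a).
Proof.
move: na ng ga; rewrite /nondegenerate /contained => na' ng' ga' xa ya yg.
apply: rect_eq => //=.
- by case: (gP (x := x1 a) (y := h)); lra.
- apply/eqP; rewrite eq_le; apply/andP; split; first lra.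
  by rewrite leNgt; apply/negP => ?; case: (gP (x := x2 g) (y := h)); lra.
- apply/eqP; rewrite eq_le; apply/andP; split; first lra.
  by rewrite leNgt; apply/negP => ?; case: (gP (x := x1 a) (y := y2 g)); lra.
Qed.

Lemma outside_id : (x2 a <= x0) || (h <= y1 a) -> g = a.
Proof.
move: na ng ga; rewrite /nondegenerate /contained => na' ng' ga' out.
apply: rect_eq => //=.
- by case: (gP (x := x1 a) (y := y1 a)); lra.
- by case: (gP (x := x1 a) (y := y1 a)); lra.
- apply/eqP; rewrite eq_le; apply/andP; split; first lra.
  by rewrite leNgt; apply/negP => ?; case: (gP (x := x2 g) (y := y1 a)); lra.
- apply/eqP; rewrite eq_le; apply/andP; split; first lra.
  by rewrite leNgt; apply/negP => ?; case: (gP (x := x1 a) (y := y2 g)); lra.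
Qed.

End OutsideCorner.

(** A point outside the new tile stays in the tile to which it belonged. Together with the
    prescribed neighbours this determines the left side of the new tile and the shape of all
    others. *)
Lemma inserted_at_vins L M x0 m : is_rectangulation L -> is_rectangulation M ->
  vpoint L x0 m -> inserted_at (true, (x0, m)) L M ->
  exists2 h, vins L M x0 h & {in tiles L, forall a,
    left_of (cut L x0 h a) (corner L x0 h) = becomes_left L (true, (x0, m)) a}.
Proof.
move=> HL HM [b [bL yb xb _]] [r [g [Bx p [xr yr] gsub grel]]].
have rM : r \in tiles M by rewrite (perm_mem p) mem_head.
have gM a : a \in tiles L -> g a \in tiles M.
  by move=> aL; rewrite (perm_mem p) inE map_f ?orbT.
have up : uniq (r :: map g (tiles L)) by rewrite -(perm_uniq p) (tiles_uniq HM).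
have gr a : a \in tiles L -> ~~ overlap (g a) r.
  move=> aL; apply/negP => /(overlap_eq HM (gM _ aL) rM) e.
  by move: up; rewrite /= -e map_f.
have nr := tile_nd HM rM; have Br := tile_in_box HM rM.
have nb := tile_nd HL bL; have Bb := tile_in_box HL bL.
move: nr Br nb Bb; rewrite /nondegenerate /contained Bx => nr Br nb Bb.
have gQ a x y : a \in tiles L -> quad true true x y a ->
    (x < x1 r) || (y2 r <= y) -> quad true true x y (g a).
  move=> aL Qa xy; have Ba := tile_in_box HL aL.
  have [|c cM Qc] := @quad_cover _ _ HM true true x y.
    by move: Qa Ba; rewrite Bx /quad /contained /=; lra.
  move: cM; rewrite (perm_mem p) in_cons => /predU1P[e|/mapP[d dL e]].
    by move: Qa Qc Ba; rewrite e /quad /contained /= {e}; lra.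
  suff -> : a = d by rewrite -e.
  apply: (overlap_eq HL) => //; have := gsub _ dL; move: Qa Qc; rewrite e.
  by rewrite /quad /overlap /contained /= {e}; lra.
have gq a x y : a \in tiles L -> x1 a <= x -> x < x2 a -> y1 a <= y -> y < y2 a ->
    (x < x1 r) || (y2 r <= y) ->
    [/\ x1 (g a) <= x, x < x2 (g a), y1 (g a) <= y & y < y2 (g a)].
  move=> aL h1 h2 h3 h4 h5; have := gQ a x y aL.
  by rewrite /quad /= h1 h2 h3 h4 h5 => /(_ isT isT) /andP[/andP[-> ->] /andP[-> ->]].
have nd a : a \in tiles L -> [/\ nondegenerate a, contained a (box L),
    nondegenerate (g a) & contained (g a) a].
  by move=> aL; rewrite (tile_nd HL) ?(tile_nd HM) ?gM ?(tile_in_box HL) ?gsub.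
have Ob : over L x0 b by rewrite /over yb xb eqxx /=.
have yrB : y2 r < y2 b.
  have [_ _] := nd _ bL; have [+ _] := grel _ bL.
  rewrite (tile_belowE HM) ?gM // overE Ob /nondegenerate /contained; lra.
(* If the new tile reached further left than [x0], a tile starting left of [x0] would rest on it,
   which [becomes_above] forbids. *)
have xr1 : x0 <= x1 r.
  rewrite leNgt; apply/negP => lt.
  have [|c cL] := @quad_cover _ _ HL false true x0 (y2 r).
    by rewrite /quad /=; lra.
  rewrite /quad /= => Qc.
  have [x xP] : exists x, [&& x1 c <= x, x1 r <= x & x < x0].
    by case: (leP (x1 r) (x1 c)) => ?; [exists (x1 c) | exists (x1 r)]; lra.
  have [|||||Q1 Q2 Q3 Q4] := gq c x (y2 r) cL; try lra.
  have := gr _ cL; have [nc Bc ngc gc] := nd _ cL.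
  have [+ _] := grel _ cL; rewrite (tile_belowE HM) ?gM // overE /over.
  by move: nc Bc ngc gc; rewrite /overlap /nondegenerate /contained; lra.
(* If it started to the right of [x0], then [b] would keep its bottom-left corner and could not lie
   above it. *)
have xr2 : x1 r <= x0.
  rewrite leNgt; apply/negP => lt.
  have [|||||Q1 Q2 Q3 Q4] := gq b x0 (y1 b) bL; try lra.
  have [+ _] := grel _ bL; rewrite (tile_belowE HM) ?gM // overE Ob; lra.
have {xr1 xr2} xr1 : x1 r = x0 by lra.
have gE a : a \in tiles L -> g a = cut L x0 (y2 r) a.
  move=> aL; have [na Ba nga ga] := nd _ aL; rewrite /cut.
  have gP x y := gq a x y aL; rewrite xr1 in gP.
  case O: (over L x0 a).
    have [+ _] := grel _ aL; rewrite (tile_belowE HM) ?gM // overE O => be.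
    apply: (outside_cut na nga ga gP); move: O; rewrite /over; lra.
  apply: (outside_id na nga ga gP).
  move: na Ba; rewrite /nondegenerate /contained => na Ba.
  apply/negPn/negP; rewrite negb_or -!ltNge => /andP[xa ya].
  have [x xP] : exists x, [&& x1 a <= x, x0 <= x & x < x2 a].
    by case: (leP x0 (x1 a)) => ?; [exists (x1 a) | exists x0]; lra.
  have [|c cL] := @quad_cover _ _ HL true true x (y1 (box L)).
    by rewrite /quad /=; lra.
  rewrite /quad /= => Qc; have [nc Bc ngc gc] := nd _ cL.
  move: nc Bc ngc gc; rewrite /nondegenerate /contained => nc Bc ngc gc.
  have xc : x0 <= x1 c.
    rewrite leNgt; apply/negP => lt; have e : b = c.
      by apply: (overlap_eq HL) => //; rewrite /overlap; lra.
    by move: lt; rewrite -e {e}; lra.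
  have Oc : over L x0 c by rewrite /over; lra.
  have [+ _] := grel _ cL; rewrite (tile_belowE HM) ?gM // overE Oc => be.
  have e : a = c by apply: (overlap_eq HL) => //; rewrite /overlap; lra.
  by rewrite e Oc in O.
have rE : r = corner L x0 (y2 r) by apply: rect_eq.
exists (y2 r); last first.
  by move=> a aL; rewrite -rE -gE //; have [] := grel _ aL.
split; [exact: HL | exact: HM | exact: Bx | | by exists b].
by rewrite -rE; move/eq_in_map: gE => <-.
Qed.

(** The height [h] is replaced by the midpoint of the edge containing it. No tile on the left starts
    strictly inside an edge, so the set of left neighbours is the same for both heights. *)
Lemma vins_inserted_at L M x0 h : vins L M x0 h ->
  exists2 m, vpoint L x0 m & inserted_at (true, (x0, m)) L M.
Proof.
move=> V; have [HL HM Bx p [b bL [xb yb]]] := V; have [hB xB1 xB2] := vins_bounds V.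
have Ob : over L x0 b by rewrite /over; lra.
have rM := vins_corner_in V; have gbM := vins_cut_in V bL; have hb := over_high V bL Ob.
have := tile_nd HL bL; have := tile_in_box HL bL.
rewrite /contained /nondegenerate => Bb nb.
have [] := @left_edge_at _ L b h HL bL; first lra.
  (* A vertex at height [h] on the left side of [b] would give a cross at the top-left vertex of the
     corner. *)
  apply/hasPn => c cL; apply/negP => Hc.
  have := tile_nd HL cL; have := tile_in_box HL cL.
  rewrite /contained /nondegenerate => Bc nc.
  have xc : x2 c = x0.
    have [e|cb] := eqVneq c b; first by move: Hc; rewrite e {e}; lra.
    have : ~~ overlap c b by apply: contra cb => /(overlap_eq HL cL bL) ->.
    by rewrite /overlap; lra.
  have Oc : over L x0 c = false by rewrite /over; lra.
  have := vins_cut_in V cL; rewrite /cut Oc => cM.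
  have cr : ~~ overlap c (corner L x0 h).
    by apply/negP => /(overlap_eq HM cM rM) e; move: xc; rewrite e /= {e}; lra.
  have yc : (y1 c == h) || (y2 c == h) by case/andP: Hc => _; rewrite ![h == _]eq_sym.
  move: gbM; rewrite /cut Ob => gbM.
  (* The fourth tile of that cross lies above [c] if [c] ends at [h], and under [c] if [c] starts
     there. *)
  have [|d dM] := @quad_cover _ _ HM false (y2 c == h) x0 h.
    by rewrite /quad Bx; case: (y2 c == h) yc => /= yc; lra.
  rewrite /quad /= => Qd; have := tile_nd HM dM; rewrite /nondegenerate => nd.
  move: Bx => _; have dc : ~~ overlap d c.
    apply/negP => /(overlap_eq HM dM cM) e; move: Qd yc; rewrite e {e}.
    by case: (eqVneq (y2 c) h) => /= ? Qd; lra.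
  have dr : ~~ overlap d (corner L x0 h).
    by apply/negP => /(overlap_eq HM dM rM) e; move: Qd; rewrite e /= {e}; lra.
  have db : ~~ overlap d (Rect (x1 b) h (x2 b) (y2 b)).
    by apply/negP => /(overlap_eq HM dM gbM) e; move: Qd; rewrite e /= {e}; lra.
  move: dc dr db Qd; rewrite /overlap /=; case: (eqVneq (y2 c) h) => yc' dc dr db /= Qd.
    have /negP[] := @no_cross _ _ HM x0 h _ _ _ _ cM rM dM gbM.
    by rewrite /cross /=; lra.
  have /negP[] := @no_cross _ _ HM x0 h _ _ _ _ dM rM cM gbM.
  by rewrite /cross /=; lra.
move=> e1 [e2 [[v1 v2 lt H] l1 hP l2]].
exists ((e1 + e2) / 2).
  by exists b; split=> //; exists e1, e2; split=> //; rewrite xb in H *.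
exists (corner L x0 h), (cut L x0 h); split=> //.
  move=> a aL; have := vins_trichotomy V aL; have := tile_nd HL aL.
  rewrite /contained /cut /nondegenerate; case O: (over L x0 a) => /= *; last lra.
  by move: O; rewrite /over; lra.
move=> a aL; rewrite (below_corner_cut V) // (left_of_cut_corner V) //; split=> //.
rewrite /becomes_left /=; case: eqP => //= xa.
have := tile_in_box HL aL; have := tile_nd HL aL.
rewrite /contained /nondegenerate => na Ba.
have [ya|ya] := leP (y1 a) (y2 b); last by lra.
have : ~~ (e1 < y1 a < e2).
  by apply: H; apply/hasP; exists a => //; rewrite xb xa !eqxx orbT.
by move=> h1; apply/idP/idP; lra.
Qed.

End InsertedVins.

(** * Room for an insertion *)

Section RoomForInsertion.

Variable F : realFieldType.
Implicit Types (L M : layout F) (a b c d r : rect F) (x y m h D : F).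

Section Shift.

Variables (x0 m D yB : F).
Hypotheses (yBm : yB < m) (mD : m < yB + D).

Let phi y := if y < m then y - D else y.

Definition shift a : rect F :=
  if x2 a <= x0 then Rect (x1 a) (phi (y1 a)) (x2 a) (phi (y2 a)) else a.

(** The graph of the strictly increasing map of heights behind [shift]. In the application [D] is
    the height of the box, so that exactly the heights below [m] land below the old bottom [yB]. *)
Definition dropped y y' : bool :=
  (y < m) && (y' == y - D) || (m <= y) && (y' == y).

Definition shift_spec a a' : bool :=
  [&& x1 a' == x1 a, x2 a' == x2 a &
  [&& x2 a <= x0, dropped (y1 a) (y1 a') & dropped (y2 a) (y2 a')] ||
  [&& x0 < x2 a, (x0 <= x1 a) || (m < y1 a), y1 a' == y1 a & y2 a' == y2 a]].

(* The effect on a tile of the shift followed by the removal of the new corner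
   tile, when the tiles above it are extended down to the new bottom yB - D. *)
Definition drop_spec a a' : bool :=
  [&& x1 a' == x1 a, x2 a' == x2 a &
  [&& x2 a <= x0, dropped (y1 a) (y1 a') & dropped (y2 a) (y2 a')] ||
  [&& x0 < x2 a, y2 a' == y2 a,
      (y1 a == yB) && (y1 a' == yB - D) || (yB < y1 a) && (y1 a' == y1 a) &
      [|| x0 < x1 a, [&& x0 == x1 a, y1 a == yB & m < y2 a] | m < y1 a]]].

Let D_gt0 : 0 < D.
Proof. by move: (yBm) (mD) => *; lra. Qed.

Lemma dropped_lt y y' z z' : dropped y y' -> dropped z z' -> (y < z) = (y' < z').
Proof.
move: D_gt0 => D0; rewrite /dropped.
by move=> /orP[] /andP[h1 /eqP->] /orP[] /andP[h2 /eqP->]; apply/idP/idP; lra.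
Qed.

Lemma dropped_same y : m <= y -> dropped y y.
Proof. by move=> h; rewrite /dropped h eqxx orbT. Qed.

Lemma dropped_eq y y' z z' : dropped y y' -> dropped z z' -> (y == z) = (y' == z').
Proof.
by move=> hy hz; rewrite !eq_le ![_ <= _]leNgt (dropped_lt hy hz) (dropped_lt hz hy).
Qed.

Lemma dropped_ge y y' : dropped y y' -> (y - D <= y') && (y' <= y).
Proof. by move: D_gt0 => D0; rewrite /dropped => /orP[] /andP[h /eqP->]; lra. Qed.

Lemma shiftP a : y1 a < y2 a -> (x2 a <= x0) || (x0 <= x1 a) || (m < y1 a) ->
  shift_spec a (shift a).
Proof.
move=> na H; rewrite /shift_spec /shift /dropped; case: (leP (x2 a) x0) H => xa /= H.
  rewrite !eqxx /phi !leNgt; case: (y1 a < m); case: (y2 a < m);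
  by rewrite !eqxx.
by rewrite !eqxx /= H.
Qed.

Lemma shift_overlap a b a' b' : nondegenerate a -> nondegenerate b ->
  shift_spec a a' -> shift_spec b b' -> overlap a' b' -> overlap a b.
Proof.
rewrite /nondegenerate /overlap => /andP[nax na] /andP[nbx nb].
case/and3P=> /eqP-> /eqP-> Ha; case/and3P=> /eqP-> /eqP-> Hb.
case/and4P=> h1 h2; rewrite h1 h2 /=.
move: Ha Hb => /orP[/and3P[La Pa1 Pa2]|/and4P[Na Ha /eqP-> /eqP->]];
  move=> /orP[/and3P[Lb Pb1 Pb2]|/and4P[Nb Hb /eqP-> /eqP->]].
- by rewrite -(dropped_lt Pa1 Pb2) -(dropped_lt Pb1 Pa2) => -> ->.
- have hb : m < y1 b by lra.
  have hb2 : m < y2 b by lra.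
  rewrite -(dropped_lt Pa1 (dropped_same (ltW hb2))).
  by rewrite -(dropped_lt (dropped_same (ltW hb)) Pa2) => -> ->.
- have ha : m < y1 a by lra.
  have ha2 : m < y2 a by lra.
  rewrite -(dropped_lt (dropped_same (ltW ha)) Pb2).
  by rewrite -(dropped_lt Pb1 (dropped_same (ltW ha2))) => -> ->.
- by move=> -> ->.
Qed.

Lemma shift_drop a a' (X : F) : nondegenerate a -> yB <= y1 a -> x2 a <= X ->
  [|| x2 a <= x0, x0 < x1 a | (m < y1 a)] -> shift_spec a a' ->
  drop_spec a (if [&& yB == y1 a', x0 < x2 a' & x1 a' < X]
               then Rect (x1 a') (yB - D) (x2 a') (y2 a') else a').
Proof.
rewrite /nondegenerate => /andP[nax na] ya xX Ta /and3P[/eqP ex1 /eqP ex2].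
rewrite ex1 ex2 /drop_spec; have -> : x1 a < X by apply: lt_le_trans nax xX.
rewrite andbT; have [xa|xa] := leP (x2 a) x0.
  by rewrite andbF ex1 ex2 !eqxx.
rewrite /= andbT => /and3P[Ha /eqP e1 /eqP e2].
have T : [|| x0 < x1 a, [&& x0 == x1 a, y1 a == yB & m < y2 a] | m < y1 a].
  by move: Ta; rewrite leNgt xa /= => /orP[] ->; rewrite ?orbT.
rewrite e1; move: T; have [e|ne] := eqVneq yB (y1 a) => T.
  by rewrite /= e2 !eqxx T.
have lt : yB < y1 a by rewrite lt_neqAle ne ya.
by rewrite ex1 ex2 e1 e2 lt !eqxx T.
Qed.

(** Contacts across the vertical line at [x0] survive because the tile on the right either starts
    above [m], where no height moves, or stands on the bottom and is extended down. *)
Lemma drop_left_of a b a' b' : nondegenerate a -> nondegenerate b ->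
  yB <= y1 a -> yB <= y1 b -> drop_spec a a' -> drop_spec b b' ->
  [&& x2 a == x1 b, y1 a < y2 b & y1 b < y2 a] =
  [&& x2 a' == x1 b', y1 a' < y2 b' & y1 b' < y2 a'].
Proof.
rewrite /nondegenerate => /andP[nax na] /andP[nbx nb] yBa yBb.
case/and3P=> /eqP xa1 /eqP -> Ha; case/and3P=> /eqP -> /eqP xb2 Hb.
case: eqP => //= xab.
move: Ha Hb => /orP[/and3P[La Pa1 Pa2]|/and4P[Na /eqP ea2 Ha Ta]];
  move=> /orP[/and3P[Lb Pb1 Pb2]|/and4P[Nb /eqP eb2 Hb Tb]].
- by rewrite (dropped_lt Pa1 Pb2) (dropped_lt Pb1 Pa2).
- have hb2 : m < y2 b by lra.
  rewrite eb2 (dropped_lt Pa1 (dropped_same (ltW hb2))); congr (_ && _).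
  have [hb|hb] := ltP m (y1 b).
    have -> : y1 b' = y1 b by move: (yBm) => ?; lra.
    by rewrite (dropped_lt (dropped_same (ltW hb)) Pa2).
  have := dropped_ge Pa2; move: D_gt0 => ? ?.
  have -> : y1 b < y2 a by lra.
  have hyb : y1 b' = yB - D by lra.
  by apply/esym/idP; rewrite hyb; lra.
- by lra.
have hb : (y1 a < y2 b) = (y1 a' < y2 b').
  by rewrite eb2; move: D_gt0 => ?; apply/idP/idP; lra.
have ha : (y1 b < y2 a) = (y1 b' < y2 a').
  by rewrite ea2; move: D_gt0 => ?; apply/idP/idP; lra.
by rewrite hb ha.
Qed.

Lemma drop_below a b a' b' : nondegenerate a -> nondegenerate b ->
  yB <= y1 a -> yB <= y1 b -> drop_spec a a' -> drop_spec b b' ->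
  [&& y2 a == y1 b, x1 a < x2 b & x1 b < x2 a] =
  [&& y2 a' == y1 b', x1 a' < x2 b' & x1 b' < x2 a'].
Proof.
rewrite /nondegenerate => /andP[nax na] /andP[nbx nb] yBa yBb.
case/and3P=> /eqP -> /eqP -> Ha; case/and3P=> /eqP -> /eqP -> Hb.
have [/andP[xab xba]|_] := boolP ((x1 a < x2 b) && (x1 b < x2 a));
  rewrite ?andbF ?andbT //.
move: Ha Hb => /orP[/and3P[La Pa1 Pa2]|/and4P[Na /eqP ea2 Ha Ta]];
  move=> /orP[/and3P[Lb Pb1 Pb2]|/and4P[Nb /eqP eb2 Hb Tb]].
- exact: dropped_eq.
- have hb : m < y1 b by lra.
  have -> : y1 b' = y1 b by move: (yBm) => ?; lra.
  exact: dropped_eq Pa2 (dropped_same (ltW hb)).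
- have ha : m < y2 a by lra.
  by rewrite ea2; exact: dropped_eq (dropped_same (ltW ha)) Pb1.
by rewrite ea2; move: D_gt0 => ?; apply/idP/idP; lra.
Qed.

(** The preimage of the common corner is at height [y + D] if [y < m] and [x <= x0], and at height
    [y] otherwise. *)
Lemma shift_cross x y a b c d a' b' c' d' :
  all (@nondegenerate F) [:: a; b; c; d] -> all (fun a => yB <= y1 a) [:: a; b; c; d] ->
  shift_spec a a' -> shift_spec b b' -> shift_spec c c' -> shift_spec d d' ->
  cross x y a' b' c' d' -> exists y', cross x y' a b c d.
Proof.
rewrite /= !andbT => /and4P[na nb nc nd] /and4P[ya yb yc yd].
move=> /and3P[/eqP ax1 /eqP ax2 Ha] /and3P[/eqP bx1 /eqP bx2 Hb].
move=> /and3P[/eqP cx1 /eqP cx2 Hc] /and3P[/eqP dx1 /eqP dx2 Hd].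
rewrite /cross ax2 bx1 cx2 dx1.
case/and4P=> ax /eqP ay bx /and5P[/eqP bY cx /eqP cy dx /eqP dy].
have same z : m <= y -> dropped z y -> z = y.
  by move=> hy; rewrite /dropped; move: D_gt0 => ? /orP[] /andP[? /eqP ?]; lra.
have diff z : y < m -> dropped z y -> (z == y + D) && (y + D < m).
  by move=> hy; rewrite /dropped => /orP[] /andP[? /eqP ?]; lra.
suff [y' yP] : exists y', [/\ y2 a = y', y2 b = y', y1 c = y' & y1 d = y'].
  by exists y'; case: yP => -> -> -> ->; rewrite ax bx cx dx !eqxx.
move: na nb nc nd; rewrite /nondegenerate.
move=> /andP[nax na] /andP[nbx nb] /andP[ncx nc] /andP[ndx nd].
move: (yBm) (mD) => ? ?.
move: Ha Hb Hc Hd; rewrite ay bY cy dy.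
have [ym|ym] := leP m y.
  move=> Ha Hb Hc Hd; exists y; split.
  - by case/orP: Ha => [/and3P[_ _]|/and4P[_ _ _ /eqP]]; [exact: same | move=> ->].
  - by case/orP: Hb => [/and3P[_ _]|/and4P[_ _ _ /eqP]]; [exact: same | move=> ->].
  - by case/orP: Hc => [/and3P[_ + _]|/and4P[_ _ /eqP]]; [exact: same | move=> ->].
  - by case/orP: Hd => [/and3P[_ + _]|/and4P[_ _ /eqP]]; [exact: same | move=> ->].
have [xx|xx] := leP x x0; last first.
  move=> Ha Hb Hc Hd; exists y; split.
  - by case/orP: Ha => [/and3P[?]|/and4P[_ _ _ /eqP ->//]]; lra.
  - by case/orP: Hb => [/and3P[?]|/and4P[_ _ _ /eqP ->//]]; lra.
  - by case/orP: Hc => [/and3P[?]|/and4P[_ _ /eqP ->//]]; lra.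
  - by case/orP: Hd => [/and3P[?]|/and4P[_ _ /eqP ->//]]; lra.
case/orP=> [/and3P[_ _ /(diff _ ym)/andP[/eqP ea yDm]]|/and4P[?]]; last by lra.
move=> Hb Hc Hd; exists (y + D); split=> //.
- case/orP: Hb => [/and3P[_ _ /(diff _ ym)/andP[/eqP -> _] //]|/and4P[_ ? _ /eqP ?]].
  by lra.
- case/orP: Hc => [/and3P[_ /(diff _ ym)/andP[/eqP -> _] //]|/and4P[? _ _ _]].
  by lra.
- case/orP: Hd => [/and3P[_ /(diff _ ym)/andP[/eqP -> _] //]|/and4P[_ ? /eqP ? _]].
  by lra.
Qed.

End Shift.
End RoomForInsertion.

Section RoomExists.

Variable F : realFieldType.
Implicit Types (L M : layout F) (a b c d r : rect F) (x y m h D : F).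

(* Everything to the left of the vertical line through the left side of b and
   below height m moves down by the height of the box, which makes room for a
   rectangle below all tiles that touch the bottom to the right of this line. *)
Lemma vins_exists L b m : is_rectangulation L -> b \in tiles L ->
  y1 b = y1 (box L) -> y1 b < m < y2 b ->
  exists f L' M h, [/\ iso f L L', vins L' M (x1 b) h,
    {in tiles L, forall a, over L' (x1 b) (f a) = over L (x1 b) a} &
    {in tiles L, forall a, left_of (cut L' (x1 b) h (f a)) (corner L' (x1 b) h) =
                           (x2 a == x1 b) && (y1 a < m)}].
Proof.
move=> HL bL yb ybm; have /andP[wB hB] := box_nd HL.
have nb := tile_nd HL bL; have Bb := tile_in_box HL bL.
move: nb Bb; rewrite /nondegenerate /contained => nb Bb.
pose x0 := x1 b; pose yB := y1 (box L); pose D := y2 (box L) - yB.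
have yb' : y1 b = yB by [].
have yBm : yB < m by rewrite /yB; lra.
have mD : m < yB + D by rewrite /D /yB; lra.
pose s := shift x0 m D.
have tri a : a \in tiles L -> [|| x2 a <= x0, x0 < x1 a, (x1 a == x0) && (a == b),
    (x1 a == x0) && (m < y1 a) | (x1 a < x0) && (m < y1 a)].
  move=> aL; have [->|ab] := eqVneq a b; first by rewrite /x0 !eqxx !orbT.
  have : ~~ overlap a b by apply: contra ab => /(overlap_eq HL aL bL) ->.
  have := tile_nd HL aL; have := tile_in_box HL aL.
  rewrite /nondegenerate /contained /overlap andbF /x0; lra.
have sP a : a \in tiles L -> shift_spec x0 m D a (s a).
  move=> aL; apply: shiftP; have := tile_nd HL aL; rewrite /nondegenerate.
    by lra.
  by have := tri _ aL; case: (a == b); lra.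
pose r := Rect x0 (yB - D) (x2 (box L)) yB.
(* [M] already contains the new tile [r], whose top is the old bottom; the layout with room for it
   is then recovered as [undercut M]. *)
pose M : layout F := (Rect (x1 (box L)) (yB - D) (x2 (box L)) (y2 (box L)),
                      r :: map s (tiles L)).
have sB a : a \in tiles L -> [/\ nondegenerate (s a), contained (s a) (box M)
    & ~~ overlap (s a) r].
  move=> aL; have := tile_nd HL aL; have := tile_in_box HL aL; have := sP _ aL.
  rewrite /shift_spec /nondegenerate /contained /overlap /= -/yB.
  move=> /and3P[/eqP-> /eqP->].
  move=> /orP[/and3P[La P1 P2]|/and4P[Na Ha /eqP-> /eqP->]] Ba na; last by split; lra.
  have := dropped_ge yBm mD P1; have := dropped_ge yBm mD P2.
  by rewrite -(dropped_lt yBm mD P1 P2) => ? ?; split; lra.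
have rB : nondegenerate r && contained r (box M).
  by rewrite /nondegenerate /contained /r /= /x0 /yB; lra.
have sov a c : a \in tiles L -> c \in tiles L -> overlap (s a) (s c) -> a = c.
  move=> aL cL ov; apply: (overlap_eq HL aL cL).
  by apply: (shift_overlap yBm mD _ _ (sP _ aL) (sP _ cL)) => //; rewrite (tile_nd HL).
have ovC a c : overlap a c = overlap c a by apply/idP/idP; rewrite /overlap; lra.
have ovE a : nondegenerate a -> overlap a a.
  by rewrite /nondegenerate /overlap; lra.
have sr a : a \in tiles L -> s a != r.
  move=> aL; have [nsa _] := sB _ aL; apply: contraNneq => e.
  by rewrite -e ovE.
have HM : is_rectangulation M.
  apply: is_rectangulation_intro.
  - by rewrite /nondegenerate /= /yB; lra.
  - move=> a; rewrite inE => /predU1P[->|/mapP[c cL ->]]; first exact/andP.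
    by have [] := sB _ cL.
  - rewrite /= map_inj_in_uniq ?(tiles_uniq HL) ?andbT.
      by apply/mapP => -[a aL e]; have := sr _ aL; rewrite e eqxx.
    by move=> a c aL cL e; apply: sov => //; rewrite e ovE //; have [] := sB _ cL.
  - move=> a c; rewrite !inE => /predU1P[->|/mapP[a' aL ->]] /predU1P[->|/mapP[c' cL ->]] //.
    + by rewrite ovC; have [_ _ /negPf->] := sB _ cL.
    + by have [_ _ /negPf->] := sB _ aL.
    + by move/sov->.
  - move=> x y; rewrite /quad /= -/yB => Q.
    have [xx|xx] := ltP x x0; last first.
      have [yy|yy] := ltP y yB.
        exists r; first exact: mem_head.
        by rewrite /r /=; lra.
      have [|a aL] := @quad_cover _ _ HL true true x y; first by rewrite /quad /= -/yB; lra.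
      rewrite /quad /= => Qa; exists (s a); first by rewrite inE map_f ?orbT.
      have := sP _ aL; rewrite /shift_spec.
      move=> /and3P[/eqP-> /eqP->].
      by move=> /orP[/and3P[La _ _]|/and4P[_ _ /eqP-> /eqP->]]; lra.
    (* The height is pulled back along the shift. Heights from [m - D] up to [m] are not in its
       image; they are covered by the tiles stretched across [m], which the half-open kind [false]
       selects. *)
    have [y' [t [Q' Qy]]] : exists y' t, [/\ quad true t x y' (box L) &
        (t && (m <= y) && (y' == y)) || (t && (y < m - D) && (y' == y + D)) ||
        (~~ t && (m - D <= y) && (y < m) && (y' == m))].
      have [y1|y1] := leP m y.
        by exists y, true; rewrite /quad /= -/yB; split; lra.
      have [y2|y2] := ltP y (m - D).
        by exists (y + D), true; rewrite /quad /= -/yB; split; lra.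
      by exists m, false; rewrite /quad /= -/yB /D; split; lra.
    have [a aL] := quad_cover HL Q'.
    rewrite /quad /= => Qa; exists (s a); first by rewrite inE map_f ?orbT.
    have := sP _ aL; rewrite /shift_spec.
    move=> /and3P[/eqP-> /eqP->].
    move=> /orP[/and3P[La P1 P2]|/and4P[Na Ha /eqP-> /eqP->]]; last first.
      by case: t Qy Qa {Q'} => /= Qy Qa; lra.
    move: P1 P2 => /orP[] /andP[hy1 /eqP->] /orP[] /andP[hy2 /eqP->];
      by case: t Qy Qa {Q'} => /= Qy Qa; lra.
  - have ndM a : a \in tiles M -> nondegenerate a && contained a (box M).
      rewrite inE => /predU1P[->//|/mapP[c cL ->]].
      by have [-> ->] := sB _ cL.
    move=> x y a c d e aM cM dM eM; apply/negP => cr.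
    have na := ndM _ aM; have nc := ndM _ cM; have nd := ndM _ dM; have ne := ndM _ eM.
    move: (cr); rewrite /cross => cr'.
    move: na nc nd ne; rewrite /nondegenerate /contained /= => na nc nd ne.
    have ar : a != r by apply: contraTneq isT => e'; move: cr'; rewrite e' /r /= {e'}; lra.
    have dr : d != r by apply: contraTneq isT => e'; move: cr'; rewrite e' /r /= {e'}; lra.
    have er : e != r by apply: contraTneq isT => e'; move: cr'; rewrite e' /r /= {e'}; lra.
    move: aM; rewrite inE (negPf ar) => /mapP[a' aL ea].
    (* The top of [r] is at height [yB], where no tile on the left can end: heights below [m] have
       dropped below [yB], and the others are above it. *)
    have cr2 : c != r.
      apply: contraTneq isT => e'; move: cr'; rewrite ea e' /r /= {e' na nc nd ne}.
      have := sP _ aL; have := tile_nd HL aL; have := tile_in_box HL aL.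
      rewrite /shift_spec /nondegenerate /contained -/yB.
      move=> Ba na /and3P[/eqP ex1 /eqP ex2].
      by move=> /orP[/and3P[_ _ /orP[]/andP[hy /eqP ey]]|/and4P[Na Ha _ _]] cr'; lra.
    move: cM; rewrite inE (negPf cr2) => /mapP[c' cL ec].
    move: dM; rewrite inE (negPf dr) => /mapP[d' dL ed].
    move: eM; rewrite inE (negPf er) => /mapP[e' eL ee].
    have [] := shift_cross (a := a') (b := c') (c := d') (d := e') yBm mD _ _
      (sP _ aL) (sP _ cL) (sP _ dL) (sP _ eL) (x := x) (y := y).
    + by rewrite /= !(tile_nd HL).
    + have low u : u \in tiles L -> yB <= y1 u by move=> /(tile_in_box HL) /and4P[].
      by rewrite /= !low.
    + by rewrite -ea -ec -ed -ee.
    move=> y'; exact/negP/(no_cross HL).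
have rM : r \in tiles M by exact: mem_head.
have brM : bottom_right M = r by exact: (bottom_rightE HM).
have sb : s b = b by rewrite /s /shift ifN // -ltNge /x0; lra.
have bM : b \in tiles M by rewrite -sb inE map_f ?orbT.
have V : vins (undercut M) M x0 yB.
  by have := vins_undercut HM bM; rewrite brM; apply.
pose f a := extend r (s a).
have tU : tiles (undercut M) = map f (tiles L).
  rewrite /undercut brM {1}/tiles /= eqxx /=; rewrite (_ : filter _ _ = map s (tiles L)).
    by rewrite -map_comp.
  by apply/all_filterP/allP => _ /mapP[a aL ->]; exact: sr.
have fP a : a \in tiles L -> drop_spec x0 m D yB a (f a).
  move=> aL; have := tile_nd HL aL; have := tile_in_box HL aL; have := sP _ aL.
  rewrite /f /extend (tile_belowE HM rM) ?inE ?map_f ?orbT //.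
  rewrite /r /= -/yB => Sa Ba na; have [/and4P[_ ya xa _]] := Ba.
  have [e|ab] := eqVneq a b; last first.
    apply: shift_drop => //.
    by have := tri _ aL; rewrite (negPf ab); clear - F; lra.
  rewrite e sb yb' !eqxx /= /drop_spec /=.
  have -> : (x0 < x2 b) && (x1 b < x2 (box L)) by rewrite /x0; lra.
  have -> : x0 < x2 b by rewrite /x0; lra.
  have -> : m < y2 b by lra.
  by rewrite /= yb' !eqxx /= !orbT.
have If : iso f L (undercut M).
  split; first by rewrite tU.
  have HU : is_rectangulation (undercut M) by case: V.
  have fU a : a \in tiles L -> f a \in tiles (undercut M) by move=> ?; rewrite tU map_f.
  have low a : a \in tiles L -> yB <= y1 a by move=> /(tile_in_box HL) /and4P[].
  move=> a c aL cL.
  rewrite (tile_left_ofE HL aL cL) (tile_left_ofE HU (fU _ aL) (fU _ cL)).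
  rewrite (tile_belowE HL aL cL) (tile_belowE HU (fU _ aL) (fU _ cL)).
  by split; [apply: (drop_left_of yBm mD (tile_nd HL aL) (tile_nd HL cL)
    (low _ aL) (low _ cL) (fP _ aL) (fP _ cL)) | apply: (drop_below yBm mD
    (tile_nd HL aL) (tile_nd HL cL) (low _ aL) (low _ cL) (fP _ aL) (fP _ cL))].
exists f, (undercut M), M, yB; split=> //.
  move=> a aL; have := tile_nd HL aL; have := tile_in_box HL aL; have := fP _ aL.
  rewrite /over /= /drop_spec /contained /nondegenerate -/yB -/x0.
  move=> /and3P[/eqP-> _].
  by move=> /orP[/and3P[La _ _]|/and4P[Na _ Hy Ta]] Ba na; apply/idP/idP; lra.
move=> a aL; rewrite (left_of_cut_corner V) ?tU ?map_f //.
have := tile_nd HL aL; have := tile_in_box HL aL; have := fP _ aL.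
rewrite /drop_spec /contained /nondegenerate -/yB -/x0.
move=> /and3P[_ /eqP-> Sa] Ba na; case: eqP => //= xa.
case/orP: Sa => [/and3P[_ P1 _]|/and4P[Na _ _ _]]; last by lra.
by move: P1 => /orP[] /andP[hy /eqP->]; apply/idP/idP; lra.
Qed.

End RoomExists.

(** * The order of the insertion points *)

Section InsertionOrder.

Variable F : realFieldType.
Implicit Types (L M : layout F) (a b c d r : rect F) (x y m h : F)
  (q : bool * (F * F)).

Definition nabove L q : nat := count (becomes_above L q) (tiles L).
Definition nleft L q : nat := count (becomes_left L q) (tiles L).

(* Along the insertion points this number is strictly increasing: for vertical
   ones [nabove] decreases and then [nleft] increases, for horizontal ones
   [nleft] increases and then [nabove] decreases. *)
Definition key L q : nat :=
  let N := size (tiles L) in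
  if q.1 then ((N - nabove L q) * N.+1 + nleft L q)%N
  else (N.+1 * N.+1 + nleft L q * N.+1 + (N - nabove L q))%N.

Lemma nabove_le L q : (nabove L q <= size (tiles L))%N.
Proof. exact: count_size. Qed.

Lemma nleft_le L q : (nleft L q <= size (tiles L))%N.
Proof. exact: count_size. Qed.

Lemma nabove_tr L q : nabove (trL L) (trq q) = nleft L q.
Proof. by rewrite /nabove count_map; apply: eq_count => a /=; rewrite becomes_above_tr. Qed.

Lemma nleft_tr L q : nleft (trL L) (trq q) = nabove L q.
Proof. by rewrite /nleft count_map; apply: eq_count => a /=; rewrite becomes_left_tr. Qed.

Lemma count_lt (T : eqType) (P Q : pred T) (s : seq T) z :
  {in s, forall w, P w -> Q w} -> z \in s -> Q z -> ~~ P z ->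
  (count P s < count Q s)%N.
Proof.
move=> PQ zs Qz Pz; have := count_predUI P (predD Q P) s.
rewrite (eq_in_count (a2 := Q)); last first.
  by move=> w /PQ /=; case: (P w) => //= ->.
rewrite (eq_count (a1 := predI P (predD Q P)) (a2 := pred0)) => [|w /=]; last by case: (P w).
rewrite count_pred0 addn0 => ->; rewrite -[X in (X < _)%N]addn0 ltn_add2l -has_count.
by apply/hasP; exists z; rewrite //= Pz.
Qed.

Section VerticalPoints.

Variable L : layout F.
Hypothesis HL : is_rectangulation L.

(** A vertex strictly inside the left side of [b] comes from a tile on the left. If it is the top of
    that tile, the next tile upwards starts there. *)
Lemma vertex_interior b y : b \in tiles L -> y1 b < y < y2 b ->
  vertexb L (x1 b) y -> exists2 a, a \in tiles L & x2 a = x1 b /\ y1 a = y.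
Proof.
move=> bL yb /hasP[c cL Hc].
have := tile_nd HL bL; have := tile_nd HL cL; have := tile_in_box HL bL.
rewrite /nondegenerate /contained => Bb nc nb; have Bc := tile_in_box HL cL.
have cb : ~~ overlap c b.
  by apply/negP => /(overlap_eq HL cL bL) e; move: Hc yb; rewrite e {e}; lra.
move: cb Bc; rewrite /overlap /contained => cb Bc.
have xc : x2 c = x1 b by lra.
have [e|yc] := eqVneq (y1 c) y; first by exists c.
have [|a aL] := @quad_cover _ _ HL false true (x1 b) y.
  by rewrite /quad /=; lra.
rewrite /quad /= => Qa; exists a => //; have := tile_nd HL aL; rewrite /nondegenerate => na.
have ab : ~~ overlap a b.
  by apply/negP => /(overlap_eq HL aL bL) e; move: Qa; rewrite e {e}; lra.
have ac : ~~ overlap a c.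
  by apply/negP => /(overlap_eq HL aL cL) e; move: Qa; rewrite e {e}; lra.
by move: ab ac; rewrite /overlap; split; lra.
Qed.

(** Moving right drops from the tiles above the one that carries the first point. Moving up along
    the same tile passes a vertex, and the tile starting there becomes a new left neighbour. *)
Lemma vpoint_lt x m x' m' : vpoint L x m -> vpoint L x' m' ->
  lexi_xy (x, m) (x', m') -> (x, m) != (x', m') ->
  let q := (true, (x, m)) in let q' := (true, (x', m')) in
  (nabove L q' < nabove L q)%N \/ nabove L q' = nabove L q /\ (nleft L q < nleft L q')%N.
Proof.
move=> [b [bL yb xb [e1 [e2 [C1 l1 l2 ->]]]]] [b' [bL' yb' xb' [e1' [e2' [C2 l1' l2' ->]]]]].
case: C1 => v1 v2 lt C1; case: C2 => v1' v2' lt' C2.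
rewrite /lexi_xy /= => /orP[xx _|/andP[/eqP exx le_m] ne].
  left; apply: (@count_lt _ _ _ _ b _ bL).
  - by move=> a aL; rewrite /becomes_above /= => /andP[-> h]; rewrite (le_trans (ltW xx)).
  - by rewrite /becomes_above /= yb xb eqxx lexx.
  - by rewrite /becomes_above /= negb_and -ltNge xb xx orbT.
right; have ebb : b = b'.
  apply: (overlap_eq HL) => //; have := tile_nd HL bL; have := tile_nd HL bL'.
  by rewrite /nondegenerate /overlap; lra.
move: ne le_m; rewrite -exx xpair_eqE eqxx /= => ne le_m.
have ltm : (e1 + e2) / 2 < (e1' + e2') / 2 by rewrite lt_neqAle ne.
split; first by apply: eq_count => a; rewrite /becomes_above /= exx.
rewrite -ebb in v1' v2' C2 l2'.
have e21 : e2 <= e1'.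
  by have := C1 _ v1'; have := C2 _ v2; have := C2 _ v1; have := C1 _ v2'; lra.
have [|||a aL [xa ya]] := @vertex_interior b e2; [by []|by lra|by []|].
apply: (@count_lt _ _ _ _ a _ aL).
- by move=> c cL; rewrite /becomes_left /= exx => /andP[-> h] /=; lra.
- by rewrite /becomes_left /= xa xb exx eqxx; lra.
- by rewrite /becomes_left /=; apply/nandP; right; rewrite -leNgt ya; lra.
Qed.

End VerticalPoints.
End InsertionOrder.

(** * Insertion points of isomorphic layouts *)

Section InsertionIndex.

Variable F : realFieldType.
Implicit Types (L M : layout F) (a b c d r : rect F) (x y m h : F)
  (q : bool * (F * F)) (f : rect F -> rect F).

(** An order given by coordinates is transported by [f] as soon as each step to an immediate
    predecessor is; induction on the number of tiles with smaller coordinate. *)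
Lemma chain_mono f (s : seq (rect F)) (P : pred (rect F)) (k : rect F -> F) :
  {in s &, forall a b, P a -> P b -> k a < k b ->
     exists c, [/\ c \in s, P c, c = a \/ k a < k c, k c < k b & k (f c) < k (f b)]} ->
  {in s &, forall a b, P a -> P b -> k a < k b -> k (f a) < k (f b)}.
Proof.
move=> pred_ex a b aL; elim: {b}_.+1 {-2}b (ltnSn (count (fun c => k c < k b) s)) => // n IHn b.
rewrite ltnS => le_n bs Pa Pb lt_ab.
have [c [cs Pc ac cb fcb]] := pred_ex _ _ aL bs Pa Pb lt_ab.
case: ac => [<- //|ac]; apply: lt_trans fcb; apply: IHn => //.
apply: leq_trans le_n; apply: (@count_lt _ _ _ _ c) => //=; last by rewrite ltxx.
by move=> w _ /lt_trans; apply.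
Qed.

Section Order.

Variables (f : rect F -> rect F) (L M : layout F).
Hypotheses (HL : is_rectangulation L) (HM : is_rectangulation M) (If : iso f L M).

(** Consecutive tiles along the bottom are related by [left_of]. *)
Lemma bottom_order : {in tiles L &, forall a b, y1 a = y1 (box L) -> y1 b = y1 (box L) ->
  (x1 (f a) < x1 (f b)) = (x1 a < x1 b)}.
Proof.
have mono : {in tiles L &, forall a b, y1 a == y1 (box L) -> y1 b == y1 (box L) ->
    x1 a < x1 b -> x1 (f a) < x1 (f b)}.
  apply: chain_mono => a b aL bL /eqP ya /eqP yb ab.
  have na := tile_nd HL aL; have nb := tile_nd HL bL.
  have Ba := tile_in_box HL aL; have Bb := tile_in_box HL bL.
  move: na nb Ba Bb; rewrite /nondegenerate /contained => na nb Ba Bb.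
  have [|c cL] := @quad_cover _ _ HL false true (x1 b) (y1 (box L)).
    by rewrite /quad /=; lra.
  rewrite /quad /= => Qc; have := tile_nd HL cL; have := tile_in_box HL cL.
  rewrite /nondegenerate /contained => Bc nc.
  have cb : ~~ overlap c b.
    by apply/negP => /(overlap_eq HL cL bL) e; move: Qc; rewrite e {e}; lra.
  move: cb; rewrite /overlap => cb; exists c; split=> //; try lra.
    have [->|ca] := eqVneq c a; [by left | right].
    have : ~~ overlap c a by apply: contra ca => /(overlap_eq HL cL aL) ->.
    by rewrite /overlap; lra.
  have [lo _] := If.2 _ _ cL bL; move: lo; rewrite (tile_left_ofE HL) //.
  rewrite (tile_left_ofE HM) ?(iso_mem If) // => lo.
  have := tile_nd HM (iso_mem If cL); rewrite /nondegenerate.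
  have : [&& x2 c == x1 b, y1 c < y2 b & y1 b < y2 c] by lra.
  by rewrite lo; lra.
move=> a b aL bL ya yb; apply/idP/idP; last by apply: mono; rewrite ?ya ?yb.
move=> lt; rewrite ltNge le_eqVlt; apply/negP => /orP[/eqP e|ba].
  have ab : a = b.
    apply: (overlap_eq HL) => //; have := tile_nd HL aL; have := tile_nd HL bL.
    by rewrite /nondegenerate /overlap; lra.
  by rewrite ab ltxx in lt.
by have := mono _ _ bL aL; rewrite ya yb !eqxx ba => /(_ isT isT isT); lra.
Qed.

(** The left neighbours of [b] form a stack whose consecutive members are related by [below]. *)
Lemma left_order b : b \in tiles L ->
  {in tiles L &, forall a c, left_of a b -> left_of c b ->
     (y1 (f a) < y1 (f c)) = (y1 a < y1 c)}.
Proof.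
move=> bL; have mono : {in tiles L &, forall a c, left_of a b -> left_of c b ->
    y1 a < y1 c -> y1 (f a) < y1 (f c)}.
  apply: (@chain_mono f (tiles L) (fun a => left_of a b) (@y1 F)) => a c aL cL.
  rewrite !(tile_left_ofE HL) // => la lc ac.
  have := tile_nd HL aL; have := tile_nd HL bL; have := tile_nd HL cL.
  have := tile_in_box HL aL; have := tile_in_box HL cL.
  rewrite /nondegenerate /contained => Bc Ba nc nb na.
  have oac : ~~ overlap a c.
    by apply/negP => /(overlap_eq HL aL cL) e; move: ac; rewrite e {e}; lra.
  move: oac; rewrite /overlap => oac.
  have [|d dL] := @quad_cover _ _ HL false false (x1 b) (y1 c).
    by rewrite /quad /=; lra.
  rewrite /quad /= => Qd; have := tile_nd HL dL; rewrite /nondegenerate => nd.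
  have odb : ~~ overlap d b.
    by apply/negP => /(overlap_eq HL dL bL) e; move: Qd; rewrite e {e}; lra.
  have odc : ~~ overlap d c.
    by apply/negP => /(overlap_eq HL dL cL) e; move: Qd; rewrite e {e}; lra.
  move: odb odc; rewrite /overlap => odb odc.
  exists d; rewrite (tile_left_ofE HL) //; split=> //; try lra.
    have [->|da] := eqVneq d a; [by left | right].
    have : ~~ overlap d a by apply: contra da => /(overlap_eq HL dL aL) ->.
    by rewrite /overlap; lra.
  have [_ be] := If.2 _ _ dL cL; move: be; rewrite (tile_belowE HL) //.
  rewrite (tile_belowE HM) ?(iso_mem If) // => be.
  have := tile_nd HM (iso_mem If dL); rewrite /nondegenerate.
  have : [&& y2 d == y1 c, x1 d < x2 c & x1 c < x2 d] by lra.
  by rewrite be; lra.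
move=> a c aL cL la lc; apply/idP/idP; last exact: mono.
move=> lt; rewrite ltNge le_eqVlt; apply/negP => /orP[/eqP e|ca].
  have ac : a = c.
    apply: (overlap_eq HL) => //; have := tile_nd HL aL; have := tile_nd HL cL.
    move: la lc; rewrite !(tile_left_ofE HL) //.
    by rewrite /nondegenerate /overlap; lra.
  by rewrite ac ltxx in lt.
by have := mono _ _ cL aL lc la ca; lra.
Qed.

End Order.

Definition corresponding f L M q q' : Prop :=
  q.1 = q'.1 /\ {in tiles L, forall a,
    becomes_above M q' (f a) = becomes_above L q a /\
    becomes_left M q' (f a) = becomes_left L q a}.

Lemma vpoint_corresponding f L M x m : is_rectangulation L ->
  is_rectangulation M -> iso f L M -> vpoint L x m ->
  exists x' m', vpoint M x' m' /\ corresponding f L M (true, (x, m)) (true, (x', m')).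
Proof.
move=> HL HM If [b [bL yb xb [e1 [e2 [[v1 v2 lt C] l1 l2 em]]]]].
have fbM := iso_mem If bL.
have yfb : y1 (f b) = y1 (box M) by apply/eqP; rewrite (iso_at_bottom HL HM If) ?yb.
have nb := tile_nd HL bL; have Bb := tile_in_box HL bL.
have nfb := tile_nd HM fbM; have Bfb := tile_in_box HM fbM.
move: nb Bb nfb Bfb; rewrite /nondegenerate /contained => nb Bb nfb Bfb.
have above a : a \in tiles L ->
    (y1 (f a) == y1 (box M)) && (x1 (f b) <= x1 (f a)) =
    (y1 a == y1 (box L)) && (x <= x1 a).
  move=> aL; rewrite (iso_at_bottom HL HM If) //; case: eqP => //= ya.
  by rewrite -xb !leNgt (bottom_order HL HM If).
have leftE a : a \in tiles L ->
    (x2 a == x) && (y1 a < m) = left_of a b && (y1 a < m).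
  move=> aL; have := tile_nd HL aL; have := tile_in_box HL aL.
  rewrite /nondegenerate /contained (tile_left_ofE HL) // => Ba na.
  by apply/idP/idP; lra.
have leftfE a m' : a \in tiles L -> m' < y2 (f b) ->
    (x2 (f a) == x1 (f b)) && (y1 (f a) < m') = left_of a b && (y1 (f a) < m').
  move=> aL mb; have faM := iso_mem If aL.
  have := tile_nd HM faM; have := tile_in_box HM faM.
  have [-> _] := If.2 _ _ aL bL.
  rewrite /nondegenerate /contained (tile_left_ofE HM) // => Ba na.
  by apply/idP/idP; lra.
(* The edge taken starts at the highest vertex not above [Y]; it is found by looking just above [Y],
   where the layout has no coordinates. *)
have edge Y : y1 (f b) <= Y -> Y < y2 (f b) -> exists m', [/\ left_edge M (f b) m',
    m' < y2 (f b) & forall z, z \in coords M -> vertexb M (x1 (f b)) z ->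
      z < y2 (f b) -> (z < m') = (z <= Y)].
  move=> Y1 Y2; have [y' y'P gap] := @gap_above _ (coords M) _ _ Y2.
  have vc z : vertexb M (x1 (f b)) z -> z \in coords M.
    move=> /hasP[c cM /andP[_]]; have := @mem_coords _ M c; rewrite inE cM orbT.
    by case=> // _ _ ? ? /orP[] /eqP->.
  have [||g1 [g2 [Cg k1 gy k2]]] := @left_edge_at _ M (f b) y' HM fbM.
  - by lra.
  - by apply/negP => /vc /gap; rewrite ltxx; case/andP: y'P => -> _ /(_ isT).
  have [w1 w2 ltg Dg] := Cg; exists ((g1 + g2) / 2); split; [|lra|].
    by exists g1, g2.
  move=> z zc vz zb; have := Dg _ vz; have := gap _ zc.
  case: (ltP Y z) => Yz; first by move=> /(_ isT) ? ?; apply/negbTE; lra.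
  by move=> _ ?; apply/idP; lra.
have pick Y : y1 (f b) <= Y -> Y < y2 (f b) ->
    {in tiles L, forall a, left_of a b -> (y1 (f a) <= Y) = (y1 a < m)} ->
    exists x' m', vpoint M x' m' /\
      corresponding f L M (true, (x, m)) (true, (x', m')).
  move=> Y1 Y2 HY; have [m' [em' m'b m'P]] := edge _ Y1 Y2.
  exists (x1 (f b)), m'; split; first by exists (f b).
  split=> // a aL; rewrite /becomes_above /becomes_left /=; split; first exact: above.
  rewrite leftE // leftfE //; case la: (left_of a b) => //=.
  rewrite -HY // m'P //.
  - have := @mem_coords _ M (f a); rewrite inE (iso_mem If aL) orbT.
    by case=> // _ _ ? _.
  - apply/hasP; exists (f a); first exact: iso_mem If aL.
    move: la; have [-> _] := If.2 _ _ aL bL; rewrite (tile_left_ofE HM) ?(iso_mem If) //.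
    by case/andP=> /eqP-> _; rewrite !eqxx orbT.
  - move: la; have [-> _] := If.2 _ _ aL bL; rewrite (tile_left_ofE HM) ?(iso_mem If) //.
    by case/and3P.
(* [Y] is the bottom of the image of the topmost left neighbour of [b] that starts below [m], or the
   bottom of [f b] if [b] has no left neighbours. *)
have [none|] := boolP (has (fun a => left_of a b) (tiles L)); last first.
  move=> /hasPn none; apply: (pick (y1 (f b))); [by []|lra|].
  by move=> a aL la; have := none _ aL; rewrite la.
have xb1 : x1 (box L) < x1 b.
  case/hasP: none => a aL; have := tile_nd HL aL; have := tile_in_box HL aL.
  by rewrite (tile_left_ofE HL) // /nondegenerate /contained; lra.
have [|c cL] := @quad_cover _ _ HL false true (x1 b) (y1 (box L)).
  by rewrite /quad /=; lra.
rewrite /quad /= => Qc; have := tile_nd HL cL; have := tile_in_box HL cL.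
rewrite /nondegenerate /contained => Bc nc.
have ocb : ~~ overlap c b.
  by apply/negP => /(overlap_eq HL cL bL) e; move: Qc; rewrite e {e}; lra.
move: ocb; rewrite /overlap => ocb.
have cS : y1 c \in [seq y1 a | a <- tiles L & left_of a b && (y1 a < m)].
  apply: map_f; rewrite mem_filter cL (tile_left_ofE HL) //; lra.
have [Y /mapP[a + eY] maxY] := seq_max cS.
rewrite mem_filter => /andP[/andP[la am] aL].
have faM := iso_mem If aL; have Bfa := tile_in_box HM faM.
apply: (pick (y1 (f a))).
- by move: Bfa; rewrite /contained; lra.
- move: la; have [-> _] := If.2 _ _ aL bL.
  by rewrite (tile_left_ofE HM) // => /and3P[].
move=> d dL ld; rewrite leNgt (left_order HL HM If bL) // -leNgt.
apply/idP/idP => [da|dm]; first exact: le_lt_trans da am.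
by rewrite -eY; apply: maxY; apply: map_f; rewrite mem_filter ld dm.
Qed.

Lemma corresponding_tr f L M q q' : corresponding f L M q q' ->
  corresponding (fun a => tr (f (tr a))) (trL L) (trL M) (trq q) (trq q').
Proof.
move=> [e H]; split; first by rewrite /= e.
move=> _ /mapP[a aL ->]; have [ha hl] := H _ aL.
by rewrite trK !becomes_above_tr !becomes_left_tr.
Qed.

Lemma corresponding_exists f L M q : is_rectangulation L ->
  is_rectangulation M -> iso f L M -> q \in insertion_points L ->
  exists2 q', q' \in insertion_points M & corresponding f L M q q'.
Proof.
move=> HL HM If; case: q => -[] [x y].
  move=> /mem_vpoint /(vpoint_corresponding HL HM If)[x' [m' [V' C]]].
  by exists (true, (x', m')) => //; apply/mem_vpoint.
move=> /mem_hpoint /(vpoint_corresponding (is_rectangulation_tr HL)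
  (is_rectangulation_tr HM) (iso_tr If))[x' [m' [V' C]]].
exists (trq (true, (x', m'))).
  by rewrite -insertion_points_tr trqK; apply/mem_vpoint.
have := corresponding_tr C; rewrite !trLK => -[e H]; split=> //.
move=> a aL; have := H _ aL; rewrite !trK.
by rewrite /trq /= !opprK.
Qed.

Lemma key_corresponding f L M q q' : iso f L M ->
  corresponding f L M q q' -> key M q' = key L q.
Proof.
move=> If [e H]; have eN : size (tiles M) = size (tiles L).
  by have [p _] := If; rewrite (perm_size p) size_map.
have eA : nabove M q' = nabove L q.
  by apply/esym/(iso_count If) => a /H[].
have eL : nleft M q' = nleft L q.
  by apply/esym/(iso_count If) => a /H[].
by rewrite /key eN eA eL e.
Qed.

Lemma key_bound L q : q.1 -> (key L q < (size (tiles L)).+1 * (size (tiles L)).+1)%N.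
Proof.
move=> q1; rewrite /key q1; have := nabove_le L q; have := nleft_le L q.
by move: (size _) (nabove _ _) (nleft _ _) => *; nia.
Qed.

Lemma key_ge L q : ~~ q.1 -> ((size (tiles L)).+1 * (size (tiles L)).+1 <= key L q)%N.
Proof. by move=> /negPf q1; rewrite /key q1 -addnA leq_addr. Qed.

Lemma lexi_xy_trans : transitive (@lexi_xy F).
Proof. by move=> u v w; rewrite /lexi_xy; lra. Qed.
Lemma lexi_yx_trans : transitive (@lexi_yx F).
Proof. by move=> u v w; rewrite /lexi_yx; lra. Qed.
Lemma lexi_xy_total : total (@lexi_xy F).
Proof. by move=> u v; rewrite /lexi_xy; lra. Qed.
Lemma lexi_yx_total : total (@lexi_yx F).
Proof. by move=> u v; rewrite /lexi_yx; lra. Qed.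

End InsertionIndex.

(** * Sorted keys and the extreme insertion points *)

Section InsertionSorted.

Variable F : realFieldType.
Implicit Types (L M : layout F) (a b c d r : rect F) (x y m h : F)
  (q : bool * (F * F)) (f : rect F -> rect F).

Lemma pairwise_uniq_sub (T : eqType) (r1 r2 : rel T) (s : seq T) :
  uniq s -> pairwise r1 s -> {in s &, forall u v, r1 u v -> u != v -> r2 u v} ->
  pairwise r2 s.
Proof.
elim: s => //= z s IHs /andP[zs us] /andP[/allP zr pr] H; apply/andP; split.
  apply/allP => w ws; apply: H; rewrite ?mem_head ?inE ?ws ?orbT ?zr //.
  by apply: contraNneq zs => ->.
by apply: IHs => // u v us' vs'; apply: H; rewrite inE ?us' ?vs' orbT.
Qed.

Lemma uniq_flatten_map (S T : eqType) (g : S -> seq T) (s : seq S) : uniq s ->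
  {in s, forall u, uniq (g u)} ->
  {in s &, forall u v w, w \in g u -> w \in g v -> u = v} ->
  uniq (flatten (map g s)).
Proof.
elim: s => //= z s IHs /andP[zs us] ug inj; rewrite cat_uniq ug ?mem_head //=.
rewrite IHs //; [|by move=> u us'; apply: ug; rewrite inE us' orbT|].
  rewrite andbT; apply/hasPn => w /flatten_mapP[u us' wu]; apply/negP => wz.
  by move: zs; rewrite (inj z u _ _ w) ?mem_head ?inE ?us' ?orbT.
by move=> u v us' vs'; apply: inj; rewrite inE ?us' ?vs' orbT.
Qed.

Lemma map_uniq_inj (S T : eqType) (g : S -> T) (s : seq S) :
  uniq (map g s) -> {in s &, injective g}.
Proof.
elim: s => //= z s IHs /andP[zs us] u v; rewrite !inE.
move=> /predU1P[->|us'] /predU1P[->|vs'] e //; last exact: IHs.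
  by move: zs; rewrite e map_f.
by move: zs; rewrite -e map_f.
Qed.

Lemma count_le (T : eqType) (P Q : pred T) (s : seq T) :
  {in s, forall w, P w -> Q w} -> (count P s <= count Q s)%N.
Proof.
elim: s => //= z s IHs PQ; apply: leq_add; last first.
  by apply: IHs => w ws; apply: PQ; rewrite inE ws orbT.
by have := PQ z (mem_head _ _); case: (P z) => // /(_ isT) ->.
Qed.

Lemma midpoints_uniq (s : seq F) : uniq (midpoints s).
Proof.
rewrite /midpoints; set t := sort _ _.
have st : sorted <%R t by rewrite sort_lt_sorted undup_uniq.
rewrite map_inj_in_uniq; first by apply: zip_uniql; rewrite sort_uniq undup_uniq.
move=> [e1 e2] [d1 d2]; rewrite !mem_zip_behead // => /and4P[h1 h2 h3 /allP h4].
move=> /and4P[g1 g2 g3 /allP g4] /= e.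
have := h4 _ g1; have := h4 _ g2; have := g4 _ h1; have := g4 _ h2 => /= *.
by congr pair; lra.
Qed.

Section SortedKeys.

Variable L : layout F.
Hypothesis HL : is_rectangulation L.

Lemma keys_sorted : sorted ltn (map (key L) (insertion_points L)).
Proof.
rewrite (sorted_pairwise ltn_trans) pairwise_map /insertion_points pairwise_cat.
apply/and3P; split.
- apply/allrelP => _ _ /mapP[u _ ->] /mapP[v _ ->] /=.
  by apply: leq_trans (key_bound L _) (key_ge L _).
- rewrite pairwise_map; set V := flatten _.
  apply: (@pairwise_uniq_sub _ (@lexi_xy F)).
  + rewrite sort_uniq; apply: uniq_flatten_map => [|b _|b c].
    * by rewrite filter_uniq // tiles_uniq.
    * by rewrite map_inj_uniq ?midpoints_uniq // => u v [].
    rewrite !mem_filter => /andP[/eqP yb bL] /andP[/eqP yc cL] w.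
    move=> /mapP[y _ ->] /mapP[z _ [exx _]]; apply: (overlap_eq HL) => //.
    have := tile_nd HL bL; have := tile_nd HL cL.
    by rewrite /nondegenerate /overlap; lra.
  + by rewrite -(sorted_pairwise (@lexi_xy_trans F)) sort_sorted //; exact: lexi_xy_total.
  have VP x m : (x, m) \in sort (@lexi_xy F) V -> vpoint L x m.
    move=> h; apply/mem_vpoint; rewrite mem_cat; apply/orP; left.
    by rewrite mem_map // => u v [].
  move=> [x m] [x' m'] /VP V1 /VP V2 le ne /=.
  rewrite /key /=; have := nleft_le L (true, (x, m)).
  have := nabove_le L (true, (x, m)); have := nabove_le L (true, (x', m')).
  case: (vpoint_lt HL V1 V2 le ne) => [|[]]; move: (size _) => N.
    by move: (nabove _ _) (nabove _ _) (nleft _ _) (nleft _ _) => *; nia.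
  by move=> ->; rewrite ltn_add2l.
- rewrite pairwise_map; set V := flatten _.
  apply: (@pairwise_uniq_sub _ (@lexi_yx F)).
  + rewrite sort_uniq; apply: uniq_flatten_map => [|b _|b c].
    * by rewrite filter_uniq // tiles_uniq.
    * by rewrite map_inj_uniq ?midpoints_uniq // => u v [].
    rewrite !mem_filter => /andP[/eqP yb bL] /andP[/eqP yc cL] w.
    move=> /mapP[y _ ->] /mapP[z _ [_ eyy]]; apply: (overlap_eq HL) => //.
    have := tile_nd HL bL; have := tile_nd HL cL.
    by rewrite /nondegenerate /overlap; lra.
  + by rewrite -(sorted_pairwise (@lexi_yx_trans F)) sort_sorted //; exact: lexi_yx_total.
  have VP x y : (x, y) \in sort (@lexi_yx F) V -> vpoint (trL L) (- y) (- x).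
    move=> h; apply/mem_hpoint; rewrite mem_cat; apply/orP; right.
    by rewrite mem_map // => u v [].
  move=> [x y] [x' y'] /VP V1 /VP V2 le ne /=.
  rewrite /key /=; have := nabove_le L (false, (x, y)).
  have := nabove_le L (false, (x', y')).
  have le' : lexi_xy (- y', - x') (- y, - x).
    by move: le; rewrite /lexi_xy /lexi_yx /=; lra.
  have ne' : (- y', - x') != (- y, - x).
    move: ne; apply: contra; rewrite !xpair_eqE !eqr_opp.
      by case/andP=> /eqP-> /eqP->; rewrite !eqxx.
  (* The reflection reverses the order, so the two points change places. *)
  have := vpoint_lt (is_rectangulation_tr HL) V2 V1 le' ne'.
  have E u v : nabove (trL L) (true, (- v, - u)) = nleft L (false, (u, v)) /\
      nleft (trL L) (true, (- v, - u)) = nabove L (false, (u, v)).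
    by split; [rewrite -nabove_tr | rewrite -nleft_tr].
  rewrite /= (E x y).1 (E x y).2 (E x' y').1 (E x' y').2.
  case=> [|[]]; move: (size _) => N.
    by move: (nabove _ _) (nabove _ _) (nleft _ _) (nleft _ _) => *; nia.
  move=> -> lt h1 h2; rewrite ltn_add2l.
  by move: (nabove _ _) (nabove _ _) lt h1 h2 => *; lia.
Qed.

Lemma insertion_points_uniq : uniq (insertion_points L).
Proof. exact: map_uniq (sorted_uniq ltn_trans ltnn keys_sorted). Qed.

Lemma key_inj : {in insertion_points L &, injective (key L)}.
Proof. exact: map_uniq_inj (sorted_uniq ltn_trans ltnn keys_sorted). Qed.

(** The point is taken on the left side of the box, where nothing lies to its left and every bottom
    tile becomes a tile above. A vertical point anywhere else has a bottom tile as left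
    neighbour. *)
Lemma vpoint_first : exists x m, [/\ vpoint L x m,
  nleft L (true, (x, m)) = 0%N & forall x' m', vpoint L x' m' ->
    (nabove L (true, (x', m')) <= nabove L (true, (x, m)))%N /\
    (nleft L (true, (x', m')) = 0%N ->
       nabove L (true, (x', m')) = nabove L (true, (x, m)))].
Proof.
have /andP[xB yB] := box_nd HL.
have [|b bL] := @quad_cover _ _ HL true true (x1 (box L)) (y1 (box L)).
  by rewrite /quad /=; lra.
rewrite /quad /= => Qb; have := tile_nd HL bL; have := tile_in_box HL bL.
rewrite /nondegenerate /contained => Bb nb.
have [y yP gap] := @gap_above _ (coords L) (y1 b) (y2 b) ltac:(lra).
have [|e1 [e2 [C l1 l12 l2]]] := left_edge_at HL bL yP.
  apply/negP => /hasP[c cL /andP[_ yc]].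
  have [|_ _ c1 c2] := @mem_coords _ L c; first by rewrite inE cL orbT.
  by case/orP: yc => /eqP yc; [have := gap _ c1 | have := gap _ c2]; rewrite -yc => /(_ _); lra.
exists (x1 b), ((e1 + e2) / 2); split.
- by exists b; split=> //; [lra | exists e1, e2].
- apply/eqP; rewrite -leqn0 leqNgt -has_count; apply/hasPn => a aL.
  have := tile_nd HL aL; have := tile_in_box HL aL.
  by rewrite /becomes_left /nondegenerate /contained /=; lra.
move=> x' m' [c [cL yc xc [d1 [d2 [Cd k1 k2 em]]]]].
have := tile_nd HL cL; have := tile_in_box HL cL.
rewrite /nondegenerate /contained => Bc nc.
split=> [|nl].
  apply: count_le => a aL; rewrite /becomes_above /= => /andP[-> _] /=.
  by have := tile_in_box HL aL; rewrite /contained; lra.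
suff -> : x' = x1 b by [].
have [xB'|xB'] := ltP (x1 (box L)) x'; last by lra.
have [|d dL] := @quad_cover _ _ HL false true x' (y1 (box L)).
  by rewrite /quad /=; lra.
rewrite /quad /= => Qd; have := tile_nd HL dL; have := tile_in_box HL dL.
rewrite /nondegenerate /contained => Bd nd.
have dc : ~~ overlap d c.
  by apply/negP => /(overlap_eq HL dL cL) e; move: Qd; rewrite e {e}; lra.
move: nl => /eqP; rewrite -leqn0 leqNgt -has_count => /hasPn /(_ d dL).
case: Cd => _ _ ltd _.
by move: dc; rewrite /overlap /becomes_left /=; lra.
Qed.

Lemma vpoint_nabove x m : vpoint L x m -> (0 < nabove L (true, (x, m)))%N.
Proof.
move=> [b [bL yb xb _]]; rewrite -has_count; apply/hasP; exists b => //.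
by rewrite /becomes_above /= yb xb eqxx lexx.
Qed.

End SortedKeys.

Section ExtremePoints.

Variable L : layout F.
Hypothesis HL : is_rectangulation L.
Local Notation ip := (insertion_points L).

Let HL' : is_rectangulation (trL L). Proof. exact: is_rectangulation_tr. Qed.

Lemma point_cases q : q \in ip ->
  (exists x m, q = (true, (x, m)) /\ vpoint L x m) \/
  (exists x m, q = trq (true, (x, m)) /\ vpoint (trL L) x m).
Proof.
case: q => -[] [x y]; first by move=> /mem_vpoint; left; exists x, y.
move=> /mem_hpoint; right; exists (- y), (- x); split=> //.
by rewrite /trq /= !opprK.
Qed.

Lemma first_point : exists2 q0, q0 \in ip &
  [/\ q0.1, nleft L q0 = 0%N & forall q, q \in ip ->
    (q.1 -> (nabove L q <= nabove L q0)%N) /\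
    (nleft L q = 0%N -> q.1 /\ nabove L q = nabove L q0)].
Proof.
have [x [m [V n0 H]]] := vpoint_first HL.
exists (true, (x, m)); first exact/mem_vpoint.
split=> // q /point_cases[[x' [m' [-> V']]]|[x' [m' [-> V']]]].
  by have [h1 h2] := H _ _ V'; split=> // e; split=> //; exact: h2.
split=> //; rewrite -nabove_tr trqK => e.
by have := vpoint_nabove V'; rewrite e.
Qed.

Lemma last_point : exists2 q0, q0 \in ip &
  [/\ ~~ q0.1, nabove L q0 = 0%N & forall q, q \in ip ->
    (~~ q.1 -> (nleft L q <= nleft L q0)%N) /\
    (nabove L q = 0%N -> ~~ q.1 /\ nleft L q = nleft L q0)].
Proof.
have [x [m [V n0 H]]] := vpoint_first HL'.
exists (trq (true, (x, m))).
  by rewrite -insertion_points_tr trqK; apply/mem_vpoint.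
split=> //; first by rewrite -nleft_tr trqK.
move=> q /point_cases[[x' [m' [-> V']]]|[x' [m' [-> V']]]].
  by split=> // e; have := vpoint_nabove V'; rewrite e.
have E p : nleft L (trq p) = nabove (trL L) p by rewrite -nabove_tr trqK.
have E' p : nabove L (trq p) = nleft (trL L) p by rewrite -nleft_tr trqK.
rewrite !E !E'.
by have [h1 h2] := H _ _ V'; split=> // e; split=> //; exact: h2.
Qed.

Lemma insertion_points_size : (1 < size ip)%N.
Proof.
have [q0 q0L [q01 _ _]] := first_point; have [q1 q1L [q11 _ _]] := last_point.
apply: (@uniq_leq_size _ [:: q0; q1]).
  by rewrite /= inE andbT; apply: contraNneq q11 => <-.
by move=> q /[!inE] /orP[] /eqP->.
Qed.

Let q_ i := nth (true, (0, 0)) ip i.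

Lemma key_mono i j : (i < size ip)%N -> (j < size ip)%N ->
  (key L (q_ i) <= key L (q_ j))%N = (i <= j)%N.
Proof.
move=> iL jL; have mono u v : (u < v)%N -> (v < size ip)%N ->
    (key L (q_ u) < key L (q_ v))%N.
  move=> uv vL; have uL := ltn_trans uv vL.
  have := @sorted_ltn_nth _ _ ltn_trans 0%N _ (keys_sorted HL) u v.
  by rewrite !inE size_map !(nth_map (true, (0, 0))) //; apply.
case: (ltngtP i j) => [ij|ji|->]; last by rewrite leqnn.
  by rewrite ltnW ?mono.
by apply/negbTE; rewrite -ltnNge mono.
Qed.

(** Translates the first position into a count of neighbours, the form in which a child shows that
    it is bottom-based; [nabove_index] does the same for the last position. *)
Lemma nleft_index i : (i < size ip)%N -> (nleft L (q_ i) == 0%N) = (i == 0%N).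
Proof.
move=> iL; have [q0 q0L [q01 n0 H]] := first_point.
have i0 : (index q0 ip < size ip)%N by rewrite index_mem.
have q0E : q_ (index q0 ip) = q0 by rewrite /q_ nth_index.
have h0 : (0 < size ip)%N by exact: leq_ltn_trans (leq0n i) iL.
have L0 : nleft L (q_ 0) = 0%N.
  have le : (key L (q_ 0) <= key L q0)%N by rewrite -q0E key_mono.
  have q0v : (q_ 0).1.
    apply/negPn/negP => /(key_ge L) ge.
    by have := key_bound L q01; rewrite ltnNge (leq_trans ge le).
  have [/(_ q0v) hA _] := H _ (mem_nth (true, (0, 0)) h0).
  move: le hA; rewrite /key q0v q01 n0 -/(q_ 0).
  have := nabove_le L (q_ 0); have := nabove_le L q0.
  by move: (size _) (nabove _ _) (nabove _ _) (nleft _ _) => *; nia.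
apply/eqP/eqP => [e|-> //].
have [_ /(_ e)[iv hi]] := H _ (mem_nth (true, (0, 0)) iL).
have [_ /(_ L0)[zv hz]] := H _ (mem_nth (true, (0, 0)) h0).
apply/eqP; rewrite -leqn0 -key_mono //.
by move: hi hz iv zv; rewrite -!/(q_ _) /key => -> -> -> ->; rewrite e L0.
Qed.

Lemma nabove_index i : (i < size ip)%N ->
  (nabove L (q_ i) == 0%N) = (i.+1 == size ip).
Proof.
move=> iL; have [q0 q0L [q01 n0 H]] := last_point.
have i0 : (index q0 ip < size ip)%N by rewrite index_mem.
have q0E : q_ (index q0 ip) = q0 by rewrite /q_ nth_index.
have hl : ((size ip).-1 < size ip)%N by rewrite prednK // (leq_ltn_trans _ iL).
have L0 : nabove L (q_ (size ip).-1) = 0%N.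
  have le : (key L q0 <= key L (q_ (size ip).-1))%N.
    by rewrite -q0E key_mono // -ltnS prednK // (leq_ltn_trans _ iL).
  have q0v : ~~ (q_ (size ip).-1).1.
    apply/negP => /(key_bound L) lt.
    by have := key_ge L q01; rewrite leqNgt (leq_ltn_trans le lt).
  have [/(_ q0v) hA _] := H _ (mem_nth (true, (0, 0)) hl).
  move: le hA; rewrite /key (negPf q0v) (negPf q01) n0 -/(q_ _).
  have := nabove_le L (q_ (size ip).-1).
  by move: (size (tiles L)) (nabove _ _) (nleft _ _) (nleft _ _) => *; nia.
apply/eqP/eqP => [e|e]; last by rewrite -L0 -e.
have [_ /(_ e)[iv hi]] := H _ (mem_nth (true, (0, 0)) iL).
have [_ /(_ L0)[zv hz]] := H _ (mem_nth (true, (0, 0)) hl).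
have : ((size ip).-1 <= i)%N.
  rewrite -key_mono //.
  move: hi hz iv zv; rewrite -!/(q_ _) /key => -> -> /negPf -> /negPf ->.
  by rewrite e L0.
by move: iL; clear; lia.
Qed.

End ExtremePoints.

(** The two lists of keys are strictly increasing with the same members, hence equal entry by entry,
    and a key identifies its point. *)
Lemma corresponding_index f L M : is_rectangulation L -> is_rectangulation M ->
  iso f L M -> size (insertion_points M) = size (insertion_points L) /\
  forall i, (i < size (insertion_points L))%N ->
    corresponding f L M (nth (true, (0, 0)) (insertion_points L) i)
                        (nth (true, (0, 0)) (insertion_points M) i).
Proof.
move=> HL HM If; have [g Ig _] := iso_sym (tiles_uniq HM) If.
have ekeys : map (key L) (insertion_points L) = map (key M) (insertion_points M).
  apply: (irr_sorted_eq ltn_trans ltnn); rewrite ?keys_sorted //.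
  move=> k; apply/mapP/mapP => -[q qL ->].
    have [q' q'M C] := corresponding_exists HL HM If qL.
    by exists q' => //; rewrite (key_corresponding If C).
  have [q' q'L C] := corresponding_exists HM HL Ig qL.
  by exists q' => //; rewrite (key_corresponding Ig C).
have sz : size (insertion_points M) = size (insertion_points L).
  by rewrite -(size_map (key M)) -ekeys size_map.
split=> // i iL; have [q' q'M C] := corresponding_exists HL HM If (mem_nth (true, (0, 0)) iL).
suff <- : q' = nth (true, (0, 0)) (insertion_points M) i by [].
apply: (key_inj HM) => //; first by rewrite mem_nth // sz.
rewrite (key_corresponding If C).
rewrite -(nth_map _ 0%N) // -(nth_map _ 0%N) ?sz //.
by rewrite ekeys.
Qed.

End InsertionSorted.

(** * Insertion and deletion in both orientations up to isomorphism *)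

Section InsertedLayouts.

Variable F : realFieldType.
Implicit Types (L M : layout F) (a b c d r : rect F) (x y m h : F)
  (q : bool * (F * F)) (f : rect F -> rect F).

Lemma inserted_at_tr q L M :
  inserted_at q L M -> inserted_at (trq q) (trL L) (trL M).
Proof.
move=> [r [g [Bx p [xr yr] gsub grel]]].
exists (tr r), (fun a => tr (g (tr a))); split.
- by rewrite /= Bx.
- apply: (perm_trans (perm_map _ p)); rewrite /= perm_cons -!map_comp.
  have E : (fun a => tr (g (tr a))) \o @tr F =1 @tr F \o g by move=> a /=; rewrite trK.
  by rewrite (eq_map E) perm_refl.
- by rewrite /= xr yr.
- by move=> _ /mapP[a aL ->]; rewrite trK contained_tr gsub.
- move=> _ /mapP[a aL ->]; have [ha hl] := grel _ aL.
  by rewrite trK below_tr left_of_tr becomes_above_tr becomes_left_tr.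
Qed.

Lemma inserted_atP q L M : is_rectangulation L -> is_rectangulation M ->
  q \in insertion_points L -> inserted_at q L M ->
  q.1 /\ (exists x h, vins L M x h /\ {in tiles L, forall a,
     over L x a = becomes_above L q a /\
     left_of (cut L x h a) (corner L x h) = becomes_left L q a}) \/
  ~~ q.1 /\ (exists x h, vins (trL L) (trL M) x h /\ {in tiles (trL L), forall a,
     over (trL L) x a = becomes_above (trL L) (trq q) a /\
     left_of (cut (trL L) x h a) (corner (trL L) x h) = becomes_left (trL L) (trq q) a}).
Proof.
move=> HL HM /point_cases[[x [m [-> V]]]|[x [m [-> V]]]] I; [left|right]; split=> //.
  by have [h Vh H] := inserted_at_vins HL HM V I; exists x, h; split=> // a /H.
have := inserted_at_tr I; rewrite trqK => I'.
have [h Vh H] := inserted_at_vins (is_rectangulation_tr HL) (is_rectangulation_tr HM) V I'.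
by exists x, h; split=> // a /H.
Qed.

Lemma iso_trLK f L M : iso f (trL L) (trL M) -> exists g, iso g L M.
Proof.
by move=> /iso_tr; rewrite !trLK; exists (fun a => tr (f (tr a))).
Qed.

(** Opposite orientations are excluded by [vtype] of the layout and of its reflection; for equal
    ones [vins_iso_inv] applies, after a reflection in the horizontal case. *)
Lemma inserted_at_delete k q q' L M L' M' :
  is_rectangulation L -> is_rectangulation M ->
  is_rectangulation L' -> is_rectangulation M' ->
  q \in insertion_points L -> q' \in insertion_points L' ->
  inserted_at q L M -> inserted_at q' L' M' -> iso k M M' ->
  q.1 = q'.1 /\ exists f, iso f L L'.
Proof.
move=> HL HM HL' HM' qL qL' I I' Ik; have ev := iso_vtype HM HM' Ik.
have [HtM HtM'] := (is_rectangulation_tr HM, is_rectangulation_tr HM').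
have etv := iso_vtype HtM HtM' (iso_tr Ik).
case: (inserted_atP HL HM qL I) => -[+ [x [h [V _]]]];
  case: (inserted_atP HL' HM' qL' I') => -[+ [x' [h' [V' _]]]].
- by move=> -> ->; split=> //; exact: vins_iso_inv V V' Ik.
- move=> _ _; have := vins_vtype V; have := vins_vtype V'.
  by rewrite trLK -ev -etv; case: (vtype M) => //; rewrite andbF.
- move=> _ _; have := vins_vtype V; have := vins_vtype V'.
  by rewrite trLK -ev -etv; case: (vtype M) => //; rewrite andbF.
- move=> /negPf-> /negPf->; split=> //.
  have [f If] := vins_iso_inv V V' (iso_tr Ik).
  exact: iso_trLK If.
Qed.

Lemma inserted_at_iso f q q' L M L' M' :
  is_rectangulation L -> is_rectangulation M ->
  is_rectangulation L' -> is_rectangulation M' ->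
  q \in insertion_points L -> q' \in insertion_points L' ->
  inserted_at q L M -> inserted_at q' L' M' ->
  iso f L L' -> corresponding f L L' q q' -> exists k, iso k M M'.
Proof.
move=> HL HM HL' HM' qL qL' I I' If C; have [eq1 H] := C.
case: (inserted_atP HL HM qL I) => -[+ [x [h [V R]]]];
  case: (inserted_atP HL' HM' qL' I') => -[+ [x' [h' [V' R']]]];
  rewrite ?eq1; try by case: (q'.1).
  move=> _ _; apply: (vins_iso V V' If) => a aL.
    have [-> _] := R _ aL; have [-> _] := R' _ (iso_mem If aL).
    by have [-> _] := H _ aL.
  have [_ ->] := R _ aL; have [_ ->] := R' _ (iso_mem If aL).
  by have [_ ->] := H _ aL.
move=> _ _; have [_ Ht] := corresponding_tr C; have It := iso_tr If.
have [|a aL|k /iso_trLK //] := vins_iso V V' It.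
  move=> a aL; have [-> _] := R _ aL; have [-> _] := R' _ (iso_mem It aL).
  by have [-> _] := Ht _ aL.
have [_ ->] := R _ aL; have [_ ->] := R' _ (iso_mem It aL).
by have [_ ->] := Ht _ aL.
Qed.

Lemma contained_cut L M x h a : vins L M x h -> a \in tiles L ->
  contained (cut L x h a) a.
Proof.
move=> V aL; have [HL _ _ _ _] := V; have := vins_trichotomy V aL; have := tile_nd HL aL.
have [hB _ _] := vins_bounds V.
rewrite /contained /cut /nondegenerate; case O: (over L x a) => /= *; last by lra.
by move: O; rewrite /over; lra.
Qed.

Lemma inserted_at_exists q L : is_rectangulation L -> q \in insertion_points L ->
  exists f L' M, [/\ iso f L L', is_rectangulation L', is_rectangulation M &
    forall q', corresponding f L L' q q' -> inserted_at q' L' M].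
Proof.
have main x m L0 : is_rectangulation L0 -> vpoint L0 x m ->
  exists f L' M, [/\ iso f L0 L', is_rectangulation L', is_rectangulation M &
    forall q', corresponding f L0 L' (true, (x, m)) q' -> inserted_at q' L' M].
  move=> HL [b [bL yb xb [e1 [e2 [[v1 v2 lt C] l1 l2 em]]]]].
  have [f [L' [M [h [If V Ho Hl]]]]] := @vins_exists _ L0 b m HL bL yb ltac:(lra).
  have [HL' HM Bx p _] := V.
  exists f, L', M; split=> // q' [_ Hq]; exists (corner L' (x1 b) h), (cut L' (x1 b) h).
  split=> //; first by move=> a aL; exact: contained_cut V aL.
  move=> a'; have [pf _] := If; rewrite (perm_mem pf) => /mapP[a aL ->].
  rewrite (below_corner_cut V) ?(iso_mem If) // Ho // Hl //.
  by have [-> ->] := Hq _ aL; rewrite /becomes_above /becomes_left /= -xb.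
move=> HL /point_cases[[x [m [-> V]]]|[x [m [-> V]]]]; first exact: main.
have [f [L' [M [If HL' HM Hq]]]] := main _ _ _ (is_rectangulation_tr HL) V.
have If' := iso_tr If; rewrite trLK in If'.
exists (fun a => tr (f (tr a))), (trL L'), (trL M).
split=> //; try exact: is_rectangulation_tr.
move=> q' C; rewrite -[q']trqK; apply: inserted_at_tr; apply: Hq.
have := corresponding_tr C; rewrite trqK trLK => -[e H]; split=> //.
by move=> a aL; have := H _ aL; rewrite !trK.
Qed.

Lemma delete_inserted_at M : is_rectangulation M -> (1 < size (tiles M))%N ->
  exists2 q, q \in insertion_points (delete M) & inserted_at q (delete M) M.
Proof.
move=> HM sz; have [x [h [V|V]]] := delete_vins HM sz.
  have [m Vm I] := vins_inserted_at V; exists (true, (x, m)) => //.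
  exact/mem_vpoint.
have [m Vm I] := vins_inserted_at V; exists (trq (true, (x, m))).
  by rewrite -insertion_points_tr trqK; apply/mem_vpoint.
by have := inserted_at_tr I; rewrite !trLK.
Qed.

(** Makes the key of the insertion point readable in the result, up to the orientation, as numbers
    of neighbours of the corner tile. *)
Lemma inserted_at_counts q L M : is_rectangulation M -> inserted_at q L M ->
  [/\ size (tiles M) = (size (tiles L)).+1,
      nabove L q = count (below (bottom_right M)) (tiles M) &
      nleft L q = count (fun a => left_of a (bottom_right M)) (tiles M)].
Proof.
move=> HM [r [g [Bx p [xr yr] gsub grel]]].
have rM : r \in tiles M by rewrite (perm_mem p) mem_head.
have -> : bottom_right M = r by apply: bottom_rightE; rewrite ?Bx.
have /andP[nx ny] := tile_nd HM rM.
rewrite (perm_size p) /= size_map !(permP p) /= !count_map; split=> //.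
  rewrite /below (gt_eqF ny) /=; apply: eq_in_count => a aL /=.
  by have [<- _] := grel _ aL.
rewrite /left_of (gt_eqF nx) /=; apply: eq_in_count => a aL /=.
by have [_ <-] := grel _ aL.
Qed.

Lemma inserted_at_key k q q' L M L' M' :
  is_rectangulation M -> is_rectangulation M' -> inserted_at q L M ->
  inserted_at q' L' M' -> q.1 = q'.1 -> iso k M M' -> key L q = key L' q'.
Proof.
move=> HM HM' I I' e Ik.
have [sM aM lM] := inserted_at_counts HM I; have [sM' aM' lM'] := inserted_at_counts HM' I'.
have [rM _ _] := bottom_right_in HM; have ek := iso_bottom_right HM HM' Ik.
have sz : size (tiles L) = size (tiles L').
  by apply: succn_inj; rewrite -sM -sM'; have [p _] := Ik; rewrite (perm_size p) size_map.
rewrite /key e sz aM aM' lM lM' -ek.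
rewrite (iso_count Ik (Q := below (k (bottom_right M)))); last first.
  by move=> a aM0; have [_ ->] := Ik.2 _ _ rM aM0.
rewrite (iso_count Ik (Q := fun a => left_of a (k (bottom_right M)))) //.
by move=> a aM0; have [-> _] := Ik.2 _ _ aM0 rM.
Qed.

Definition bottom_basedL L : bool :=
  has (fun a => [&& y1 a == y1 (box L), x1 a == x1 (box L) & x2 a == x2 (box L)])
    (tiles L).

Definition right_basedL L : bool :=
  has (fun a => [&& x2 a == x2 (box L), y1 a == y1 (box L) & y2 a == y2 (box L)])
    (tiles L).

Lemma bottom_basedL_tr L : bottom_basedL (trL L) = right_basedL L.
Proof.
rewrite /bottom_basedL /right_basedL has_map; apply: eq_has => a /=.
by rewrite !eqr_opp [(y2 a == _) && _]andbC.
Qed.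

Lemma iso_bottom_basedL f L M : is_rectangulation L -> is_rectangulation M ->
  iso f L M -> bottom_basedL L = bottom_basedL M.
Proof.
move=> HL HM If; apply: (iso_has If) => a aL.
by rewrite (iso_at_bottom HL HM If) // (iso_at_left HL HM If) // (iso_at_right HL HM If).
Qed.

Lemma inserted_at_bottom_based q L M : is_rectangulation M -> inserted_at q L M ->
  bottom_basedL M = (nleft L q == 0%N).
Proof.
move=> HM I; have [_ _ ->] := inserted_at_counts HM I.
have [rM xr yr] := bottom_right_in HM.
rewrite eqn0Ngt -has_count -(tile_at_left HM rM); apply/hasP/idP.
  by case=> a aM /and3P[/eqP ya /eqP xa /eqP xa2]; rewrite (bottom_rightE HM aM) // xa.
by move=> xr1; exists (bottom_right M); rewrite // xr yr xr1 !eqxx.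
Qed.

Lemma inserted_at_right_based q L M : is_rectangulation M -> inserted_at q L M ->
  right_basedL M = (nabove L q == 0%N).
Proof.
move=> HM I; rewrite -bottom_basedL_tr -nleft_tr.
exact: inserted_at_bottom_based (is_rectangulation_tr HM) (inserted_at_tr I).
Qed.

End InsertedLayouts.

(** * The tree of rectangulations *)

Section Classes.

Variable F : realFieldType.
Implicit Types (R S : rectangulation F) (x : rclass F) (i n : nat).

Lemma piP R S : \pi_(rclass F) R = \pi_(rclass F) S <-> exists f, iso f R S.
Proof.
rewrite -equivalentP; split=> [/eqmodP /asboolP //|h].
by apply/eqmodP/asboolP.
Qed.

Lemma iso_repr x R : \pi_(rclass F) R = x -> exists f, iso f (repr x) R.
Proof. by move=> <-; apply/piP; rewrite reprK. Qed.

Lemma nrectsE x R : \pi_(rclass F) R = x -> nrects x = size (tiles R).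
Proof.
by move=> /iso_repr[f [p _]]; rewrite /nrects (perm_size p) size_map.
Qed.

Lemma nuE x R : \pi_(rclass F) R = x -> nu x = size (insertion_points R).
Proof.
by move=> /iso_repr[f If]; have [-> _] := corresponding_index (layP _) (layP R) If.
Qed.

Lemma bottom_basedE x R : \pi_(rclass F) R = x -> bottom_based x = bottom_basedL R.
Proof.
by move=> /iso_repr[f If]; rewrite -(iso_bottom_basedL (layP _) (layP R) If).
Qed.

Lemma right_basedE x R : \pi_(rclass F) R = x -> right_based x = right_basedL R.
Proof.
move=> /iso_repr[f If]; rewrite -bottom_basedL_tr.
have [H1 H2] := (is_rectangulation_tr (layP (repr x)), is_rectangulation_tr (layP R)).
by rewrite -(iso_bottom_basedL H1 H2 (iso_tr If)) bottom_basedL_tr.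
Qed.

Lemma index_lt i k : (0 < i <= k)%N -> (i.-1 < k)%N.
Proof. by case: i. Qed.

Lemma inserted_ip i R S : inserted i R S ->
  nth (true, (0, 0)) (insertion_points R) i.-1 \in insertion_points R.
Proof. by move=> [/index_lt ? _]; exact: mem_nth. Qed.

Lemma inserted_exists i x : (0 < i <= nu x)%N ->
  exists R S, \pi_(rclass F) R = x /\ inserted i R S.
Proof.
move=> iN; have iN' := index_lt iN; pose R0 := repr x.
have qR := mem_nth (true, (0, 0)) iN'.
have [f [L [M [If HL HM Hq]]]] := inserted_at_exists (layP R0) qR.
have [sz C] := corresponding_index (layP R0) HL If.
exists (Rectangulation (asboolT HL)), (Rectangulation (asboolT HM)); split.
  by rewrite -[RHS]reprK; apply/esym/piP; exists f.
by split; [rewrite /= sz | exact: Hq (C _ iN')].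
Qed.

Lemma childP i x : (0 < i <= nu x)%N -> exists R S,
  [/\ \pi_(rclass F) R = x, \pi_(rclass F) S = child i x & inserted i R S].
Proof.
move=> /inserted_exists[R [S [Rx I]]].
suff : [set y | exists R S,
    [/\ \pi_(rclass F) R = x, \pi_(rclass F) S = y & inserted i R S]]%classic (child i x) by [].
(* The default [x] of [xget] would be returned only for an empty set, which [inserted_exists] rules
   out. *)
by apply: xgetPex; exists (\pi_(rclass F) S), R, S.
Qed.

(** Independence of all choices: neither the representative nor the exact place of the new tile
    affects the class of the result. *)
Lemma inserted_child i R S : inserted i R S ->
  \pi_(rclass F) S = child i (\pi_(rclass F) R).
Proof.
move=> I; have [iN At] := I; have iN' := index_lt iN.
have iN2 : (0 < i <= nu (\pi_(rclass F) R))%N by rewrite (nuE erefl).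
have [R' [S' [/esym/piP[f If] <- I']]] := childP iN2; have [_ At'] := I'.
have [_ C] := corresponding_index (layP R) (layP R') If.
apply/piP; exact: (inserted_at_iso (layP R) (layP S) (layP R') (layP S')
  (inserted_ip I) (inserted_ip I') At At' If (C _ iN')).
Qed.

Lemma inserted_size i R S : inserted i R S -> size (tiles S) = (size (tiles R)).+1.
Proof. by move=> [_ /(inserted_at_counts (layP S))[]]. Qed.

Lemma size_gt0 R : (0 < size (tiles R))%N.
Proof. by have [rR _ _] := bottom_right_in (layP R); case: (tiles R) rR. Qed.

Lemma delete_inserted S : (1 < size (tiles S))%N ->
  exists R i, lay R = delete S /\ inserted i R S.
Proof.
move=> sz; have HD := delete_rectangulation (layP S) sz.
have [q qD At] := delete_inserted_at (layP S) sz.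
exists (Rectangulation (asboolT HD)), (index q (insertion_points (delete S))).+1.
by split=> //; split; rewrite /= ?index_mem ?nth_index.
Qed.

Lemma parent_inserted i R S : inserted i R S ->
  parent (\pi_(rclass F) S) = \pi_(rclass F) R.
Proof.
move=> I; set y := \pi_(rclass F) S; have [k Ik] := iso_repr (erefl y).
have sz : (1 < size (tiles (repr y)))%N.
  by have := nrectsE (erefl y); rewrite /nrects (inserted_size I) => ->; rewrite ltnS size_gt0.
have [R0 [i0 [eR0 I0]]] := delete_inserted sz.
rewrite /parent -eR0 valKd.
have [_ ex] := inserted_at_delete (layP R0) (layP (repr y)) (layP R) (layP S)
  (inserted_ip I0) (inserted_ip I) I0.2 I.2 Ik.
exact/piP.
Qed.

Lemma parent_child i x : (0 < i <= nu x)%N -> parent (child i x) = x.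
Proof. by move=> /childP[R [S [<- <- /parent_inserted]]]. Qed.

Lemma nrects_child i x : (0 < i <= nu x)%N -> nrects (child i x) = (nrects x).+1.
Proof.
move=> /childP[R [S [Rx Sx I]]].
by rewrite (nrectsE Sx) (nrectsE Rx) (inserted_size I).
Qed.

Lemma child_parent x : (1 < nrects x)%N ->
  exists2 i, (0 < i <= nu (parent x))%N & child i (parent x) = x.
Proof.
move=> sz; have [R [i [_ I]]] := delete_inserted sz.
have e1 := parent_inserted I; have e2 := inserted_child I; rewrite !reprK in e1 e2.
by exists i; rewrite e1 -?e2 // (nuE (erefl (\pi_(rclass F) R))); case: I.
Qed.

(** The common class determines the orientation and the key of the insertion point, and keys are
    injective on the list. *)
Lemma child_inj i j x : (0 < i <= nu x)%N -> (0 < j <= nu x)%N ->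
  child i x = child j x -> i = j.
Proof.
move=> iN jN; have [R [S [Rx <- I]]] := childP iN.
have [R' [S' [R'x <- I']]] := childP jN => /piP[k Ik].
have [eq1 _] := inserted_at_delete (layP R) (layP S) (layP R') (layP S')
  (inserted_ip I) (inserted_ip I') I.2 I'.2 Ik.
have ek := inserted_at_key (layP S) (layP S') I.2 I'.2 eq1 Ik.
have [f If] : exists f, iso f R R' by apply/piP; rewrite Rx R'x.
have [sz C] := corresponding_index (layP R) (layP R') If.
have iR : (i.-1 < size (insertion_points R))%N by rewrite -(nuE Rx) index_lt.
have jR : (j.-1 < size (insertion_points R'))%N by rewrite -(nuE R'x) index_lt.
rewrite -(key_corresponding If (C _ iR)) in ek.
have iR' : (i.-1 < size (insertion_points R'))%N by rewrite sz.
have e := key_inj (layP R') (mem_nth (true, (0, 0)) iR') (mem_nth (true, (0, 0)) jR) ek.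
have : i.-1 = j.-1.
  apply/eqP; rewrite -(nth_uniq (true, (0, 0)) iR' jR) ?e //.
  exact: insertion_points_uniq (layP R').
by move: iN jN; clear; lia.
Qed.

Lemma nu_gt1 x : (1 < nu x)%N.
Proof. exact: insertion_points_size (layP _). Qed.

Lemma bottom_based_child i x : (0 < i <= nu x)%N ->
  bottom_based (child i x) = (i == 1%N).
Proof.
move=> iN; have [R [S [Rx Sx I]]] := childP iN.
rewrite (bottom_basedE Sx) (inserted_at_bottom_based (layP S) I.2).
rewrite (nleft_index (layP R)); last by rewrite -(nuE Rx) index_lt.
by case: i iN {Sx I} => [|i].
Qed.

Lemma right_based_child i x : (0 < i <= nu x)%N ->
  right_based (child i x) = (i == nu x).
Proof.
move=> iN; have [R [S [Rx Sx I]]] := childP iN.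
rewrite (right_basedE Sx) (inserted_at_right_based (layP S) I.2).
rewrite (nabove_index (layP R)); last by rewrite -(nuE Rx) index_lt.
by rewrite (nuE Rx) prednK //; case/andP: iN.
Qed.

Lemma parent_id_rect n : parent (id_rect F n.+2) = id_rect F n.+1.
Proof.
pose side m : rectangulation F := Rectangulation (asboolT (side_rectangulation F m)).
have sE m : id_rect F m.+1 = \pi_(rclass F) (side m) by [].
have sz : (1 < size (tiles (side n.+1)))%N by rewrite /= size_map size_iota.
have [R [i [eR I]]] := delete_inserted sz.
rewrite sE (parent_inserted I) sE; apply/piP.
pose t (m : nat) : rect F := Rect m%:R 0 m.+1%:R 1.
set k := n.+1; have tS : tiles (side k) = rcons (map t (iota 0 k)) (t k).
  have -> : tiles (side k) = map t (iota 0 k.+1) by [].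
  by rewrite -[k.+1]addn1 iotaD map_cat cats1.
have brS : bottom_right (side k) = t k.
  by apply: (bottom_rightE (layP _)); rewrite // tS mem_rcons mem_head.
have ltt u v : ((t u : rect F) \in [:: t v]) = (u == v).
  by rewrite inE; apply/eqP/eqP => [[/eqP]|->//]; rewrite eqr_nat => /eqP.
have lo u v : left_of (t u) (t v) = (u.+1 == v).
  by rewrite /left_of /= eqr_nat maxxx minxx ltr01 andbT.
have be u v : below (t u) (t v) = false by rewrite /below /= oner_eq0.
have del : delete (side k) = (box (side k),
    [seq if left_of a (t k) then Rect (x1 a) (y1 a) (x2 (t k)) (y2 a) else a
    | a <- [seq a <- tiles (side k) | a != t k]]).
  rewrite /delete brS ifF.
    (* All tiles end at height 1, so no arm leaves the vertex upwards and [vdeletable_or] leaves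
       only the stem pointing down. *)
    case: (vdeletable_or (layP (side k)) sz) => -[].
      rewrite brS => /and4P[/hasP[a]].
      by rewrite tS -map_rcons => /mapP[v _ ->] /andP[_ /andP[_]]; rewrite ltxx.
    by rewrite bottom_right_tr brS stem_right_tr => ->.
  apply/negP => /and4P[/hasP[a]].
  by rewrite tS -map_rcons => /mapP[v _ ->] /andP[_ /andP[_]]; rewrite ltxx.
have fS : [seq a <- tiles (side k) | a != t k] = map t (iota 0 k).
  rewrite tS filter_rcons eqxx; apply/all_filterP/allP => _ /mapP[v vk ->].
  by have := ltt v k; rewrite inE => ->; move: vk; rewrite mem_iota; lia.
pose t' v : rect F := if v.+1 == k then Rect v%:R 0 k.+1%:R 1 else t v.
have tR : tiles R = map t' (iota 0 k).
  rewrite eR del -[LHS]/(map _ _) fS -map_comp; apply: eq_map => v /=.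
  by rewrite lo /t'; case: ifP.
have [||||f If _] := @iso_param F _ (iota 0 k) t' t R (side n).
- exact: tiles_uniq (layP R).
- by rewrite tR.
- exact: perm_refl.
- move=> u v; rewrite !mem_iota /= add0n => uk vk; rewrite lo be.
  rewrite /left_of /below /t'; case: (eqVneq u.+1 k) => hu; case: (eqVneq v.+1 k) => hv;
    rewrite /= ?eqr_nat ?oner_eq0 ?maxxx ?minxx ?ltr01 ?andbT; split=> //;
    by apply/eqP/eqP; move: hu hv uk vk; clear; lia.
by exists f.
Qed.

Lemma right_based_id_rect n : right_based (id_rect F n.+1).
Proof.
rewrite (right_basedE (erefl (id_rect F n.+1))) /right_basedL.
apply/hasP; exists (Rect n%:R 0 n.+1%:R 1); last by rewrite /= !eqxx.
by apply/mapP; exists n; rewrite // mem_iota; lia.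
Qed.

Lemma nrects_id_rect n : nrects (id_rect F n.+1) = n.+1.
Proof. by rewrite (nrectsE (erefl (id_rect F n.+1))) /= size_map size_iota. Qed.

Lemma id_rect_child n : id_rect F n.+2 = child (nu (id_rect F n.+1)) (id_rect F n.+1).
Proof.
have [|i iN e] := @child_parent (id_rect F n.+2); first by rewrite nrects_id_rect.
rewrite parent_id_rect in iN e; have := right_based_id_rect n.+1.
by rewrite -e right_based_child // => /eqP ->.
Qed.

End Classes.

(** * Jumps and blocks of children *)

Section Algorithms.

Variable F : realFieldType.
Implicit Types (x y P R : rclass F) (C : set (rclass F)) (o : direction)
  (i j k n : nat) (s : seq (rclass F)).

Definition dir_lt o k l : bool := if o is Right then (k < l)%N else (l < k)%N.

Lemma dir_lt_trans o : transitive (dir_lt o).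
Proof. by case: o => k l m /=; lia. Qed.

Lemma dir_lt_irr o : irreflexive (dir_lt o).
Proof. by case: o => k /=; rewrite ltnn. Qed.

Lemma dir_lt_total o k l : k != l -> dir_lt o k l || dir_lt o l k.
Proof. by case: o => /=; lia. Qed.

Lemma oppositeK : involutive opposite.
Proof. by case. Qed.

Definition steps o k d k' : Prop :=
  if o is Right then (k' = k + d)%N else (k = k' + d)%N.

Lemma strictly_betweenE o k d l k' : steps o k d k' ->
  strictly_between o k d l = dir_lt o k l && dir_lt o l k'.
Proof. by case: o => /= ->; rewrite ?addnK 1?andbC. Qed.

Lemma nrects_parent n x : nrects x = n.+2 -> nrects (parent x) = n.+1.
Proof.
move=> xn; have [|i iN e] := @child_parent F x; first by rewrite xn.
by apply: succn_inj; rewrite -(nrects_child iN) e.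
Qed.

Lemma level_top n C : level n C n = C.
Proof.
rewrite /level subnn; apply/seteqP; split=> [x [y Cy <-] //|x Cx].
by exists x.
Qed.

Lemma level_lower n C j : (j <= n)%N -> level n.+1 C j = level n (@parent F @` C)%classic j.
Proof.
move=> jn; rewrite /level subSn //; apply/seteqP; split=> [x [y Cy <-]|x [_ [y Cy <-] <-]].
  by exists (parent y); [exists y | rewrite iterSr].
by exists y; rewrite ?iterSr.
Qed.

Lemma minimal_jump_bounds n C o j x y : minimal_jump n C o j x y -> (2 <= j <= n)%N.
Proof. by case=> d [P [k []]]. Qed.

Lemma minimal_jump_nrects n C o j x y : minimal_jump n C o j x y ->
  nrects x = n /\ nrects y = n.
Proof. by case=> d [P [k [_ _ []]]]. Qed.

Lemma minimal_jump_top n C o P k k' : nrects P = n.+1 ->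
  (0 < k <= nu P)%N -> (0 < k' <= nu P)%N -> dir_lt o k k' ->
  (forall l, dir_lt o k l -> dir_lt o l k' -> ~ C (child l P)) ->
  minimal_jump n.+2 C o n.+2 (child k P) (child k' P).
Proof.
move=> Pn kP kP' kk' none; pose d := if o is Right then (k' - k)%N else (k - k')%N.
have dE : steps o k d k'.
  by rewrite /steps /d; case: (o) kk' => /=; lia.
exists d, P, k; split.
- by rewrite leqnn.
- by rewrite /steps /d; case: (o) kk' => /=; lia.
- by split; rewrite /rects /= nrects_child // Pn.
- by apply: (@jump_last F o _ d P k k') => //; rewrite ?parent_child //; case: (o) dE.
by move=> l; rewrite (strictly_betweenE _ dE) level_top => /andP[]; exact: none.
Qed.

Lemma minimal_jump_top_inv n C o x y : minimal_jump n C o n x y ->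
  exists k k', [/\ x = child k (parent x), y = child k' (parent x),
    (0 < k <= nu (parent x))%N, (0 < k' <= nu (parent x))%N & dir_lt o k k' /\
    forall l, dir_lt o k l -> dir_lt o l k' -> ~ C (child l (parent x))].
Proof.
case=> d [P [k [jn d0 _ J none]]].
have inv m R R' : jump o n d P k m R R' -> m = n -> exists k', [/\ parent R = P,
    parent R' = P, (0 < k <= nu P)%N, (0 < k' <= nu P)%N &
    [/\ steps o k d k', R = child k P & R' = child k' P]].
  case=> {m R R'} [k' R R' ? ? ? ? st ? ? _|m R R' le _ _ e].
    by exists k'; split=> //; split=> //; case: (o) st.
  by rewrite -e ltnn in le.
have [k' [xP yP kP kP' [dE xk yk]]] := inv _ _ _ J erefl.
exists k, k'; rewrite xP; split=> //; split.
  by move: d0 dE; case: (o) => /=; lia.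
move=> l kl lk; have := none l; rewrite (strictly_betweenE _ dE) kl lk level_top.
exact.
Qed.

Definition co_based x y : Prop :=
  (bottom_based x /\ bottom_based y) \/ (right_based x /\ right_based y).

Lemma minimal_jump_lower n C o j x y : (j <= n)%N ->
  minimal_jump n.+1 C o j x y ->
  co_based x y /\ minimal_jump n (@parent F @` C)%classic o j (parent x) (parent y).
Proof.
move=> jn [d [P [k [/andP[j2 _] d0 [xn yn] J none]]]].
have inv m R R' : jump o j d P k m R R' -> m = n.+1 ->
    co_based R R' /\ jump o j d P k n (parent R) (parent R').
  case=> {m R R'} [k' R R' _ _ _ _ _ _ _ e|m R R' _ b J' [<-] //].
  by rewrite e ltnn in jn.
have [b J'] := inv _ _ _ J erefl.
case: n jn xn yn J' none {J inv} => [|n] jn xn yn J' none; first by case: j j2 jn {J' none} => [|[]].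
split=> //; exists d, P, k; split=> //.
- by rewrite j2.
- by split; rewrite /rects /= (nrects_parent xn, nrects_parent yn).
by move=> l /none; rewrite level_lower.
Qed.

Lemma minimal_jump_lower_conv n C o j x y : nrects x = n.+1 -> nrects y = n.+1 ->
  co_based x y -> minimal_jump n (@parent F @` C)%classic o j (parent x) (parent y) ->
  minimal_jump n.+1 C o j x y.
Proof.
move=> xn yn b [d [P [k [/andP[j2 jn] d0 _ J none]]]].
exists d, P, k; split=> //.
- by rewrite j2 ltnW.
- exact: jump_below.
by move=> l /none; rewrite level_lower.
Qed.

(** The index at which the last rectangle comes to rest when it moves in direction [o]. *)
Definition end_index o P : nat := if o is Right then nu P else 1%N.

Lemma end_index_bounds o P : (0 < end_index o P <= nu P)%N.
Proof. by have := nu_gt1 P; case: o => /=; lia. Qed.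

Lemma end_index_neq o P : end_index (opposite o) P != end_index o P.
Proof. by have := nu_gt1 P; case: o => /=; lia. Qed.

Lemma turns_child o P k : (0 < k <= nu P)%N ->
  M_turns o (child k P) = (k == end_index o P).
Proof. by case: o => kP /=; rewrite ?bottom_based_child ?right_based_child. Qed.

Lemma co_based_child o P P' :
  co_based (child (end_index o P) P) (child (end_index o P') P').
Proof.
have h := end_index_bounds o P; have h' := end_index_bounds o P'.
case: o h h' => /= h h'; [left | right]; split.
- by rewrite bottom_based_child.
- by rewrite bottom_based_child.
- by rewrite right_based_child.
- by rewrite right_based_child.
Qed.

(** With at least two children no child of [P] is at both ends, so being co-based pins down the end
    at which [y] sits. *)
Lemma co_based_child_eq n o P y : nrects y = n.+2 ->
  co_based (child (end_index o P) P) y -> y = child (end_index o (parent y)) (parent y).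
Proof.
move=> yn; have [|i iN e] := @child_parent F y; first by rewrite yn.
have nP := nu_gt1 P; have h := end_index_bounds o P.
move=> b; rewrite -[LHS]e; congr child; rewrite -e in b; move: b; rewrite /co_based.
rewrite !(bottom_based_child h) !(bottom_based_child iN) (right_based_child h).
rewrite (right_based_child iN).
by case: o h => /= h [] [/eqP h1 /eqP h2]; lia.
Qed.

(** For the last rectangle, two different targets would contradict minimality of the longer jump.
    Otherwise the target is determined by its parent, unique by induction, and by the end at which
    [x] already sits. *)
Lemma minimal_jump_unique n C o j x y y' : C y -> C y' ->
  minimal_jump n C o j x y -> minimal_jump n C o j x y' -> y = y'.
Proof.
elim: n C x y y' => [|n IHn] C x y y' Cy Cy' J J'.
  by have := minimal_jump_bounds J; case: j {J J'} => [|[]].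
have := minimal_jump_bounds J => /andP[j2]; rewrite leq_eqVlt => /predU1P[ej|jn].
  rewrite ej in J J'.
  have [k [k1 [xk yk1 kP k1P [kk1 none]]]] := minimal_jump_top_inv J.
  have [k' [k2 [xk' yk2 kP' k2P [kk2 none']]]] := minimal_jump_top_inv J'.
  have ek : k' = k by apply: (child_inj kP' kP); rewrite -xk -xk'.
  rewrite ek in kk2 none'; rewrite yk1 yk2; congr child.
  apply/eqP/negPn/negP => /(dir_lt_total o) /orP[lt|lt].
    by apply: (none' k1) => //; rewrite -yk1.
  by apply: (none k2) => //; rewrite -yk2.
have jn' : (j <= n)%N by [].
have [b Jp] := minimal_jump_lower jn' J; have [b' Jp'] := minimal_jump_lower jn' J'.
have [xn yn] := minimal_jump_nrects J; have [_ yn'] := minimal_jump_nrects J'.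
have ep : parent y = parent y'.
  by apply: IHn Jp Jp'; [exists y | exists y'].
case: n {IHn Jp Jp' jn'} jn xn yn yn' {J J'} => [|n] jn xn yn yn'; first by case: j j2 jn => [|[]].
have [|i iN e] := @child_parent F x; first by rewrite xn.
have [o' eo] : exists o', x = child (end_index o' (parent x)) (parent x).
  case: b => -[]; rewrite -{1}e ?bottom_based_child ?right_based_child // => /eqP ei _.
    by exists Left; rewrite -[LHS]e ei.
  by exists Right; rewrite -[LHS]e ei.
rewrite eo in b b'.
by rewrite (co_based_child_eq yn b) (co_based_child_eq yn' b') ep.
Qed.

Definition children C P : seq nat :=
  [seq k <- iota 1 (nu P) | `[< C (child k P) >]].

Definition indices C o P : seq nat :=
  if o is Right then children C P else rev (children C P).

Definition block C o P : seq (rclass F) := [seq child k P | k <- indices C o P].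

Fixpoint weave C o s : seq (rclass F) :=
  if s is P :: s' then block C o P ++ weave C (opposite o) s' else [::].

Fixpoint visits n C : seq (rclass F) :=
  if n is m.+1 then
    if m is 0 then [:: id_rect F 1] else weave C Left (visits m (@parent F @` C)%classic)
  else [::].

Lemma mem_indices C o P k :
  (k \in indices C o P) = (0 < k <= nu P)%N && `[< C (child k P) >].
Proof.
have -> : (k \in indices C o P) = (k \in children C P).
  by case: o => //=; rewrite mem_rev.
by rewrite mem_filter mem_iota add1n ltnS andbC.
Qed.

Lemma indices_sorted C o P : sorted (dir_lt o) (indices C o P).
Proof.
have s : sorted ltn (children C P).
  by apply: sorted_filter; [exact: ltn_trans | exact: iota_ltn_sorted].
by case: o => //=; rewrite rev_sorted.
Qed.

Lemma indices_opposite C o P : indices C (opposite o) P = rev (indices C o P).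
Proof. by case: o => //=; rewrite revK. Qed.

Lemma indices_uniq C o P : uniq (indices C o P).
Proof.
by apply: (sorted_uniq (@dir_lt_trans o) (@dir_lt_irr o)); exact: indices_sorted.
Qed.

(** Applied to the indices of a block: the target of a minimal jump of the last rectangle is the
    next entry. *)
Lemma sorted_next (T : eqType) (r : rel T) (A B : seq T) (k k' : T) :
  transitive r -> irreflexive r -> sorted r (A ++ k :: B) ->
  k' \in A ++ k :: B -> r k k' ->
  {in A ++ k :: B, forall l, r k l -> ~~ r l k'} -> exists B', B = k' :: B'.
Proof.
move=> tr ir; rewrite (sorted_pairwise tr) pairwise_cat => /and3P[/allrelP Ak _ pB].
rewrite mem_cat inE => /or3P[k'A|/eqP->|k'B] kk'; last 1 first.
- move: pB k'B => /= /andP[/allP kB]; case: B kB {Ak} => // b B kB /= /andP[/allP bB _].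
  rewrite inE => /predU1P[->|k'B] H; first by exists B.
  have := H b; rewrite mem_cat !inE eqxx !orbT => /(_ isT).
  by rewrite kB ?mem_head // bB // => /(_ isT).
- have := Ak _ _ k'A (mem_head _ _) => k'k.
  by have := tr _ _ _ kk' k'k; rewrite ir.
- by rewrite ir in kk'.
Qed.

End Algorithms.

(** * Algorithm M *)

Section AlgorithmRuns.

Variable F : realFieldType.
Implicit Types (x y P R : rclass F) (C : set (rclass F)) (o : direction)
  (i j k n : nat) (s : seq (rclass F)).

Section TopLevel.

Variables (n : nat) (C : set (rclass F)).
Hypothesis C_rects : forall x, C x -> nrects x = n.+2.
Local Notation C' := (@parent F @` C)%classic.
Hypothesis C_ends : forall P, C' P -> C (child 1 P) /\ C (child (nu P) P).

Lemma parents_rects P : C' P -> nrects P = n.+1.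
Proof. by move=> [x Cx <-]; apply: nrects_parent; exact: C_rects. Qed.

Lemma end_index_in o o' P : C' P -> end_index o' P \in indices C o P.
Proof.
move=> /C_ends[C1 Cn]; rewrite mem_indices end_index_bounds /=.
by apply/asboolP; case: o'.
Qed.

(** The zigzag condition puts both extreme children into the set, so that each block runs from one
    end to the other. *)
Lemma indices_ends o P : C' P -> exists K,
  indices C o P = end_index (opposite o) P :: rcons K (end_index o P).
Proof.
move=> CP; have f := end_index_in o (opposite o) CP.
have l := end_index_in o o CP; have := indices_sorted C o P.
have lim k : k \in indices C o P ->
    (k == end_index (opposite o) P) || dir_lt o (end_index (opposite o) P) k.
  by rewrite mem_indices => /andP[kP _]; case: (o) => /=; lia.
have lim' k : k \in indices C o P -> (k == end_index o P) || dir_lt o k (end_index o P).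
  by rewrite mem_indices => /andP[kP _]; case: (o) => /=; lia.
have ne := end_index_neq o P.
move: f l lim lim' ne; move: (end_index _ P) (end_index o P) => u v.
have tr := @dir_lt_trans o; have ir := @dir_lt_irr o.
case: (indices C o P) => // a s uI vI lim lim' ne srt.
have pa := order_path_min tr srt.
have ea : u = a.
  have := lim a (mem_head _ _) => /predU1P[//|ua].
  move: uI; rewrite inE => /predU1P[//|/(allP pa) au].
  by have := tr _ _ _ ua au; rewrite ir.
rewrite ea; move: vI; rewrite inE eq_sym -ea (negPf ne) /= ea => vs.
case/lastP: s vs lim lim' srt pa {uI} => // K b vs lim lim' srt pa.
exists K; congr (_ :: rcons _ _); apply/eqP.
have bI : b \in a :: rcons K b by rewrite inE mem_rcons mem_head orbT.
have /orP[//|bv] := lim' b bI.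
move: vs; rewrite mem_rcons inE => /predU1P[->//|vK].
move: srt; rewrite (sorted_pairwise tr) /= -cats1 pairwise_cat.
case/and3P=> _ /allrelP /(_ v b vK (mem_head _ _)) vb _.
by have := tr _ _ _ bv vb; rewrite ir.
Qed.

Lemma mem_block o P x : C' P ->
  (x \in block C o P) <-> C x /\ parent x = P.
Proof.
move=> CP; split=> [/mapP[k]|[Cx <-]].
  by rewrite mem_indices => /andP[kP /asboolP Ck] ->; rewrite parent_child.
have [|k kP e] := @child_parent F x; first by rewrite C_rects.
by apply/mapP; exists k; rewrite // mem_indices kP e; apply/asboolP.
Qed.

Lemma mem_weave o s x : {in s, forall P, C' P} ->
  (x \in weave C o s) <-> C x /\ parent x \in s.
Proof.
elim: s o => [|P s IHs] o sC /=; first by split=> // -[].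
have CP := sC _ (mem_head _ _).
have sC' : {in s, forall P, C' P} by move=> Q Qs; apply: sC; rewrite inE Qs orbT.
rewrite mem_cat; split=> [/orP[/(mem_block _ _ CP)[Cx <-]|/(IHs _ sC')[Cx xs]]|[Cx]].
- by split; rewrite // mem_head.
- by split; rewrite // inE xs orbT.
rewrite inE => /predU1P[e|xs]; apply/orP; [left|right].
  by apply/(mem_block _ _ CP).
by apply/(IHs _ sC').
Qed.

Lemma weave_uniq o s : {in s, forall P, C' P} -> uniq s -> uniq (weave C o s).
Proof.
elim: s o => //= P s IHs o sC /andP[Ps us]; have CP := sC _ (mem_head _ _).
have sC' : {in s, forall P, C' P} by move=> Q Qs; apply: sC; rewrite inE Qs orbT.
rewrite cat_uniq IHs // andbT; apply/andP; split.
  rewrite map_inj_in_uniq ?indices_uniq // => k l.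
  rewrite !mem_indices => /andP[kP _] /andP[lP _]; exact: child_inj.
apply/hasPn => x /(mem_weave _ _ sC')[_ xs].
by apply/negP => /(mem_block _ _ CP)[_ e]; rewrite -e xs in Ps.
Qed.

Lemma block_split o P k A B : C' P -> indices C o P = A ++ k :: B ->
  [/\ (0 < k <= nu P)%N, C (child k P) & nrects P = n.+1].
Proof.
move=> CP e; have : k \in indices C o P by rewrite e mem_cat mem_head orbT.
by rewrite mem_indices => /andP[-> /asboolP]; split=> //; exact: parents_rects.
Qed.

Lemma block_jump o P k k' A B : C' P -> indices C o P = A ++ [:: k, k' & B] ->
  minimal_jump n.+2 C o n.+2 (child k P) (child k' P).
Proof.
move=> CP e; have [kP _ Pn] := block_split CP e.
have [k'P _ _] : [/\ (0 < k' <= nu P)%N, C (child k' P) & nrects P = n.+1].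
  by apply: (@block_split o _ _ (A ++ [:: k]) B) => //; rewrite -catA.
have := indices_sorted C o P; rewrite (sorted_pairwise (@dir_lt_trans o)) e.
rewrite pairwise_cat => /and3P[/allrelP AB _ /= /and3P[/andP[kk' kB] k'B _]].
apply: minimal_jump_top => // l kl lk' Cl.
have lP : (0 < l <= nu P)%N by move: kl lk' kP k'P; case: (o) => /=; lia.
have : l \in indices C o P by rewrite mem_indices lP; apply/asboolP.
rewrite e mem_cat !inE => /or4P[lA|/eqP el|/eqP el|lB].
- have := AB l k lA (mem_head _ _) => lk.
  by have := dir_lt_trans lk kl; rewrite dir_lt_irr.
- by rewrite el dir_lt_irr in kl.
- by rewrite el dir_lt_irr in lk'.
- have := dir_lt_trans (allP k'B _ lB) lk'; by rewrite dir_lt_irr.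
Qed.

End TopLevel.

(** A single execution whose choices are read off from the list; uniqueness of minimal jumps later
    extends it to all executions. *)
Fixpoint M_run n C (S : M_state F) s : Prop :=
  if s is x :: s' then
    M_rect S = x /\
    if s' is y :: _ then
      [/\ M_s S n <> 1%N, minimal_jump n C (M_o S (M_s S n)) (M_s S n) x y &
          M_run n C (M_update n S y) s']
    else M_s S n = 1%N
  else False.

Lemma M_run_cons n C S x y s : M_run n C S [:: x, y & s] =
  (M_rect S = x /\ [/\ M_s S n <> 1%N,
     minimal_jump n C (M_o S (M_s S n)) (M_s S n) x y &
     M_run n C (M_update n S y) (y :: s)]).
Proof. by []. Qed.

Arguments M_run : simpl never.

Section Simulation.

Variables (n : nat) (C : set (rclass F)).
Hypothesis C_rects : forall x, C x -> nrects x = n.+2.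
Local Notation C' := (@parent F @` C)%classic.
Hypothesis C_ends : forall P, C' P -> C (child 1 P) /\ C (child (nu P) P).
Local Notation N := n.+2.

(* While r_N sweeps through a block the entries below N stay put, except that
   s_N and s_(N-1) are updated at the end. *)
Lemma M_run_block o P K k A S s : C' P -> K != [::] ->
  indices C o P = A ++ k :: K ->
  M_rect S = child k P -> M_s S N = N -> M_o S N = o ->
  (forall S1, M_rect S1 = child (last k K) P -> M_o S1 N = opposite o ->
     M_s S1 N = M_s S n.+1 -> M_s S1 n.+1 = n.+1 ->
     (forall j, (j <= n.+1)%N -> M_o S1 j = M_o S j) ->
     (forall j, (j <= n)%N -> M_s S1 j = M_s S j) ->
     M_run N C S1 (child (last k K) P :: s)) ->
  M_run N C S ([seq child i P | i <- k :: K] ++ s).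
Proof.
move=> CP; elim: K k A S => // k' K IHK k A S _ e rS sS oS cont.
have J := block_jump C_rects CP e.
rewrite /= M_run_cons rS; split=> //; rewrite sS oS; split=> //.
have [k'P _ _] : [/\ (0 < k' <= nu P)%N, C (child k' P) & nrects P = n.+1].
  by apply: (@block_split _ _ C_rects o P k' (rcons A k) K CP); rewrite cat_rcons.
have [K0 eK] := indices_ends C_ends o CP.
have lastK : last k' K = end_index o P.
  have := congr1 (last 0%N) eK; rewrite e last_cat /= last_rcons.
  by [].
rewrite /M_update sS oS subnn /= turns_child //.
case: K IHK e cont lastK => [|k2 K] IHK e cont lastK.
  rewrite -lastK eqxx /=; apply: cont; rewrite /= ?eqxx //.
  - have -> : (n.+2 == n.+1) = false by lia.
    by have -> : (n.+1 == n.+2) = false by lia.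
  - by move=> j jn; have -> : (j == n.+2) = false by lia.
  - move=> j jn; have -> : (j == n.+2) = false by lia.
    by have -> : (j == n.+1) = false by lia.
have -> : (k' == end_index o P) = false.
  have := indices_uniq C o P; rewrite e cat_uniq => /and3P[_ _ /= /and3P[_ k'K _]].
  apply: contraNF k'K => /eqP->; rewrite -lastK /=; exact: mem_last.
apply: (IHK k' (rcons A k)); rewrite ?cat_rcons //= ?eqxx //.
move=> S1 r1 o1 s1 s1' oj sj; apply: cont => //.
- by rewrite s1; have -> : (n.+1 == n.+2) = false by lia.
- by move=> j jn; rewrite sj //; have -> : (j == n.+2) = false by lia.
Qed.

(** When a block ends, entry [N] of [s] receives entry [n.+1], which is then reset to [n.+1]. The
    former is the index that the run on the parents uses next; the latter is the reset with which
    its own update begins. So after the jump between two blocks both states agree again on the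
    entries up to [n.+1]. *)
Lemma M_run_weave s S' S o : {in s, forall P, C' P} -> M_run n.+1 C' S' s ->
  (forall P, ohead s = Some P -> M_rect S = child (end_index (opposite o) P) P) ->
  (forall j, (0 < j <= n.+1)%N -> M_o S j = M_o S' j /\ M_s S j = M_s S' j) ->
  M_o S N = o -> M_s S N = N -> M_run N C S (weave C o s).
Proof.
elim: s S' S o => // P s IHs S' S o sC [rS' run] rS agree oS sS.
have CP := sC _ (mem_head _ _); have [K eK] := indices_ends C_ends o CP.
have sC' : {in s, forall P, C' P} by move=> Q Qs; apply: sC; rewrite inE Qs orbT.
rewrite [weave _ _ _]/= /block eK.
have rS0 := rS P erefl.
apply: (@M_run_block o P (rcons K (end_index o P)) (end_index (opposite o) P) [::] S) => //.
  by case: (K).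
rewrite last_rcons => S1 r1 o1 s1N s1n oj sj.
have e1 : M_s S1 N = M_s S' n.+1 by rewrite s1N; have [] := agree n.+1; rewrite ?leqnn.
case: s IHs run sC sC' rS => [|P' s] IHs run sC sC' rS.
  by split; [exact: r1 | rewrite e1].
have CP' := sC' _ (mem_head _ _); have [K' eK'] := indices_ends C_ends (opposite o) CP'.
case: run => ne1 J run; rewrite [weave _ _ _]/= /block eK' oppositeK.
have := minimal_jump_bounds J => /andP[j2 jn].
set y := child (end_index o P') P'; set x := child (end_index o P) P.
have xn : nrects x = N by rewrite nrects_child ?end_index_bounds // (parents_rects C_rects CP).
have yn : nrects y = N by rewrite nrects_child ?end_index_bounds // (parents_rects C_rects CP').
have px : parent x = P by rewrite parent_child // end_index_bounds.
have py : parent y = P' by rewrite parent_child // end_index_bounds.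
have oj1 : M_o S1 (M_s S' n.+1) = M_o S' (M_s S' n.+1).
  by rewrite oj //; have [|//] := agree (M_s S' n.+1); rewrite jn (ltnW j2).
rewrite [_ ++ _]/= M_run_cons e1 oj1; split=> //; split=> //.
  by apply: minimal_jump_lower_conv; rewrite ?px ?py //; exact: co_based_child.
have run' := IHs (M_update n.+1 S' P') (M_update N S1 y) (opposite o) sC' run.
move: run'; rewrite [weave C (opposite o) (P' :: s)]/= /block eK' oppositeK.
(* The test in step M5 concerns the same rectangulation in both runs. *)
have eu : iter (N - M_s S' n.+1) (@parent F) y = iter (n.+1 - M_s S' n.+1) (@parent F) P'.
  by rewrite subSn // iterSr py.
move ej : (M_s S' n.+1) J j2 jn e1 oj1 eu ne1 => j J j2 jn e1 oj1 eu ne1.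
apply.
- by move=> Q [<-]; rewrite /M_update; case: ifP.
- have base i : (0 < i <= n.+1)%N ->
      (if i == N then N else M_s S1 i) = (if i == n.+1 then n.+1 else M_s S' i).
    move=> iP; have -> : (i == N) = false by lia.
    case: eqVneq => [->//|ne]; rewrite sj; last by lia.
    by have [] := agree i iP.
  move=> i iP; have baseo : M_o S1 i = M_o S' i.
    by rewrite oj; [have [] := agree i iP | lia].
  rewrite /M_update e1 ej oj1 eu; case: ifP => _ /=; rewrite baseo !base //; lia.
- rewrite /M_update e1; case: ifP => _ //=; rewrite o1.
  by have -> : (N == j) = false by lia.
rewrite /M_update e1; case: ifP => _ //=; rewrite eqxx //.
have -> : (N == j.-1) = false by lia.
by have -> : (N == j) = false by lia.
Qed.

End Simulation.
End AlgorithmRuns.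

(** * Algorithm J *)

Section Outputs.

Variable F : realFieldType.
Implicit Types (x y P R : rclass F) (C : set (rclass F)) (o : direction)
  (i j k n : nat) (s : seq (rclass F)).

Lemma visits_spec n C : (C `<=` rects n.+1)%classic -> zigzag n.+1 C ->
  [/\ uniq (visits n.+1 C), forall x, x \in visits n.+1 C <-> C x,
      ohead (visits n.+1 C) = Some (id_rect F n.+1) &
      M_run n.+1 C (MState (id_rect F n.+1) (fun _ => Left) id) (visits n.+1 C)].
Proof.
elim: n C => [|n IHn] C Cr.
  move=> /= ->; split=> // x; rewrite inE.
  by split=> [/eqP|->].
move=> [zC' ends]; have C_rects x : C x -> nrects x = n.+2 by exact: Cr.
have [|u m hd run] := IHn _ _ zC'; first by move=> P CP; exact: (parents_rects C_rects CP).
have sC : {in visits n.+1 (@parent F @` C)%classic, forall P, (@parent F @` C)%classic P}.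
  by move=> P /m.
(* The initial rectangulation is the rightmost child of its parent, where a block in direction
   [Left] begins. *)
have fst P : ohead (visits n.+1 (@parent F @` C)%classic) = Some P ->
    id_rect F n.+2 = child (end_index Right P) P.
  by rewrite hd => -[<-]; exact: id_rect_child.
have -> : visits n.+2 C = weave C Left (visits n.+1 (@parent F @` C)%classic) by [].
split.
- exact: (weave_uniq C_rects Left sC u).
- move=> x; split=> [/(mem_weave C_rects _ _ sC)[]//|Cx].
  by apply/(mem_weave C_rects _ _ sC); split=> //; apply/m; exists x.
- case: (visits n.+1 _) hd fst sC => //= P s [eP] fst sC.
  have [K eK] := indices_ends ends Left (sC _ (mem_head _ _)).
  by rewrite /block eK /= -fst.
- exact: (M_run_weave C_rects ends sC run).
Qed.

Lemma M_run_outputs n C S s : M_run n C S s -> {in s, forall x, C x} ->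
  outputs (@M_step F n C) (fun S => M_s S n = 1%N) (@M_rect F) S s.
Proof.
elim: s S => // x [|y s] IHs S.
  by case=> <- fin _; apply: outputs_final.
rewrite M_run_cons => -[<- [ne J run]] sC.
have Cy : C y by apply: sC; rewrite !inE eqxx orbT.
have sC' : {in y :: s, forall x, C x} by move=> z zs; apply: sC; rewrite inE zs orbT.
apply: outputs_step => //; first by exists (M_update n S y), y.
move=> T [R [J' CR ->]]; rewrite (minimal_jump_unique CR Cy J' J).
exact: IHs.
Qed.

Definition candidate n C (V : seq (rclass F)) x o j R : Prop :=
  [/\ minimal_jump n C o j x R, C R & R \notin x :: V].

(* x has been visited after V, and W remains to be visited. *)
Definition J_forced n C (V : seq (rclass F)) x (W : seq (rclass F)) : Prop :=
  if W is y :: _ then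
    exists o j, minimal_jump n C o j x y /\
      forall o' j' R, candidate n C V x o' j' R ->
        (j' < j)%N \/ [/\ j' = j, o' = o & R = y]
  else forall o j R, ~ candidate n C V x o j R.

Lemma weave_split C o s V x W : weave C o s = V ++ x :: W ->
  exists s1 P s2 oP A k B, [/\ s = s1 ++ P :: s2, indices C oP P = A ++ k :: B,
    x = child k P, V = weave C o s1 ++ [seq child i P | i <- A] &
    W = [seq child i P | i <- B] ++ weave C (opposite oP) s2].
Proof.
elim: s o V => [|P s IHs] o V /=; first by case: V.
move=> e; have [le|lt] := leqP (size (block C o P)) (size V).
  have e1 : V = block C o P ++ drop (size (block C o P)) V.
    rewrite -{1}(cat_take_drop (size (block C o P)) V); congr (_ ++ _).
    by have := congr1 (take (size (block C o P))) e; rewrite take_size_cat // takel_cat.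
  move: e; rewrite e1 -catA => /eqP; rewrite eqseq_cat // eqxx /= => /eqP e2.
  have [s1 [Q [s2 [oQ [A [k [B [-> eI -> eV eW]]]]]]]] := IHs _ _ e2.
  exists (P :: s1), Q, s2, oQ, A, k, B; split=> //.
  by rewrite /= -catA -eV.
have e1 : V = [seq child i P | i <- take (size V) (indices C o P)].
  rewrite map_take -/(block C o P).
  by have := congr1 (take (size V)) e; rewrite takel_cat 1?ltnW // take_size_cat.
have e2 : drop (size V) (block C o P) ++ weave C (opposite o) s = x :: W.
  by have := congr1 (drop (size V)) e; rewrite drop_cat lt drop_size_cat.
case eB : (drop (size V) (indices C o P)) => [|k B].
  have := congr1 size eB; rewrite size_drop /= => /eqP; rewrite subn_eq0.
  by move: lt; rewrite size_map ltnNge => /negPf ->.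
exists [::], P, s, o, (take (size V) (indices C o P)), k, B.
move: e2; rewrite /block -map_drop eB /= => -[ex eW].
by split; rewrite // -eB cat_take_drop.
Qed.

Lemma J_forced_visits n C V x W : (C `<=` rects n.+1)%classic -> zigzag n.+1 C ->
  visits n.+1 C = V ++ x :: W -> J_forced n.+1 C V x W.
Proof.
elim: n C V x W => [|n IHn] C V x W Cr.
  move=> _ /=; case: V => [[_ <-]|z V [_]]; last by case: V.
  by move=> o j R [/minimal_jump_bounds]; case: j => [|[]].
move=> [zC' ends]; have C_rects z : C z -> nrects z = n.+2 by exact: Cr.
have Cr' : (@parent F @` C `<=` rects n.+1)%classic.
  by move=> P CP; exact: (parents_rects C_rects CP).
have [_ m _ _] := visits_spec Cr' zC'.
have -> : visits n.+2 C = weave C Left (visits n.+1 (@parent F @` C)%classic) by [].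
move=> /weave_split[s1 [P [s2 [o [A [k [B [es eI ex eV eW]]]]]]]].
have sC : {in s1 ++ P :: s2, forall Q, (@parent F @` C)%classic Q}.
  by move=> Q; rewrite -es => /m.
have CP : (@parent F @` C)%classic P by apply: sC; rewrite mem_cat mem_head orbT.
have [kP Ck Pn] := block_split C_rects CP eI.
have xn : nrects x = n.+2 by rewrite ex nrects_child ?Pn.
have px : parent x = P by rewrite ex parent_child.
(* Jumps of the last rectangle stay within the block of x. *)
have top o' R : candidate n.+2 C V x o' n.+2 R ->
    o' = o /\ exists k' B', B = k' :: B' /\ R = child k' P.
  case=> J CR; rewrite inE negb_or eV mem_cat negb_or => /and3P[_ _ RA].
  have [k0 [k' [xk0 Rk' k0P k'P [k0k' none]]]] := minimal_jump_top_inv J.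
  rewrite px in xk0 Rk' k0P k'P none.
  have ek : k0 = k by apply: (child_inj k0P kP); rewrite -xk0.
  rewrite {k0 xk0 k0P}ek in k0k' none.
  have k'I : k' \in indices C o' P.
    by rewrite mem_indices k'P /=; apply/asboolP; rewrite -Rk'.
  have none' : {in indices C o' P, forall l, dir_lt o' k l -> ~~ dir_lt o' l k'}.
    move=> l; rewrite mem_indices => /andP[_ /asboolP Cl] kl.
    by apply/negP => /(none _ kl).
  have nxt := sorted_next (@dir_lt_trans o') (@dir_lt_irr o').
  have so := indices_sorted C o' P.
  have [eo|eo] : o' = o \/ o' = opposite o by case: (o') (o) => -[]; auto.
    rewrite eo eI in so k'I none'; rewrite eo in k0k' none' nxt.
    have [B' eB] := nxt _ _ _ _ so k'I k0k' none'.
    by split=> //; exists k', B'.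
  (* A jump against the direction of the block reaches the preceding entry, which has been
     visited. *)
  have eI' : indices C o' P = rev B ++ k :: rev A.
    by rewrite eo indices_opposite eI rev_cat rev_cons cat_rcons.
  rewrite eI' in so k'I none'.
  have [A' eA] := nxt _ _ _ _ so k'I k0k' none'.
  case/negP: RA; rewrite Rk'; apply: (map_f (fun i => child i P)).
  by rewrite -mem_rev eA mem_head.
case: B eI eW top => [|k' B] eI eW top; last first.
  rewrite eW /=; exists o, n.+2; split.
    by rewrite ex; exact: (block_jump C_rects CP eI).
  move=> o' j' R cand; have [J _ _] := cand.
  have := minimal_jump_bounds J => /andP[_]; rewrite leq_eqVlt => /predU1P[ej|]; last by left.
  rewrite ej in cand *; have [-> [k2 [B2 [[<- _] ->]]]] := top _ _ cand.
  by right.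
have [K eK] := indices_ends ends o CP.
have ek : k = end_index o P.
  have := congr1 (last 0%N) eK; rewrite eI last_cat /= last_rcons.
  by [].
have lower o' j' R : candidate n.+2 C V x o' j' R ->
    [/\ (j' <= n.+1)%N, candidate n.+1 (@parent F @` C)%classic s1 P o' j' (parent R)
      & R = child (end_index o (parent R)) (parent R)].
  move=> cand; have [J CR RV] := cand.
  have := minimal_jump_bounds J => /andP[_]; rewrite leq_eqVlt => /predU1P[ej|jn].
    by rewrite ej in cand; have [_ [k2 [B2 []]]] := top _ _ cand.
  have jn' : (j' <= n.+1)%N by [].
  have [b J'] := minimal_jump_lower jn' J; rewrite px in J'.
  have eR : R = child (end_index o (parent R)) (parent R).
    by apply: (co_based_child_eq (P := P) (C_rects _ CR)); rewrite -ek -ex; exact: b.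
  split=> //; split; [exact: J' | by exists R |].
  (* If the parent of [R] were [P], then [R] would be the child at the same end as [x], hence [x]
     itself. If it were in [s1], its block, and [R] with it, would have been visited. *)
  rewrite inE negb_or; apply/andP; split.
    apply: contraNneq RV => eP; rewrite eR eP ex ek; exact: mem_head.
  apply: contra RV => Rs1; rewrite inE eV mem_cat; apply/or3P; constructor 2.
  apply/(mem_weave C_rects) => //.
  by move=> Q Qs; apply: sC; rewrite mem_cat Qs.
have := IHn _ s1 P s2 Cr' zC' es; rewrite eW.
case: s2 es sC {eW} => [|P2 s2] es sC /=.
  by move=> none o' j' R /lower[_ /none].
case=> o1 [j1 [J1 uni]].
have CP2 : (@parent F @` C)%classic P2.
  by apply: sC; rewrite mem_cat !inE eqxx !orbT.
have [K2 eK2] := indices_ends ends (opposite o) CP2.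
rewrite /block eK2 /= oppositeK; exists o1, j1; split.
  have yP := end_index_bounds o P2.
  apply: minimal_jump_lower_conv => //.
  - by rewrite nrects_child // (parents_rects C_rects CP2).
  - by rewrite ex ek; exact: co_based_child.
  by rewrite px parent_child.
move=> o' j' R /lower[_ /uni[lt|[-> -> eP]] eR]; first by left.
by right; split=> //; rewrite eR eP.
Qed.

(** A state of Algorithm J lists the earlier rectangulations with the latest one first, hence
    [rev V]. *)
Lemma J_outputs n C V x W : (C `<=` rects n.+1)%classic -> zigzag n.+1 C ->
  visits n.+1 C = rev V ++ x :: W ->
  outputs (@J_step F n.+1 C) (fun st => ~ exists t, J_step n.+1 C st t) fst (x, V) (x :: W).
Proof.
move=> Cr zC; have [u m _ _] := visits_spec Cr zC.
have candE V0 x0 o j R : J_candidate n.+1 C (x0, V0) o j R <->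
    candidate n.+1 C (rev V0) x0 o j R.
  rewrite /J_candidate /candidate /=.
  by rewrite !inE mem_rev.
elim: W x V => [|y W IHW] x V e; have fc := J_forced_visits Cr zC e.
  apply: outputs_final => -[t [_ [o [j [/candE cand _ _]]]]].
  exact: fc cand.
case: fc => o [j [J uni]].
have yV : y \notin x :: V.
  move: u; rewrite e cat_uniq => /and3P[_ /hasPn yV /= /andP[xW _]].
  rewrite inE negb_or; apply/andP; split.
    by apply: contraNneq xW => <-; exact: mem_head.
  by have := yV y; rewrite !inE eqxx orbT mem_rev => /(_ isT).
have Cy : C y by apply/m; rewrite e mem_cat !inE eqxx !orbT.
have candy : J_candidate n.+1 C (x, V) o j y by [].
have next : J_step n.+1 C (x, V) (y, x :: V).
  split=> //; exists o, j; split=> //.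
    by move=> o' j' R /candE /uni[/ltnW|[-> _ _]].
  by move=> R /candE /uni[|[_ eo _]]; rewrite ?ltnn //; case: (o) eo.
have e' : visits n.+1 C = rev (x :: V) ++ y :: W by rewrite rev_cons cat_rcons.
apply: outputs_step; first by apply; exists (y, x :: V).
  by exists (y, x :: V).
move=> [t1 t2] [/= -> [o' [j' [/candE /uni c mx _]]]].
case: c => [lt|[_ _ ->]]; last exact: IHW.
by have := mx _ _ _ candy; rewrite leqNgt lt.
Qed.

End Outputs.

Theorem theorem8 (F : realFieldType) (n : nat) (C : set (rclass F))
    (n_ge1 : (1 <= n)%N) (C_rects : (C `<=` rects n)%classic)
    (C_zigzag : zigzag n C) :
  exists L : seq (rclass F),
    [/\ M_output n C L, J_output n C L, uniq L &
        forall R : rclass F, R \in L <-> C R].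
Proof.
case: n n_ge1 C_rects C_zigzag => // n _ Cr zC.
have [u m hd run] := visits_spec Cr zC.
exists (visits n.+1 C); split=> //.
  by apply: M_run_outputs run _ => x /m.
case: (visits n.+1 C) hd (@J_outputs F n C [::] (id_rect F n.+1)) => //= x s [->] J.
exact: J.
Qed.
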